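(* Let $P$ be a framed $4$-graph. Then $P$ is non-planar if and only if $\Gamma$ is a minor of $P$ or $\Delta$ is a minor of $P$. Alternatively, $P$ is non-planar if and only if $\Gamma$ is an $s$-minor of $P$.
   Context: All graphs are finite; loops and multiple edges are allowed. A $4$-graph is a regular $4$-valent graph which, besides ordinary components, may also have circular components (circles without vertices, each regarded as a single ''circular edge''). A $4$-graph is framed if at each vertex the four incident half-edges are split into two pairs; the half-edges in the same pair are called opposite, and two half-edges at the same vertex that are not opposite are called adjacent. Framed $4$-graphs are considered up to isomorphism preserving the framing. Planarity: an embedding of a framed $4$-graph in a $2$-surface is always assumed to preserve the framing, i.e. half-edges opposite at a vertex are locally opposite on the surface (they are not neighbours in the cyclic order around the vertex). A framed $4$-graph is planar if it admits such an embedding in $\mathbb{R}^2$, and non-planar otherwise. Smoothing: at a vertex $X$ of a framed $4$-graph there are exactly two ways of pairing the four half-edges into two pairs of adjacent half-edges. For each of these pairings, the corresponding smoothing at $X$ is the framed $4$-graph obtained by removing $X$ and pasting together the two half-edges of each pair (circular components may arise); the framing at all other vertices is unchanged. Minor: a framed $4$-graph $G'$ is a minor of a framed $4$-graph $G$ if $G'$ can be obtained from $G$ by a (possibly empty) sequence of smoothings at vertices and deletions of connected components. $s$-minor: a framed $4$-graph $G'$ is an $s$-minor of a framed $4$-graph $G$ if $G'$ can be obtained from $G$ by a (possibly empty) sequence of the following operations: (1) passing to a subgraph all of whose vertices have even valency and then deleting all vertices of valency $2$ (the two half-edges at such a vertex, whether opposite or adjacent, are merged into one edge or circular component), the $4$-valent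 vertices of the subgraph keeping their framing; (2) removing connected components; (3) smoothings at vertices. The graph $\Gamma$: the framed $4$-graph with exactly one vertex and two loops such that for each loop its two half-edges are opposite to each other at the vertex. The graph $\Delta$: the framed $4$-graph with exactly three vertices, in which every two distinct vertices are connected by exactly two edges (six edges in total), and at each vertex the two half-edges of the two edges leading to the same neighbouring vertex are opposite. *)

(* Defs.v *)
From HB Require Import structures.
From mathcomp Require Import all_boot all_order all_algebra.

Set Implicit Arguments.
Unset Strict Implicit.
Unset Printing Implicit Defensive.

(* The darts are the half-edges: [edge] sends a half-edge to the other half of
   its edge (so loops and multiple edges are allowed), [vert] to the vertex it
   is incident to, and [opp] to its opposite half-edge.  The circular
   components carry no structure, so only their number [ncirc] is recorded. *)
Record framed4graph := Framed4Graph {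
  vertex : finType;
  dart : finType;
  vert : dart -> vertex;
  edge : dart -> dart;
  opp : dart -> dart;
  ncirc : nat;
  edgeK : involutive edge;
  edge_neq : forall d, edge d != d;
  oppK : involutive opp;
  opp_neq : forall d, opp d != d;
  vert_opp : forall d, vert (opp d) = vert d;
  four_valent : forall v, #|[set d | vert d == v]| = 4
}.

Definition isomorphic (G G' : framed4graph) : Prop :=
  exists (fv : vertex G -> vertex G') (fd : dart G -> dart G'),
    [/\ bijective fv, bijective fd,
        forall d, vert (fd d) = fv (vert d),
        forall d, edge (fd d) = fd (edge d) /\ opp (fd d) = fd (opp d) &
        ncirc G = ncirc G'].

Section Pasting.
Variables (G : framed4graph) (K : {set dart G}) (W : {set vertex G}).
Variable (p : dart G -> dart G).

(* K is the set of half-edges of a subgraph of G, W is the set of vertices that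
   remain vertices; at the other vertices the half-edges of K are pasted
   together according to p. *)
Definition pairing : Prop :=
  forall d, d \in K -> vert d \notin W ->
    [/\ p d \in K, vert (p d) = vert d, p d != d & p (p d) = d].

Definition link : rel (dart G) := fun x y =>
  (y == edge x) || ((vert x \notin W) && (y == p x)).

(* The classes of half-edges chained together without meeting W. *)
Definition closed_chains : {set {set dart G}} :=
  [set [set y | connect link x y] |
    x in [set x in K | [forall y, connect link x y ==> (vert y \notin W)]]].

(* G' is isomorphic to the result of the pasting, c being the number of
   circular components of G that are kept.  Under the [pairing] hypothesis a
   chain is a path or a cycle: it contains either exactly two half-edges
   incident to W, which become the two halves of an edge of G', or none, and
   then it becomes a circular component of G'. *)
Definition pasted (c : nat) (G' : framed4graph) : Prop :=
  exists (fv : vertex G' -> vertex G) (fd : dart G' -> dart G),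
    [/\ injective fv /\ fv @: [set: vertex G'] = W,
        injective fd /\ fd @: [set: dart G'] = [set d in K | vert d \in W],
        forall d, vert (fd d) = fv (vert d) /\ opp (fd d) = fd (opp d),
        forall x y, edge x = y <-> x != y /\ connect link (fd x) (fd y) &
        ncirc G' = c + #|closed_chains|].

End Pasting.

Definition smoothing (G G' : framed4graph) : Prop :=
  exists (X : vertex G) (p : dart G -> dart G),
    [/\ pairing [set: dart G] [set~ X] p,
        forall d, vert d = X -> p d != opp d &
        pasted [set: dart G] [set~ X] p (ncirc G) G'].

Definition adjacent (G : framed4graph) : rel (vertex G) := fun v w =>
  [exists d : dart G, (vert d == v) && (vert (edge d) == w)].

(* The first disjunct deletes the component of the vertex v0, the second one
   deletes a circular component.  Nothing is pasted, so the pairing is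
   irrelevant. *)
Definition component_deletion (G G' : framed4graph) : Prop :=
  (exists v0 : vertex G,
     let W := [set v | ~~ connect (@adjacent G) v0 v] in
     pasted [set d | vert d \in W] W id (ncirc G) G') \/
  (exists2 c, ncirc G = c.+1 &
     pasted [set: dart G] [set: vertex G] id c G').

(* A vertex meeting no half-edge of K is not in the subgraph: an isolated
   vertex cannot occur in the resulting 4-graph.  At a vertex of valency 2, p
   is forced to exchange the two half-edges. *)
Definition even_subgraph (G G' : framed4graph) : Prop :=
  exists (K : {set dart G}) (p : dart G -> dart G) (c : nat),
    let val v := #|[set d in K | vert d == v]| in
    let W := [set v | val v == 4] in
    [/\ forall d, d \in K -> edge d \in K,
        forall v, ~~ odd (val v),
        pairing K W p, c <= ncirc G &
        pasted K W p c G'].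

Inductive minor (G' : framed4graph) : framed4graph -> Prop :=
| minor_iso G : isomorphic G G' -> minor G' G
| minor_smoothing G G1 : smoothing G G1 -> minor G' G1 -> minor G' G
| minor_component G G1 : component_deletion G G1 -> minor G' G1 -> minor G' G.

Inductive sminor (G' : framed4graph) : framed4graph -> Prop :=
| sminor_iso G : isomorphic G G' -> sminor G' G
| sminor_subgraph G G1 : even_subgraph G G1 -> sminor G' G1 -> sminor G' G
| sminor_component G G1 :
    component_deletion G G1 -> sminor G' G1 -> sminor G' G
| sminor_smoothing G G1 : smoothing G G1 -> sminor G' G1 -> sminor G' G.

(* The half-edge (l, b) is the end b of the loop l. *)
Section Gamma.
Let D : finType := (bool * bool)%type.
Let swap (d : D) : D := (d.1, ~~ d.2).

Let swapK : involutive swap.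
Proof. by case=> a b; rewrite /swap /= negbK. Qed.
Let swap_neq d : swap d != d.
Proof. by case: d => [[] []]. Qed.
Let Gamma_valent (v : unit) : #|[set d : D | tt == v]| = 4.
Proof.
case: v; rewrite (_ : [set d : D | _] = setT); last by apply/setP=> d; rewrite !inE.
by rewrite cardsT card_prod card_bool.
Qed.

Definition Gamma : framed4graph :=
  @Framed4Graph unit D (fun=> tt) swap swap 0
    swapK swap_neq swapK swap_neq (fun=> erefl) Gamma_valent.
End Gamma.

(* The half-edge (v, s, t) is incident to v; it leads to the cyclic successor
   of v if s, to its predecessor otherwise, and t distinguishes the two edges
   leading there. *)
Section Delta.
Let D : finType := ('I_3 * bool * bool)%type.
Let Dedge (d : D) : D :=
  let: (v, s, t) := d in (if s then ordS v else ord_pred v, ~~ s, t).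
Let Dopp (d : D) : D := let: (v, s, t) := d in (v, s, ~~ t).

Let DedgeK : involutive Dedge.
Proof. by case=> [[v []] t] /=; rewrite ?ordSK ?ord_predK. Qed.
Let Dedge_neq d : Dedge d != d.
Proof. by case: d => [[v []] t]; rewrite /= !xpair_eqE /= andbF. Qed.
Let DoppK : involutive Dopp.
Proof. by case=> [[v s] t] /=; rewrite negbK. Qed.
Let Dopp_neq d : Dopp d != d.
Proof. by case: d => [[v s] []]; rewrite /= !xpair_eqE /= andbF. Qed.
Let Dvert_opp d : (Dopp d).1.1 = d.1.1.
Proof. by case: d => [[v s] t]. Qed.
Let Delta_valent (v : 'I_3) : #|[set d : D | d.1.1 == v]| = 4.
Proof.
rewrite (_ : [set d : D | _] = setX (setX [set v] setT) setT).
  by rewrite !cardsX cards1 !cardsT card_bool.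
by apply/setP=> -[[w s] t]; rewrite !inE /= !andbT.
Qed.

Definition Delta : framed4graph :=
  @Framed4Graph 'I_3 D (fun d => d.1.1) Dedge Dopp 0
    DedgeK Dedge_neq DoppK Dopp_neq Dvert_opp Delta_valent.
End Delta.

(* Imported only here: it shadows the finite-set constants used above. *)
From mathcomp Require Import all_classical all_reals all_analysis.
Import Order.TTheory GRing.Theory Num.Theory.
Import numFieldNormedType.Exports.
Local Open Scope classical_set_scope.
Local Open Scope ring_scope.

Section Planarity.
Variable R : realType.
Local Notation plane := (R * R)%type.

(* f is a homeomorphism from the open set U onto the open set V, with inverse
   g; the values of f outside U and of g outside V are irrelevant. *)
Definition homeo_between (U V : set plane) (f g : plane -> plane) : Prop :=
  [/\ open U /\ open V,
      forall x, U x -> V (f x) /\ g (f x) = x,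
      forall y, V y -> U (g y) /\ f (g y) = y,
      forall x, U x -> {for x, continuous f} &
      forall y, V y -> {for y, continuous g}].

Definition starts_along (f : plane -> plane) (gamma : R -> plane) (u : plane) :
    Prop :=
  \forall t \near 0^'+, exists2 r : R, 0 < r &
    f (gamma t) = (r * u.1, r * u.2).

Variable G : framed4graph.

(* A continuous injective map from the (compact) geometric realization of G to
   the plane: [gamma d] parametrizes by [0, 1] the edge of d, starting at the
   end of d, and [kappa i] so parametrizes the i-th circular component. *)
Definition embedding (pos : vertex G -> plane) (gamma : dart G -> R -> plane)
    (kappa : 'I_(ncirc G) -> R -> plane) : Prop :=
  [/\ forall d, [/\ {within `[0, 1], continuous (gamma d)},
        gamma d 0 = pos (vert d) &
        forall t : R, 0 <= t <= 1 -> gamma (edge d) t = gamma d (1 - t)],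
      forall i, {within `[0, 1], continuous (kappa i)} /\
        kappa i 0 = kappa i 1,
      injective pos /\
        (forall d v (t : R), 0 < t < 1 -> gamma d t <> pos v),
      forall d d' (t t' : R), 0 < t < 1 -> 0 < t' < 1 ->
        gamma d t = gamma d' t' ->
        (d' = d /\ t' = t) \/ (d' = edge d /\ t' = 1 - t) &
      (forall i j (t t' : R), 0 <= t < 1 -> 0 <= t' < 1 ->
        kappa i t = kappa j t' -> i = j /\ t = t') /\
      (forall i d (t t' : R), 0 <= t <= 1 -> 0 <= t' <= 1 ->
        kappa i t <> gamma d t')].

(* In suitable local coordinates at the vertex v, its four half-edges start
   along the four half-axes, opposite half-edges along opposite half-axes. *)
Definition framing_preserved (pos : vertex G -> plane)
    (gamma : dart G -> R -> plane) (v : vertex G) : Prop :=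
  exists (U V : set plane) (f g : plane -> plane) (a b : dart G),
    [/\ homeo_between U V f g, U (pos v) /\ f (pos v) = (0, 0),
        [/\ vert a = v, vert b = v, b <> a & b <> opp a],
        starts_along f (gamma a) (1, 0) /\
        starts_along f (gamma (opp a)) (-1, 0) &
        starts_along f (gamma b) (0, 1) /\
        starts_along f (gamma (opp b)) (0, -1)].

Definition planar : Prop :=
  exists (pos : vertex G -> plane) (gamma : dart G -> R -> plane)
    (kappa : 'I_(ncirc G) -> R -> plane),
    embedding pos gamma kappa /\ forall v, framing_preserved pos gamma v.

End Planarity.

(* Main.v *)
(* If Gamma is an s-minor, then P contains two closed curves that cross exactly
   once and otherwise only touch; the winding number of the first around the
   points of the second would jump exactly once along a closed curve, so that P
   is not planar.  Delta contains Gamma as an s-minor.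

   Conversely, choose one smoothing at every vertex so that as few circuits as
   possible remain.  If Gamma is not a minor, every circuit passes twice through
   each of its vertices, in the same direction, and so is a chord diagram.  Let
   the interlaced chords be adjacent: an odd closed walk can be shortened by
   pivoting at two consecutive chords until three pairwise interlaced ones are
   left, which give the minor Delta.  Otherwise the chords are 2-coloured, those
   of one colour are drawn on one side of the circuit without crossings, and
   contracting each chord to a point draws P in the plane. *)

Require Import Defs.
From mathcomp Require Import all_boot all_order all_algebra.
From mathcomp Require Import reals.
From mathcomp Require Import zify.
(* Imported again: mathcomp has its own [opp] *)
Require Import Defs.

Set Implicit Arguments.
Unset Strict Implicit.
Unset Printing Implicit Defensive.

(** * Crossing circuits *)

(** The two crossing circuits are what is transported along s-minors, because every operation is a
    pasting and a circuit of the result lifts to one of the original graph. Embeddings are merely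
    continuous, with topological charts at the vertices, so the jump of the winding number cannot be
    read off from tangents. It is obtained by deforming the two branches at the crossing into
    antipodal pairs [(v / 2, - v / 2)]: for an injective [g] the field [g (v / 2) - g (- v / 2)] is
    odd and nowhere zero, so its argument changes by an odd multiple of pi over half a loop, as in
    Borsuk's theorem. In the other direction a pivot has to be realized on the framed graph and not
    only on the interlacement graph: changing the smoothing at two interlaced chords rearranges the
    circuit into one that still runs twice in the same direction through each of its vertices. The
    drawing is piecewise linear with explicit constants, so that non-crossing reduces to linear
    arithmetic over integer sites at distance at least 1. *)

Lemma mem_vertex4 (G : framed4graph) (s : seq (dart G)) (v : vertex G) :
  uniq s -> size s = 4 -> {in s, forall d, vert d = v} ->
  forall d, vert d = v -> d \in s.
Proof.
move=> us ss sv d dv.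
have sub : [set x in s] \subset [set d | vert d == v].
  by apply/subsetP=> x; rewrite !inE => /sv ->.
have /eqP/setP/(_ d) : [set x in s] == [set d | vert d == v].
  by rewrite eqEcard sub four_valent cardsE (card_uniqP us) ss.
by rewrite !inE dv eqxx.
Qed.

Lemma opp_inj (G : framed4graph) : injective (@opp G).
Proof. exact: can_inj (@oppK G). Qed.

Lemma edge_inj (G : framed4graph) : injective (@edge G).
Proof. exact: can_inj (@edgeK G). Qed.

Lemma mem_vertex_opp (G : framed4graph) (a b d : dart G) :
  vert b = vert a -> b != a -> b != opp a -> vert d = vert a ->
  d \in [:: a; opp a; b; opp b].
Proof.
move=> ba nba nbo da; apply: (@mem_vertex4 _ _ (vert a)) => //.
  have nb : opp b != a by rewrite (inv_eq (@oppK G)).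
  have ao := opp_neq a; have bo := opp_neq b.
  rewrite /= !inE !negb_or (inj_eq (@opp_inj G)).
  rewrite !(eq_sym a) !(eq_sym _ b).
  by rewrite ao nba nb nbo ?(eq_sym b) bo.
by move=> x; rewrite !inE => /or4P[] /eqP ->; rewrite ?vert_opp.
Qed.

(* Two half-edges are in the same class when a curve following the edges and
   turning from [d] to [q d] at the vertices joins them. *)
Definition strand (G : framed4graph) (q : dart G -> dart G) : rel (dart G) :=
  fun x y => (y == edge x) || (y == q x).

Lemma strand_sym (G : framed4graph) (q : dart G -> dart G) :
  involutive q -> connect_sym (strand q).
Proof.
move=> qK; apply/sym_connect_sym => x y; rewrite /strand.
by rewrite -(can_eq (@edgeK G)) edgeK -[y == q x](can_eq qK) qK !(eq_sym x).
Qed.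

(* The curves through [a] and [b] are disjoint closed curves that cross
   transversally at [vert a] and, [q] being nowhere [opp] at another common
   vertex, only touch elsewhere.  Fixed points of [q] are the half-edges that an
   s-minor has discarded. *)
Definition crossing_circuits (G : framed4graph) : Prop :=
  exists (q : dart G -> dart G) (a b : dart G),
    [/\ involutive q /\ (forall d, vert (q d) = vert d),
        [/\ vert a = vert b, q a = opp a & q b = opp b],
        ~~ connect (strand q) a b,
        forall d, connect (strand q) a d || connect (strand q) b d -> q d != d
      & forall c d, connect (strand q) a c -> connect (strand q) b d ->
          vert c = vert d -> q c = opp c -> vert c = vert a].

(** In [Gamma] the mate of a half-edge is also its opposite, so the strands of [opp] are the two
    loops; the loop label [(fd d).1] is constant along a strand and tells them apart. *)
Lemma Gamma_crossing_circuits (G : framed4graph) :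
  isomorphic G Gamma -> crossing_circuits G.
Proof.
case=> fv [fd [bfv [h fdK hK] vfd efd nc]].
have e1 (d : dart G) : edge d = opp d.
  by have [e1 e2] := efd d; rewrite -[LHS]fdK -e1 -[RHS]fdK -e2.
have v1 (v w : vertex G) : v = w.
  by apply: (bij_inj bfv); case: (fv v); case: (fv w).
have inv x y : connect (strand (@opp G)) x y -> (fd y).1 = (fd x).1.
  move=> /connectP[s]; elim: s x => [|z s IH] x /=; first by move=> _ ->.
  case/andP=> /orP xz /IH H /H ->.
  have -> : z = opp x by case: xz => /eqP ->.
  by case: (efd x) => _ <-.
exists (@opp G), (h (false, false)), (h (true, false)); split=> //.
- by split; [exact: oppK | exact: vert_opp].
- by apply/negP=> /inv; rewrite !hK.
- by move=> d _; exact: opp_neq.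
Qed.

(** Every operation is a pasting, so this pulls circuits back through all of them. The condition on
    [p] concerns only pasted vertices with all four half-edges kept: pasting opposite half-edges
    there could add a crossing, while with fewer half-edges kept the two circuits cannot both
    pass. *)
Lemma crossing_circuits_pasted (G G1 : framed4graph) (K : {set dart G})
    (W : {set vertex G}) (p : dart G -> dart G) (c : nat) :
  {in K, forall d, edge d \in K} -> pairing K W p ->
  (forall d, vert d \notin W -> (forall e, vert e = vert d -> e \in K) ->
     p d != opp d) ->
  pasted K W p c G1 -> crossing_circuits G1 -> crossing_circuits G.
Proof.
move=> eK pP pO [fv [fd [[fvI fvW] [fdI fdW] fdE edgeE _]]].
case=> [q1 [a1 [b1 [[q1K q1v] [ab1 qa1 qb1] nab1 nf1 cr1]]]].
have fdP d : reflect (exists x, d = fd x) ((d \in K) && (vert d \in W)).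
  move/setP/(_ d): fdW; rewrite !inE => <-.
  by apply: (iffP imsetP) => [[x _ ->]|[x ->]]; exists x.
have fdKW x : (fd x \in K) && (vert (fd x) \in W) by apply/fdP; exists x.
(* [q] follows [q1] at the surviving vertices and [p] at the pasted ones, and fixes what was
   discarded. *)
pose q d := if d \in K then
  if vert d \in W then if [pick x | fd x == d] is Some x then fd (q1 x) else d
  else p d else d.
have qfd x : q (fd x) = fd (q1 x).
  rewrite /q; case/andP: (fdKW x) => -> ->.
  by case: pickP => [y /eqP/fdI ->|/(_ x)]; rewrite ?eqxx.
have qp d : d \in K -> vert d \notin W -> q d = p d.
  by rewrite /q => -> /negbTE ->.
have qn d : d \notin K -> q d = d by rewrite /q => /negbTE ->.
have qK : involutive q.
  move=> d; case: (boolP (d \in K)) => dK; last by rewrite !qn.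
  case: (boolP (vert d \in W)) => dW.
    have /fdP[x ->] : (d \in K) && (vert d \in W) by rewrite dK dW.
    by rewrite !qfd q1K.
  by have [p1 p2 _ p4] := pP _ dK dW; rewrite (qp d) // qp ?p2.
have qv d : vert (q d) = vert d.
  case: (boolP (d \in K)) => dK; last by rewrite qn.
  case: (boolP (vert d \in W)) => dW.
    have /fdP[x ->] : (d \in K) && (vert d \in W) by rewrite dK dW.
    by rewrite qfd !(proj1 (fdE _)) q1v.
  by have [_ p2 _ _] := pP _ dK dW; rewrite qp.
have link_fd x y : connect (link W p) (fd x) (fd y) -> y = x \/ y = edge x.
  move=> xy; case: (eqVneq x y) => [->|nxy]; first by left.
  by right; apply/esym/edgeE.
(* A strand of [q] that starts in the result stays in [K] and is a strand of [q1] with each edge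
   replaced by its chain. *)
have cl x y : connect (strand q) (fd x) y -> y \in K /\
    exists2 z, connect (strand q1) x z & connect (link W p) (fd z) y.
  move=> /connectP[s]; elim/last_ind: s y => [|s z IH] y /=.
    move=> _ ->; split; first by case/andP: (fdKW x).
    by exists x; rewrite connect0.
  rewrite rcons_path last_rcons => /andP[/IH /(_ erefl)].
  set w := last _ _ => -[wK [u xu uw]] wz ->.
  case/orP: wz => /eqP ->.
    split; first exact: eK.
    exists u => //; apply: connect_trans uw (connect1 _).
    by rewrite /link eqxx.
  case: (boolP (vert w \in W)) => wW.
    have /fdP[w' ww] : (w \in K) && (vert w \in W) by rewrite wK wW.
    rewrite ww qfd; split; first by case/andP: (fdKW (q1 w')).
    exists (q1 w') => //; apply: (@connect_trans _ _ w'); last first.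
      by apply: connect1; rewrite /strand eqxx orbT.
    move: uw; rewrite ww => /link_fd[] -> //.
    by apply: connect_trans xu (connect1 _); rewrite /strand eqxx.
  have [p1 p2 _ _] := pP _ wK wW; rewrite qp //; split=> //.
  exists u => //; apply: connect_trans uw (connect1 _).
  by rewrite /link wW eqxx orbT.
have clfd x y : connect (strand q) (fd x) (fd y) -> connect (strand q1) x y.
  case/cl=> _ [z xz /link_fd[] -> //].
  by apply: connect_trans xz (connect1 _); rewrite /strand eqxx.
have nf x d : (forall y, connect (strand q1) x y -> q1 y != y) ->
    connect (strand q) (fd x) d -> q d != d.
  move=> nfx xd; have [dK _] := cl _ _ xd.
  case: (boolP (vert d \in W)) => dW; last first.
    by rewrite qp //; have [] := pP _ dK dW.
  have /fdP[w ww] : (d \in K) && (vert d \in W) by rewrite dK dW.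
  by move: xd; rewrite ww qfd (inj_eq fdI) => /clfd /nfx.
have nab : ~~ connect (strand q) (fd a1) (fd b1).
  by apply/negP=> /clfd; apply/negP.
have symq := strand_sym qK.
have stepq x y : connect (strand q) x y -> connect (strand q) x (q y).
  by move=> xy; apply: connect_trans xy (connect1 _); rewrite /strand eqxx orbT.
exists q, (fd a1), (fd b1); split=> //.
- by split; rewrite ?qfd ?qa1 ?qb1 ?(proj1 (fdE _)) ?(proj2 (fdE _)) ?ab1.
- move=> d /orP[]; apply: nf => y y1; apply: nf1; rewrite y1 ?orbT //.
move=> c0 d ac bd cd qc; have [cK _] := cl _ _ ac; have [dK _] := cl _ _ bd.
case: (boolP (vert c0 \in W)) => cW.
  have /fdP[c' cE] : (c0 \in K) && (vert c0 \in W) by rewrite cK cW.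
  have /fdP[d' dE] : (d \in K) && (vert d \in W) by rewrite dK -cd cW.
  move: ac bd cd qc; rewrite cE dE qfd !(proj1 (fdE _)) (proj2 (fdE _)).
  by move=> /clfd ac /clfd bd /fvI cd /fdI qc; rewrite (cr1 c' d').
have dW : vert d \notin W by rewrite -cd.
have [d1 d2 d3 _] := pP _ dK dW.
have nm u w : connect (strand q) (fd a1) u -> connect (strand q) (fd b1) w ->
    u != w.
  move=> au bw; apply: contra nab => /eqP uw.
  by apply: connect_trans au _; rewrite uw symq.
(* At a common pasted vertex the two circuits use four different half-edges, that is all of them, so
   [pO] applies. *)
suff : p c0 != opp c0 by rewrite -qc qp // eqxx.
apply: pO => // e ev.
have : e \in [:: c0; q c0; d; q d].
  apply: (@mem_vertex4 _ _ (vert c0)) => //=.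
    have nc : q c0 != c0 by apply: (nf a1) => // y y1; apply: nf1; rewrite y1.
    have nd : q d != d by apply: (nf b1) => // y y1; apply: nf1; rewrite y1 orbT.
    have := stepq _ _ ac; have := stepq _ _ bd => bd' ac'.
    rewrite /= !inE !negb_or (eq_sym c0 (q c0)) (eq_sym d) nc nd.
    by rewrite (nm _ _ ac bd) (nm _ _ ac bd') (nm _ _ ac' bd) (nm _ _ ac' bd').
  by move=> u; rewrite !inE => /or4P[] /eqP ->; rewrite ?qv.
rewrite !inE => /or4P[] /eqP -> //; rewrite qp //.
  by have [] := pP _ cK cW.
Qed.

Lemma sminor_Gamma_crossing_circuits (G : framed4graph) :
  sminor Gamma G -> crossing_circuits G.
Proof.
elim=> {G} [G /Gamma_crossing_circuits //|G G1 sG _|G G1 cG _|G G1 sG _].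
- case: sG => K [p [c []]] eK ev pP _ pas.
  apply: (crossing_circuits_pasted eK pP _ pas) => d.
  (* A vertex whose four half-edges are all kept has valency 4 and remains a vertex. *)
  rewrite inE => /negP nv ck; case: nv; apply/eqP.
  rewrite -[RHS](four_valent (vert d)); apply: eq_card => e.
  by rewrite !inE; case: (vert e =P vert d) => [/ck ->|]; rewrite ?andbF.
- case: cG => [[v0 pas]|[c nc pas]]; last first.
    by apply: (crossing_circuits_pasted _ _ _ pas)=> [d|d|d]; rewrite ?inE.

  apply: (crossing_circuits_pasted _ _ _ pas) => [d|d|d].
  + rewrite !inE; apply: contra => H; apply: connect_trans H (connect1 _).
    by apply/existsP; exists (edge d); rewrite edgeK !eqxx.
  + by rewrite inE => -> .
  + by move=> nW /(_ d erefl); rewrite inE (negbTE nW).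
- case: sG => X [p [pP pO pas]].
  apply: (crossing_circuits_pasted _ pP _ pas) => [//|d dW _].
  by apply: pO; apply/eqP; move: dW; rewrite !inE negbK.
Qed.

Section Turn.
Variables (G : framed4graph) (q : dart G -> dart G).
Hypothesis qK : involutive q.

(* [turn] orbits run along the strands of [q] in a fixed direction. *)
Definition turn (d : dart G) : dart G := q (edge d).

Lemma turn_inj : injective turn.
Proof. by apply: inj_comp; [exact: can_inj qK | exact: edge_inj]. Qed.

Lemma turn_strand x y : fconnect turn x y -> connect (strand q) x y.
Proof.
move/iter_findex <-; elim: (findex _ _ _) => [|n IH] //=.
apply: connect_trans IH _; apply: (@connect_trans _ _ (edge (iter n turn x))).
  by apply: connect1; rewrite /strand eqxx.
by apply: connect1; rewrite /strand eqxx orbT.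
Qed.

(** The orbit holds the half-edges along which the curve leaves a vertex, and their mates are those
    along which it arrives; together they make up the strand. *)
Lemma strand_turn x y : connect (strand q) x y ->
  fconnect turn x y \/ fconnect turn x (edge y).
Proof.
have symt := fconnect_sym turn_inj.
move=> /connectP[s]; elim/last_ind: s y => [|s z IH] y /=.
  by move=> _ ->; left; rewrite connect0.
rewrite rcons_path last_rcons => /andP[/IH /(_ erefl)].
set w := last _ _ => xw wz ->.
have tq : turn (edge (q w)) = w by rewrite /turn edgeK qK.
case/orP: wz => /eqP ->; first by rewrite edgeK; case: xw; [right | left].
case: xw => xw; [right | left]; apply: connect_trans xw _.
  by rewrite symt -{2}tq; exact: fconnect1.
by rewrite (_ : q w = turn (edge w)) ?fconnect1 // /turn edgeK.
Qed.

(** No curve runs along an edge in both directions. If [edge d] is [n] steps after [d], then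
    [edge (turn d)] is [n - 2] steps after [turn d]; the descent ends at [edge d = d] or at a fixed
    point of [q]. *)
Lemma turn_edge x y : (forall d, connect (strand q) x d -> q d != d) ->
  fconnect turn x y -> ~~ fconnect turn x (edge y).
Proof.
move=> nf xy; apply/negP => xe.
have symt := fconnect_sym turn_inj.
have ye : fconnect turn y (edge y) by apply: connect_trans xe; rewrite symt.
suff H n d : connect (strand q) x d -> edge d = iter n turn d -> False.
  by apply: (H (findex turn y (edge y)) y (turn_strand xy)); rewrite iter_findex.
elim/ltn_ind: n d => -[|[|n]] IH d xd /=.
- by move=> e; have := edge_neq d; rewrite e eqxx.
- have xe' : connect (strand q) x (edge d).
    by apply: connect_trans xd (connect1 _); rewrite /strand eqxx.
  by move=> e; have := nf _ xe'; rewrite {2}e eqxx.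
move=> e; apply: (IH n _ (turn d)) => //.
  by apply: connect_trans xd (turn_strand (fconnect1 _ _)).
apply: edge_inj; rewrite edgeK -iterSr /=; apply: (can_inj qK).
by rewrite -[RHS]/(turn (turn (iter n turn d))) -e /turn qK.
Qed.

End Turn.

(** * States and smoothings *)

(* A state picks one smoothing at every vertex: [p] pastes [d] to [p d]. *)
Definition state (G : framed4graph) (p : dart G -> dart G) : Prop :=
  [/\ involutive p, forall d, vert (p d) = vert d,
      forall d, p d != d & forall d, p d != opp d].

Section State.
Variables (G : framed4graph) (p : dart G -> dart G).
Hypothesis sp : state p.

Lemma stateK : involutive p. Proof. by case: sp. Qed.
Lemma state_vert d : vert (p d) = vert d. Proof. by case: sp. Qed.
Lemma state_neq d : p d != d. Proof. by case: sp. Qed.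
Lemma state_opp_neq d : p d != opp d. Proof. by case: sp. Qed.

Lemma state_mem d e : vert e = vert d -> e \in [:: d; opp d; p d; opp (p d)].
Proof. by apply: mem_vertex_opp; rewrite ?state_vert ?state_neq ?state_opp_neq. Qed.

(** With four half-edges at the vertex, pairing [d] with [p d] leaves only [opp d] and [opp (p d)]
    for each other. *)
Lemma state_opp d : p (opp d) = opp (p d).
Proof.
have /state_mem : vert (p (opp d)) = vert d by rewrite state_vert vert_opp.
rewrite !inE (negbTE (state_neq (opp d))) => /or4P[] // /eqP e.
- by have := state_opp_neq (opp d); rewrite e oppK eqxx.
- by have := opp_neq d; rewrite (can_inj stateK e) eqxx.
- exact: e.
Qed.
End State.

Lemma pasted_edge (G G1 : framed4graph) (W : {set vertex G}) (p : dart G -> dart G)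
    (fd : dart G1 -> dart G) :
  (forall x, connect (link W p) (fd x) (fd (edge x))) ->
  (forall x y, connect (link W p) (fd x) (fd y) -> y = x \/ y = edge x) ->
  forall x y, edge x = y <-> x != y /\ connect (link W p) (fd x) (fd y).
Proof.
move=> h1 h2 x y; split=> [<-|[xy /h2[yx|->//]]]; first by rewrite eq_sym edge_neq.
by rewrite yx eqxx in xy.
Qed.

Lemma connect_link_setT (G : framed4graph) (p : dart G -> dart G) x y :
  connect (link [set: vertex G] p) x y -> y = x \/ y = edge x.
Proof.
move=> /connectP[s]; elim/last_ind: s y => [|s z IH] y /=; first by left.
rewrite rcons_path last_rcons => /andP[/IH /(_ erefl)].
rewrite /link inE /= orbF => h /eqP -> ->.
by case: h => ->; rewrite ?edgeK; [right | left].
Qed.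

Lemma closed_chains_setT (G : framed4graph) (K : {set dart G}) (p : dart G -> dart G) :
  closed_chains K [set: vertex G] p = set0.
Proof.
apply/setP=> C; rewrite [in RHS]inE; apply/negbTE/negP => /imsetP[x].
by rewrite inE => /andP[_ /forallP/(_ x)]; rewrite connect0 inE.
Qed.

(* Circular components never obstruct the search for [Gamma] and [Delta], so a
   minor may be built with any number of them. *)
Definition with_circles (G : framed4graph) (c : nat) : framed4graph :=
  @Framed4Graph (vertex G) (dart G) (@vert G) (@edge G) (@opp G) c
    (@edgeK G) (@edge_neq G) (@oppK G) (@opp_neq G) (@vert_opp G) (@four_valent G).

Lemma pasted_all (G G' : framed4graph) (fv : vertex G' -> vertex G)
    (fd : dart G' -> dart G) (p : dart G -> dart G) (c : nat) :
  bijective fv -> bijective fd -> (forall d, vert (fd d) = fv (vert d)) ->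
  (forall d, edge (fd d) = fd (edge d) /\ opp (fd d) = fd (opp d)) ->
  c = ncirc G' -> pasted [set: dart G] [set: vertex G] p c G'.
Proof.
move=> bv bd hv hd ->; exists fv, fd; split.
- split; [exact: bij_inj | apply/setP=> v; rewrite inE].
  by apply/imsetP; case: bv => h _ hK; exists (h v); rewrite ?hK.
- split; [exact: bij_inj | apply/setP=> v; rewrite !inE].
  by apply/imsetP; case: bd => h _ hK; exists (h v); rewrite ?hK.
- by move=> d; split; [exact: hv | case: (hd d)].
- apply: pasted_edge => [x|x y].
    by apply: connect1; rewrite /link; case: (hd x) => -> _; rewrite eqxx.
  move=> /connect_link_setT; case: (hd x) => -> _.
  by case=> /(bij_inj bd); [left | right].
- by rewrite closed_chains_setT cards0 addn0.
Qed.

Lemma minor_with_circles (H G : framed4graph) (c : nat) :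
  c <= ncirc G -> minor H (with_circles G c) -> minor H G.
Proof.
have step n : minor H (with_circles G n) -> minor H (with_circles G n.+1).
  apply: minor_component; right; exists n => //.
  by apply: (@pasted_all _ (with_circles G n) id id) => //; exists id.
have GE : with_circles G (ncirc G) = G by case: G {step}.
move=> cG mH; rewrite -GE -(subnKC cG).
by elim: (_ - _) => [|n IH]; rewrite ?addn0 // addnS; exact: step.
Qed.

(** * Carrying a state through one smoothing *)

Section Smooth.
Variables (G : framed4graph) (X : vertex G) (p : dart G -> dart G).
Hypothesis sp : state p.
Let pK := stateK sp.

Let psi (d : dart G) : dart G := edge (p d).
Let psiI : injective psi.
Proof. by apply: inj_comp; [exact: edge_inj | exact: can_inj pK]. Qed.

(** The edge of the smoothed graph that starts at [x] ends at [y]: each [psi] passes once through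
    [X] and along the next edge, until another vertex is reached. *)
Definition first_return (x y : dart G) : Prop :=
  exists2 k, y = iter k psi (edge x) &
    vert y != X /\ forall i, i < k -> vert (iter i psi (edge x)) = X.

Definition next_dart (x : dart G) : dart G :=
  let stop i := vert (iter i psi (edge x)) != X in
  iter (find stop (iota 0 (order psi (edge x)))) psi (edge x).

(** The search stops within one [psi] orbit: the last element of the orbit of [edge x] is pasted to
    [x], so it is not at [X]. *)
Lemma next_dartP x : vert x != X -> first_return x (next_dart x).
Proof.
move=> xX; rewrite /next_dart; set stop := fun i => _; set s := iota _ _.
have hs : has stop s.
  apply/hasP; exists (order psi (edge x)).-1.
    by rewrite mem_iota /= add0n prednK ?order_gt0.
  have := iter_order psiI (edge x); rewrite -(prednK (order_gt0 psi (edge x))) iterS.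
  rewrite /= {1}/psi => /(@edge_inj G) e.
  by rewrite /stop -(state_vert sp) e.
have fs : find stop s < order psi (edge x) by rewrite -[ltnRHS](size_iota 0) -has_find.
exists (find stop s) => //; split; first by have := nth_find 0 hs; rewrite nth_iota.
move=> i lt_i; have := before_find 0 lt_i; rewrite nth_iota ?add0n.
  by move=> /negbT; rewrite negbK => /eqP.
exact: ltn_trans fs.
Qed.

Lemma first_return_uniq x y z : first_return x y -> first_return x z -> y = z.
Proof.
move=> [k -> [kX kP]] [j -> [jX jP]]; case: (ltngtP k j) => [kj|jk|-> //].
  by rewrite (jP _ kj) eqxx in kX.
by rewrite (kP _ jk) eqxx in jX.
Qed.

Lemma first_return_sym x y : vert x != X -> first_return x y -> first_return y x.
Proof.
move=> xX [k yE [yX kP]].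
have back j : j <= k -> iter j psi (edge y) = edge (iter (k - j) psi (edge x)).
  elim: j => [|j IH] jk; first by rewrite subn0 -yE.
  rewrite iterS IH; last by lia.
  have -> : k - j = (k - j.+1).+1 by lia.
  by rewrite iterS {2}/psi edgeK /psi pK.
exists k; first by rewrite back // subnn edgeK.
split=> // i ik; rewrite back; last by lia.
have -> : k - i = (k - i.+1).+1 by lia.
by rewrite iterS /psi edgeK (state_vert sp) kP //; lia.
Qed.

(** One step of the new [turn] amounts to [k + 1] steps of the old one, the intermediate ones all at
    [X]: the curves of the state are unchanged except that their visits to [X] are dropped. *)
Lemma first_return_turn x y : first_return x y ->
  exists k, p y = iter k.+1 (turn p) x /\
    forall i, 0 < i <= k -> vert (iter i (turn p) x) = X.
Proof.
have E i : iter i.+1 (turn p) x = p (iter i psi (edge x)).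
  by elim: i => [|i IH] //; rewrite iterS IH.
move=> [k -> [_ kP]]; exists k; split=> [|[//|i] ik]; first by rewrite E.
by rewrite E (state_vert sp) kP.
Qed.

(** Otherwise the curve through [x] would also run backwards along its edge, against [turn_edge]. *)
Lemma first_return_neq x y : vert x != X -> first_return x y -> y != x.
Proof.
move=> xX /first_return_turn[k [e _]]; apply/eqP => yx.
have nf d : connect (strand p) x d -> p d != d by move=> _; exact: state_neq.
have /negP := turn_edge pK nf (connect0 _ x); apply.
have E : p x = turn p (edge x) by rewrite /turn edgeK.
apply: (@connect_trans _ _ (p x)).
  by rewrite yx in e; rewrite e; exact: fconnect_iter.
by rewrite (fconnect_sym (turn_inj pK)) E; exact: fconnect1.
Qed.

Let vtx : finType := {v : vertex G | v != X}.
Let drt : finType := {d : dart G | vert d != X}.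
Let svert (d : drt) : vtx := Sub (vert (val d)) (valP d).
Let sopp_sub (d : drt) : vert (opp (val d)) != X.
Proof. by rewrite vert_opp; exact: (valP d). Qed.
Let sopp (d : drt) : drt := Sub (opp (val d)) (sopp_sub d).

(** The half-edges away from [X], with first returns as edges, form the smoothed graph; the state
    restricts to it, and [turn p1] is the first return map of [turn p]. This is the induction step
    in the search for both [Gamma] and [Delta]. *)
Lemma smooth_state : exists (G1 : framed4graph) (p1 : dart G1 -> dart G1)
    (fv : vertex G1 -> vertex G) (fd : dart G1 -> dart G),
  [/\ smoothing G G1 /\ state p1,
      injective fv /\ (forall v, fv v != X),
      injective fd /\ (forall d, vert d != X -> exists e, d = fd e),
      forall d, [/\ vert (fd d) = fv (vert d), vert (fd d) != X,
                    opp (fd d) = fd (opp d) & p (fd d) = fd (p1 d)] &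
      forall d, exists k, fd (turn p1 d) = iter k.+1 (turn p) (fd d) /\
        forall i, 0 < i <= k -> vert (iter i (turn p) (fd d)) = X].
Proof.
(* The default [d] of [insubd] is never taken, as [next_dart] ends away from [X]. *)
pose sedge (d : drt) : drt := insubd d (next_dart (val d)).
have sedgeP (d : drt) : first_return (val d) (val (sedge d)).
  have fr := next_dartP (valP d); rewrite /sedge val_insubd.
  by case: ifP => // /negbT /negP[]; case: fr => k _ [].
pose sp1 (d : drt) : drt := insubd d (p (val d)).
have sp1E d : val (sp1 d) = p (val d).
  by have dX : vert (val d) != X := valP d; rewrite /sp1 val_insubd (state_vert sp) dX.
have sedgeK : involutive sedge.
  move=> d; apply: val_inj; apply: first_return_uniq (sedgeP _) _.
  exact: first_return_sym (valP d) (sedgeP d).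
have sedge_neq d : sedge d != d.
  by rewrite -val_eqE; exact: first_return_neq (valP d) (sedgeP d).
have soppK : involutive sopp by move=> d; apply: val_inj; rewrite /= oppK.
have sopp_neq d : sopp d != d by rewrite -val_eqE opp_neq.
have svert_opp d : svert (sopp d) = svert d by apply: val_inj; rewrite /= vert_opp.
have sfour v : #|[set d | svert d == v]| = 4.
  rewrite -(four_valent (val v)) -(card_imset _ val_inj); apply: eq_card => d.
  rewrite inE; apply/imsetP/eqP => [[e]|dv].
    by rewrite inE => /eqP <- ->.
  have dX : vert d != X by rewrite dv; exact: (valP v).
  by exists (Sub d dX : drt); rewrite ?inE // -val_eqE /= dv.
pose cc := closed_chains [set: dart G] [set~ X] p.
pose G1 := @Framed4Graph vtx drt svert sedge sopp (ncirc G + #|cc|)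
  sedgeK sedge_neq soppK sopp_neq svert_opp sfour.
have fdP (d : dart G) : vert d != X -> exists e : drt, d = val e.
  by move=> dX; exists (Sub d dX); rewrite SubK.
have fvP (v : vertex G) : v != X -> exists w : vtx, v = val w.
  by move=> vX; exists (Sub v vX); rewrite SubK.
exists G1, sp1, val, val; split.
- split; last first.
    split=> d.
    + by apply: val_inj; rewrite !sp1E pK.
    + by apply: val_inj; rewrite /= sp1E (state_vert sp).
    + by rewrite -val_eqE sp1E (state_neq sp).
    + by rewrite -val_eqE sp1E (state_opp_neq sp).
  exists X, p; split.
  + move=> d _ _; rewrite inE (state_vert sp) (state_neq sp); split=> //; exact: pK.
  + by move=> d _; exact: state_opp_neq.
  exists val, val; split=> //.
  + split; [exact: val_inj | apply/setP=> v; rewrite !inE].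
    by apply/imsetP/idP => [[w _ ->]|/fvP[w ->]]; [exact: (valP w) | exists w].
  + split; [exact: val_inj | apply/setP=> d; rewrite !inE].
    by apply/imsetP/idP => [[w _ ->]|/fdP[w ->]]; [exact: (valP w) | exists w].
  pose L := link [set~ X] p.
  have Ledge z : L z (edge z) by rewrite /L /link eqxx.
  have Lp z : vert z = X -> L z (p z) by rewrite /L /link !inE => ->; rewrite !eqxx orbT.
  apply: pasted_edge => x; have [k xk [yX kP]] := sedgeP x.
    rewrite -/L /= xk; elim: k {xk} kP => [|k IH] kP; first exact: connect1.
    apply: connect_trans (IH _) _; first by move=> i ik; apply: kP; lia.
    apply: (@connect_trans _ _ (p (iter k psi (edge (val x))))).
      by apply: connect1; apply: Lp; apply: kP.
    exact: connect1.
  (* The chain of [x] is listed completely: [x], the [psi] iterates up to the end [k], and the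
     partners at [X] of the earlier ones. *)
  move=> y; suff I z : connect L (val x) z -> [\/ z = val x,
      exists2 i, i <= k & z = iter i psi (edge (val x)) |
      exists2 i, i < k & z = p (iter i psi (edge (val x)))].
    move=> /I[e|[i ik e]|[i ik e]].
    - by left; exact: val_inj.
    - right; apply: val_inj; rewrite e /= xk; congr (iter _ _ _).
      apply/eqP; rewrite eqn_leq ik leqNgt; apply/negP => /kP iX.
      by have := valP y; rewrite /= e iX eqxx.
    - by have := valP y; rewrite /= e (state_vert sp) kP ?eqxx.
  move=> /connectP[s]; elim/last_ind: s z => [|s w IH] z /=; first by constructor 1.
  rewrite rcons_path last_rcons => /andP[/IH /(_ erefl)].
  set u := last _ _ => uP uw ->; move: uw; rewrite /L /link !inE negbK.
  case: uP => [->|[i ik ->]|[i ik ->]] /orP[/eqP ->|/andP[/eqP uX /eqP ->]].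
  - by constructor 2; exists 0.
  - by have := valP x; rewrite /= uX eqxx.
  - case: i ik => [|i] ik; first by rewrite edgeK; constructor 1.
    by constructor 3; exists i => //; rewrite iterS /psi edgeK.
  - constructor 3; exists i => //; rewrite ltn_neqAle ik andbT.
    by apply/eqP => ek; move: uX; rewrite ek -xk => yX'; rewrite yX' eqxx in yX.
  - by constructor 2; exists i.+1.
  - by rewrite pK; constructor 2; exists i; rewrite // ltnW.
- by split; [exact: val_inj | move=> v; exact: (valP v)].
- by split; [exact: val_inj |].
- by move=> d; split=> //; exact: (valP d).
by move=> d; have [k [e kP]] := first_return_turn (sedgeP d); exists k; rewrite /turn sp1E.
Qed.
End Smooth.

Lemma surj_inj_bij (S T : finType) (h : S -> T) :
  injective h -> (forall y, exists x, y = h x) -> bijective h.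
Proof.
move=> hI hS; apply: inj_card_bij => //; rewrite -(card_codom hI).
by apply: subset_leq_card; apply/subsetP => y _; have [x ->] := hS y; exact: codom_f.
Qed.

Lemma isomorphic_sym (G H : framed4graph) : isomorphic H G -> isomorphic G H.
Proof.
case=> fv [fd [[gv fvK gvK] [gd fdK gdK] hv hd nc]].
exists gv, gd; split=> [||d|d|]; [by exists fv | by exists fd | | | by []].
  by apply: (can_inj fvK); rewrite gvK -hv gdK.
by have [e1 e2] := hd (gd d); split; apply: (can_inj fdK); rewrite -?e1 -?e2 !gdK.
Qed.

(** All circles are discarded before comparing; the disjunction asks for the isomorphism only at
    [c = ncirc H], which is 0 here. *)
Lemma minor_smooth_iso (H G : framed4graph) :
  (forall c, isomorphic H (with_circles G c) \/ ncirc H != c) ->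
  ncirc H = 0 -> minor H G.
Proof.
move=> iso H0; apply: (@minor_with_circles H G 0) => //; apply: minor_iso.
by apply: isomorphic_sym; case: (iso 0) => //; rewrite H0.
Qed.

Lemma smooth_card (G G1 : framed4graph) (X : vertex G) (fv : vertex G1 -> vertex G) :
  injective fv -> (forall v, fv v != X) -> #|vertex G1| < #|vertex G|.
Proof.
move=> fI fX; rewrite -(card_codom fI); apply: proper_card; apply/properP.
split; first by apply/subsetP.
by exists X => //; apply/negP => /codomP[v e]; have := fX v; rewrite e eqxx.
Qed.

(** * First return maps: [g] traces [f] on the image of [h] *)

Section FirstReturn.
Variables (T1 T : finType) (g : T1 -> T1) (f : T -> T) (h : T1 -> T) (P : pred T).
Hypotheses (hI : injective h) (hP : forall x, P (h x)).
Hypothesis ret : forall x, exists k, h (g x) = iter k.+1 f (h x) /\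
  forall i, 0 < i <= k -> ~~ P (iter i f (h x)).

Lemma fconnect_return x y : fconnect f (h x) (h y) -> fconnect g x y.
Proof.
move/iter_findex; move: (findex _ _ _) => n; elim/ltn_ind: n x => n IH x e.
case: n => [|n] in IH e *; first by rewrite (hI e) connect0.
have [k [gE kP]] := ret x; have [nk|kn] := ltnP n k.
  by have := kP n.+1; rewrite e hP => /(_ nk).
apply: connect_trans (fconnect1 _ _) (IH (n - k) _ (g x) _); first by lia.
by rewrite gE -iterD -e; congr (iter _ f _); lia.
Qed.

(** Here [j] counts the steps made since the last visit [h x], which lets the induction pass over
    letters outside [P]. *)
Lemma path_return x j s : (forall i, 0 < i <= j -> ~~ P (iter i f (h x))) ->
  fpath f (iter j f (h x)) s ->
  exists2 s1, map h s1 = filter P s & fpath g x s1.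
Proof.
elim: s x j => [|w s IH] x j jP /=; first by exists [::].
move=> /andP[/eqP wE ps]; rewrite -iterS in wE.
have [k [gE kP]] := ret x.
case: ifP => Pw.
  have kj : k = j.
    apply/eqP; rewrite eqn_leq; apply/andP; split; rewrite leqNgt; apply/negP => lt.
      by have := kP j.+1; rewrite wE Pw => /(_ lt).
    by have := jP k.+1; rewrite -gE hP => /(_ lt).
  rewrite -wE -kj -gE in ps *.
  have j0 i : 0 < i <= 0 -> ~~ P (iter i f (h (g x))) by case: i.
  have [s1 e ps1] := IH (g x) 0 j0 ps.
  by exists (g x :: s1); rewrite /= ?e ?gE ?eqxx.
apply: (IH x j.+1); last by rewrite wE.
move=> i ij; have [->|ne] := eqVneq i j.+1; first by rewrite wE Pw.
by apply: jP; lia.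
Qed.

Lemma cycle_return s : fcycle f s -> (forall y, P y -> exists x, y = h x) ->
  exists2 s1, map h s1 = filter P s & fcycle g s1.
Proof.
move=> cs Ph; have [/hasP[y ys Py]|] := boolP (has P s); last first.
  move=> nP; exists [::] => //=; apply/esym/eqP.
  by rewrite -size_eq0 size_filter -leqn0 -ltnS ltnS leqNgt -has_count.
have [x yE] := Ph _ Py.
(* Rotated to start in [P], the cycle is a path from [h x] back to [h x]; its trace is rotated back
   by the number of elements of [s1] in [P]. *)
case/splitPr: ys cs => s1 s2; rewrite -(rot_cycle (size s1)) rot_size_cat /= => cs.
have j0 i : 0 < i <= 0 -> ~~ P (iter i f (h x)) by case: i.
rewrite yE in cs; have [t tE] := path_return j0 cs.
case/lastP: t tE => [|t z]; first by rewrite filter_rcons hP; case: (filter _ _).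
rewrite map_rcons filter_rcons hP => /rcons_inj[tE /hI ->] pt.
exists (rotr (size (filter P s1)) (x :: t)); last by rewrite rotr_cycle.
rewrite map_rotr /= tE !filter_cat /= yE hP.
by rewrite -cat_cons rotr_size_cat.
Qed.
End FirstReturn.

(* The circuit leaving along [d] comes back along [opp d]: [Gamma] is left once
   all other vertices are smoothed. *)
Lemma turn_opp_minor_Gamma (G : framed4graph) (p : dart G -> dart G) (d : dart G) :
  state p -> fconnect (turn p) d (opp (p d)) -> minor Gamma G.
Proof.
move: {2}#|vertex G| (leqnn #|vertex G|) => n; elim: n G p d => [|n IH] G p d.
  by rewrite leqn0 => /eqP /card0_eq /(_ (vert d)).
move=> Gn sp bad.
have [X|all1] := pickP (fun X => X != vert d).
  rewrite eq_sym => dX.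
  have [G1 [p1 [fv [fd [[sG1 sp1] [fvI fvX] [fdI fdP] fdE ret]]]]] := smooth_state X sp.
  have [d1 d1E] := fdP _ dX; subst d.
  apply: minor_smoothing sG1 (IH G1 p1 d1 _ sp1 _).
    by have := smooth_card fvI fvX; lia.
  have [_ _ _ pE] := fdE d1.
  apply: (@fconnect_return _ _ (turn p1) (turn p) fd (fun x => vert x != X)) => //.
  - by move=> x; have [] := fdE x.
  - move=> x; have [k [e kP]] := ret x; exists k; split=> // i /kP ->.
    by rewrite eqxx.
  by have [_ _ <- _] := fdE (p1 d1); rewrite -pE.
have mem x : x \in [:: d; opp d; p d; opp (p d)].
  by apply: (state_mem sp); apply/eqP; have /negbT := all1 (vert x); rewrite negbK.
have pK := stateK sp; have po := state_opp sp.
(* The orbit of [d] reaches [opp (p d)], so no set stable under [turn] contains [d] without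
   [opp (p d)]; this excludes every edge pattern on the one vertex other than the two loops. *)
have stuck (S : pred (dart G)) : (forall x, S x -> S (turn p x)) -> S d -> S (opp (p d)).
  move=> cl dS; move/iter_findex: bad => <-.
  by elim: (findex _ _ _) => [//|m IHm]; rewrite iterS; exact: cl.
have nd := opp_neq d; have npd := opp_neq (p d).
have n1 := state_neq sp d; have n2 := state_opp_neq sp d.
have n3 : opp (p d) != d by rewrite (inv_eq (@oppK G)).
have n4 : opp (p d) != opp d by rewrite (inj_eq (@opp_inj G)).
have ed : edge d = opp d.
  have := mem (edge d); rewrite !inE (negbTE (edge_neq d)) /= => /or3P[/eqP //|/eqP e|/eqP e].
    suff : pred1 d (opp (p d)) by rewrite /= (negbTE n3).
    by apply: stuck; rewrite /= ?eqxx // => x /eqP ->; rewrite /turn e pK eqxx.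
  have eo : edge (opp d) = p d.
    have := mem (edge (opp d)); rewrite !inE (negbTE (edge_neq _)) /=.
    case/or3P => /eqP eo //.
      have e' : edge d = opp d by rewrite -{1}eo edgeK.
      by case/negP: n4; rewrite -e e'.
    by case/negP: nd; rewrite (edge_inj (etrans eo (esym e))).
  suff : pred2 d (opp d) (opp (p d)) by rewrite /= (negbTE n3) (negbTE n4).
  by apply: stuck; rewrite /= ?eqxx // => x /orP[] /eqP ->; rewrite /turn ?e ?eo ?pK ?po ?pK ?eqxx ?orbT //.
have epd : edge (p d) = opp (p d).
  have := mem (edge (p d)); rewrite !inE (negbTE (edge_neq _)) /=.
  case/or3P => /eqP e //.
    by case/negP: n2; rewrite -ed -{2}e edgeK.
  by case/negP: n1; rewrite (edge_inj (etrans e (esym ed))).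
apply: minor_smooth_iso => // c; have [->|] := eqVneq c 0; last by rewrite eq_sym; right.
left; exists (fun=> vert d).
exists (fun z : bool * bool => let y := if z.1 then p d else d in if z.2 then opp y else y).
split=> //.
- exists (fun=> tt) => [[]//|v]; have /negbT := all1 v; rewrite negbK => /eqP -> //.
- apply: surj_inj_bij.
    have N := (negbTE n1, negbTE n2, negbTE n3, negbTE n4, negbTE nd, negbTE npd).
    have N' := (etrans (eq_sym _ _) (negbTE n1), etrans (eq_sym _ _) (negbTE n2),
      etrans (eq_sym _ _) (negbTE n3), etrans (eq_sym _ _) (negbTE n4),
      etrans (eq_sym _ _) (negbTE nd), etrans (eq_sym _ _) (negbTE npd)).
    by move=> [[] []] [[] []] //= /eqP; rewrite ?(inj_eq (@opp_inj G)) ?N ?N'.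
  move=> y; have := mem y; rewrite !inE => /or4P[] /eqP ->.
  + by exists (false, false).
  + by exists (false, true).
  + by exists (true, false).
  + by exists (true, true).
- by case=> [[] []] /=; rewrite ?vert_opp ?(state_vert sp).
case=> [[] []] /=; rewrite ?oppK //; split=> //=.
- by rewrite -epd edgeK.
- by rewrite -ed edgeK.
Qed.

(** Closure under [opp] says that the two passages through a vertex leave along opposite half-edges,
    so the pairs [d], [opp d] are the chords of a chord diagram. *)
Definition circuit (G : framed4graph) (p : dart G -> dart G) (s : seq (dart G)) : Prop :=
  [/\ uniq s, fcycle (turn p) s & {in s, forall d, opp d \in s}].

Lemma surj_card_bij (S T : finType) (h : S -> T) :
  #|S| <= #|T| -> (forall y, exists x, y = h x) -> bijective h.
Proof.
move=> ST hS; have ex y : exists x, y == h x by have [x ->] := hS y; exists x.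
pose g y := xchoose (ex y).
have hg : cancel g h by move=> y; apply/esym/eqP/(xchooseP (ex y)).
have gh : bijective g by apply: inj_card_bij => //; exact: can_inj hg.
by apply: (bij_can_bij gh hg).
Qed.

Lemma card_darts (G : framed4graph) : #|dart G| = 4 * #|vertex G|.
Proof.
rewrite -sum1_card (partition_big (@vert G) predT) //= mulnC -sum_nat_const.
apply: eq_bigr => v _; rewrite -(four_valent v) -sum1_card.
by apply: eq_bigl => d; rewrite inE.
Qed.

Lemma minor_Delta_triangle (G : framed4graph) (p : dart G -> dart G)
    (a b c : dart G) :
  state p -> uniq [:: vert a; vert b; vert c] ->
  (forall v, v \in [:: vert a; vert b; vert c]) ->
  fcycle (turn p) [:: a; b; c; opp a; opp b; opp c] -> minor Delta G.
Proof.
move=> sp uv allv /=; rewrite !andbT.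
case/and5P => /eqP tab /eqP tbc /eqP tca /eqP tab' /andP[/eqP tbc' /eqP tca'].
have pK := stateK sp; have po := state_opp sp.
have eE x y : turn p x = y -> edge x = p y by move=> <-; rewrite /turn pK.
pose t (v : nat) : dart G := nth a [:: a; b; c] v.
pose dr (v : nat) (r : bool) : dart G := if r then opp (t v) else t v.
have bdP : bijective (fun v : 'I_3 => vert (t v)).
  have vE (v : 'I_3) : vert (t v) = nth (vert a) [:: vert a; vert b; vert c] v.
    by rewrite /t; case: v => [[|[|[|]]]].
  apply: surj_inj_bij => [v w|y].
    by rewrite !vE => /eqP; rewrite nth_uniq // => /eqP /val_inj.
  have := allv y => /(nthP (vert a)) [i i3 <-].
  by exists (Ordinal (i3 : i < 3)); rewrite vE.
apply: minor_smooth_iso => // k; have [->|] := eqVneq k 0; last by rewrite eq_sym; right.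
(* A half-edge of [Delta] towards the successor leaves along the circuit, one towards the
   predecessor is the mate of a half-edge leaving there; the last bit selects one of the two
   passages. *)
left; pose h (x : dart Delta) : dart G :=
  if x.1.2 then dr x.1.1 x.2 else edge (dr (ord_pred x.1.1) x.2).
have [ea eb ec] : [/\ edge a = p b, edge b = p c & edge c = p (opp a)] by split; exact: eE.
have [ea' eb' ec'] : [/\ edge (opp a) = p (opp b), edge (opp b) = p (opp c)
    & edge (opp c) = p a] by split; exact: eE.
have hv x : vert (h x) = vert (t x.1.1).
  case: x => [[[[|[|[|//]]] i3] []] []]; rewrite /h /dr /t /= ?vert_opp //;
  by rewrite ?ea ?eb ?ec ?ea' ?eb' ?ec' !(state_vert sp) ?vert_opp.
exists (fun v : 'I_3 => vert (t v)), h; split=> //.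
- apply: surj_card_bij.
    have cV : #|vertex G| = 3 by rewrite -(card_ord 3); exact/esym/(bij_eq_card bdP).
    by rewrite (card_darts Delta) (card_darts G) cV (_ : #|vertex Delta| = 3) // card_ord.
  move=> y; have mem := state_mem sp.
  have /(nthP (vert a))[i i3 iE] := allv (vert y).
  have yE : vert y = vert (t i) by rewrite -iE /t; case: i i3 {iE} => [|[|[|]]].
  have := mem _ _ yE; rewrite !inE => /or4P[] /eqP ->.
  + by exists (Ordinal (i3 : i < 3), true, false).
  + by exists (Ordinal (i3 : i < 3), true, true).
  + case: i i3 {iE yE} => [|[|[|//]]] i3.
    * by exists (Ordinal i3, false, true); rewrite /h /dr /t /= ec'.
    * by exists (Ordinal i3, false, false); rewrite /h /dr /t /= ea.
    * by exists (Ordinal i3, false, false); rewrite /h /dr /t /= eb.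
  case: i i3 {iE yE} => [|[|[|//]]] i3; rewrite -po.
  * by exists (Ordinal i3, false, false); rewrite /h /dr /t /= ec.
  * by exists (Ordinal i3, false, true); rewrite /h /dr /t /= ea'.
  * by exists (Ordinal i3, false, true); rewrite /h /dr /t /= eb'.
- move=> x; split.
    case: x => [[v []] r]; last exact: edgeK.
    by congr (edge (dr _ r)); exact: (congr1 val (esym (ordSK v))).
  case: x => [[[[|[|[|//]]] i3] []] []]; rewrite /h /dr /t /= ?oppK //;
  by rewrite ?ea ?eb ?ec ?ea' ?eb' ?ec' ?po ?oppK.
Qed.

(** Smoothing a vertex other than [a], [b], [c] only erases its letter from the word of the circuit;
    in the end the word is [abcabc] and [minor_Delta_triangle] applies. *)
Lemma minor_Delta_word (G : framed4graph) (p : dart G -> dart G) (s : seq (dart G))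
    (a b c : vertex G) :
  state p -> circuit p s -> uniq [:: a; b; c] ->
  [seq v <- map (@vert G) s | v \in [:: a; b; c]] = [:: a; b; c; a; b; c] ->
  minor Delta G.
Proof.
move: {2}#|vertex G| (leqnn #|vertex G|) => n; elim: n G p s a b c => [|n IH] G p s a b c.
  by rewrite leqn0 => /eqP /card0_eq /(_ a).
move=> Gn sp [us cs os] uabc wE.
have [X|all3] := pickP (fun X => X \notin [:: a; b; c]).
  move=> Xn.
  have [G1 [p1 [fv [fd [[sG1 sp1] [fvI fvX] [fdI fdP] fdE ret]]]]] := smooth_state X sp.
  pose P x := vert x != X.
  have [||s1 s1E cs1] := @cycle_return _ _ (turn p1) (turn p) fd P fdI _ _ s cs fdP.
  - by move=> x; have [] := fdE x.
  - move=> x; have [k [e kP]] := ret x; exists k; split=> // i /kP e'.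
    by rewrite /P e' eqxx.
  have lift v : v \in [:: a; b; c] -> exists w, v = fv w.
    move=> vabc; have : v \in [seq v <- map (@vert G) s | v \in [:: a; b; c]].
      by rewrite wE; move: vabc; rewrite !inE => /or3P[] ->; rewrite ?orbT.
    rewrite mem_filter => /andP[_ /mapP[d _ vE]].
    have dX : vert d != X by apply/eqP => dX; move: Xn; rewrite -dX -vE vabc.
    by have [e eE] := fdP _ dX; exists (vert e); rewrite vE eE; have [] := fdE e.
  have [[a1 aE] [b1 bE] [c1 cE]] : [/\ exists w, a = fv w, exists w, b = fv w & exists w, c = fv w].
    by split; apply: lift; rewrite !inE eqxx ?orbT.
  have abcE : [:: a; b; c] = map fv [:: a1; b1; c1] by rewrite /= -aE -bE -cE.
  apply: (minor_smoothing sG1 (IH G1 p1 s1 a1 b1 c1 _ sp1 _ _ _)).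
  - by have := smooth_card fvI fvX; lia.
  - split=> //.
    + by rewrite -(map_inj_uniq fdI) s1E filter_uniq.
    + move=> d d1; rewrite -(mem_map fdI) s1E mem_filter.
      have [_ dX <- _] := fdE d; rewrite /P vert_opp dX /=; apply: os.
      by have : fd d \in map fd s1 by [rewrite mem_map]; rewrite s1E mem_filter => /andP[].
  - by rewrite -(map_inj_uniq fvI) -abcE.
  apply: (inj_map fvI); rewrite /= -aE -bE -cE -wE abcE.
  have fm (w : seq (vertex G1)) : map fv [seq v <- w | v \in [:: a1; b1; c1]] =
      [seq v <- map fv w | v \in map fv [:: a1; b1; c1]].
    by rewrite filter_map; congr map; apply: eq_filter => v; rewrite -(mem_map fvI).
  have vs1 : map fv (map (@vert G1) s1) = map (@vert G) (map fd s1).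
    by rewrite -!map_comp; apply: eq_map => d /=; have [-> _ _ _] := fdE d.
  have fP : map (@vert G) (filter P s) = [seq v <- map (@vert G) s | v != X].
    by rewrite filter_map.
  rewrite fm -abcE vs1 s1E fP -filter_predI.
  apply: eq_filter => v /=; case: (boolP (v \in [:: a; b; c])) => //= vabc.
  by apply/eqP => vX; move: Xn; rewrite -vX vabc.
have inabc v : v \in [:: a; b; c] by have := all3 v; case: (v \in _).
have {}wE : map (@vert G) s = [:: a; b; c; a; b; c].
  by rewrite -wE; apply/esym/all_filterP/allP => v _.
case: s us cs os wE => [//|d0 [//|d1 [//|d2 [//|d3 [//|d4 [//|d5 [|//]]]]]]] us cs os [va vb vc va' vb' vc'].
(* A vertex met at exactly two positions is met there by a half-edge and its opposite. *)
have op d e : d \in [:: d0; d1; d2; d3; d4; d5] ->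
    [seq x <- [:: d0; d1; d2; d3; d4; d5] | vert x == vert d] = [:: d; e] -> e = opp d.
  move=> dS fE; have : opp d \in [:: d; e].
    by rewrite -fE mem_filter vert_opp eqxx os.
  by rewrite !inE (negbTE (opp_neq d)) => /eqP.
move: uabc; rewrite /= !inE !negb_or andbT => /andP[/andP[ab ac] bc].
have N := (negbTE ab, negbTE ac, negbTE bc, etrans (eq_sym b a) (negbTE ab),
  etrans (eq_sym c a) (negbTE ac), etrans (eq_sym c b) (negbTE bc)).
have e3 : d3 = opp d0.
  by apply: op; rewrite ?inE ?eqxx //= va vb vc va' vb' vc' !eqxx !N.
have e4 : d4 = opp d1.
  by apply: op; rewrite ?inE ?eqxx ?orbT //= va vb vc va' vb' vc' !eqxx !N.
have e5 : d5 = opp d2.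
  by apply: op; rewrite ?inE ?eqxx ?orbT //= va vb vc va' vb' vc' !eqxx !N.
apply: (@minor_Delta_triangle G p d0 d1 d2) => //.
- by rewrite va vb vc /= !inE !N.
- by rewrite va vb vc.
by rewrite -e3 -e4 -e5.
Qed.

(** * Interlacement *)

Section Interlace.
Variable T : eqType.
Implicit Types (w : seq T) (z u : T).

(* [il w z u] is the parity of the number of pairs of an occurrence of [z]
   followed by an occurrence of [u]: when both letters occur twice it says that
   they interlace, and it is additive under concatenation. *)
Definition par w z : bool := odd (count_mem z w).

Fixpoint il w z u : bool :=
  if w is x :: w' then ((x == z) && par w' u) (+) il w' z u else false.

Definition adj w z u : bool := (z != u) && il w z u.

Lemma par_cat w1 w2 z : par (w1 ++ w2) z = par w1 z (+) par w2 z.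
Proof. by rewrite /par count_cat oddD. Qed.

Lemma par_cons x w z : par (x :: w) z = (x == z) (+) par w z.
Proof. by rewrite /par /= oddD oddb. Qed.

Lemma il_cat w1 w2 z u :
  il (w1 ++ w2) z u = il w1 z u (+) il w2 z u (+) (par w1 z && par w2 u).
Proof.
elim: w1 => [|x w1 IH] /=; first by rewrite addbF.
rewrite IH par_cat par_cons.
by case: (x == z); case: (par w1 u); case: (par w2 u); case: (il w1 z u);
  case: (il w2 z u); case: (par w1 z).
Qed.

(** The two terms together count all pairs of an occurrence of [z] and one of [u], each pair being
    in one of the two orders. *)
Lemma il_swap w z u : z != u -> il w z u (+) il w u z = par w z && par w u.
Proof.
move=> zu; elim: w => [|x w IH] //=; rewrite !par_cons.
have : ~~ ((x == z) && (x == u)).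
  by apply/negP => /andP[/eqP -> /eqP e]; rewrite e eqxx in zu.
move: IH; case: (x == z); case: (x == u); case: (par w u); case: (par w z);
  by case: (il w z u); case: (il w u z).
Qed.

Definition even_word w := forall z, ~~ par w z.

Lemma adj_sym w z u : even_word w -> adj w z u = adj w u z.
Proof.
move=> ev; rewrite /adj eq_sym; case: (boolP (u != z)) => //= uz.
have := @il_swap w u z uz; rewrite (negbTE (ev u)) /=.
by case: (il w z u); case: (il w u z).
Qed.

Lemma il_rot w n z u : even_word w -> il (rot n w) z u = il w z u.
Proof.
move=> ev; rewrite /rot -[in RHS](cat_take_drop n w) !il_cat.
have := ev z; have := ev u; rewrite -{1 2}(cat_take_drop n w) !par_cat.
case: (par _ z); case: (par _ z); case: (par _ u); case: (par _ u);
  by case: (il _ z u); case: (il _ z u).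
Qed.

Lemma adj_mem w z u : adj w z u -> u \in w.
Proof.
move=> /andP[_]; elim: w => [//|x w IH] /=.
case: (boolP (u \in w)) => [uw _|nu]; first by rewrite inE uw orbT.
have -> : par w u = false by rewrite /par (count_memPn nu).
by rewrite andbF addFb => /IH uw; rewrite uw in nu.
Qed.

Lemma il_filter (P : pred T) w z u : P z -> P u -> il (filter P w) z u = il w z u.
Proof.
have pf w' v : P v -> par (filter P w') v = par w' v.
  move=> Pv; rewrite /par count_filter; congr odd; apply: eq_count => x /=.
  by case: eqP => // ->.
move=> Pz Pu; elim: w => [|x w IH] //=; case: ifP => Px /=; rewrite IH ?pf //.
by case: eqP => [xz|]; rewrite ?addFb //; rewrite xz Pz in Px.
Qed.

(* Closed walks of length [m] in the interlacement graph of [w], as periodic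
   sequences. *)
Definition walk w (m : nat) (f : nat -> T) : Prop :=
  (forall i, adj w (f i) (f i.+1)) /\ (forall i, f (i + m) = f i).

Lemma mk_walk w m (h : nat -> T) : 0 < m ->
  (forall i, i.+1 < m -> adj w (h i) (h i.+1)) -> adj w (h m.-1) (h 0) ->
  walk w m (fun i => h (i %% m)).
Proof.
move=> m0 hs hc; split=> i; last by rewrite modnDr.
rewrite -addn1 -modnDml addn1; have lt := ltn_pmod i m0.
move: lt; rewrite leq_eqVlt => /orP[/eqP e|lt]; last by rewrite (modn_small lt); apply: hs.
by rewrite e modnn -[X in h X]/(i %% m) (_ : i %% m = m.-1) //; lia.
Qed.

Lemma walk_shift w m f k : walk w m f -> walk w m (fun i => f (k + i)).
Proof. by case=> fs fp; split=> i; rewrite ?addnS // addnA. Qed.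

(* A chord or a repetition splits an odd closed walk into an even one and a
   shorter odd one. *)
Lemma walk_chord w m f i : even_word w -> walk w m f -> odd m -> 2 <= i <= m - 2 ->
  adj w (f 0) (f i) || (f 0 == f i) ->
  exists m' f', [/\ m' < m, odd m' & walk w m' f'].
Proof.
move=> ev [fs fp] om iP; case: (boolP (odd i)) => oi /orP[ad|/eqP e].
- exists (m - i).+1, (fun j => f (i + j %% (m - i).+1)).
  split; [lia | rewrite /= oddB ?om ?oi //; lia |].
  apply: (@mk_walk w _ (fun j => f (i + j))) => // [j _|]; first by rewrite addnS.
  by rewrite /= subnKC ?addn0 ?(fp 0) -1?{1}[m]add0n ?fp //; lia.
- exists i, (fun j => f (j %% i)); split; [lia | by [] |].
  apply: mk_walk => //; first lia.
  by have := fs i.-1; rewrite prednK -?e //; lia.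
- exists i.+1, (fun j => f (j %% i.+1)); split; [lia | by rewrite /= oi |].
  by apply: mk_walk => //=; rewrite adj_sym.
exists (m - i), (fun j => f (i + j %% (m - i))); split; [lia | |].
  by rewrite oddB ?om ?(negbTE oi) //; lia.
apply: (@mk_walk w _ (fun j => f (i + j))) => // [|j _|]; [lia | by rewrite addnS |].
have := fs (m.-1); rewrite prednK; last lia.
rewrite -{2}[m]add0n fp e addn0 (_ : i + _ = m.-1) //; lia.
Qed.

Lemma il_notin w z u : z \notin w -> il w z u = false.
Proof.
by elim: w => [|x w IH] //=; rewrite inE negb_or eq_sym => /andP[/negbTE -> /IH ->].
Qed.

Lemma par_notin w z : z \notin w -> par w z = false.
Proof. by rewrite /par => /count_memPn ->. Qed.

(* Exchanging [C] and [E] is local complementation along the edge [xy] of the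
   interlacement graph. *)
Lemma il_pivot (x y z u : T) (B C D E : seq T) :
  x \notin B ++ C ++ D ++ E -> y \notin B ++ C ++ D ++ E ->
  z != x -> z != y -> u != x -> u != y -> x != y ->
  let w := x :: B ++ y :: C ++ x :: D ++ y :: E in even_word w ->
  il (x :: B ++ y :: E ++ x :: D ++ y :: C) z u =
  il w z u (+) ((il w x z && il w y u) (+) (il w x u && il w y z)).
Proof.
rewrite !mem_cat !negb_or => /and4P[xB xC xD xE] /and4P[yB yC yD yE] zx zy ux uy xy w ev.
have := ev z; have := ev u; clear ev.
rewrite {}/w /=; do 4 rewrite ?(il_cat, par_cat, par_cons) /=.
rewrite !(eq_sym x z) !(eq_sym y z) !(eq_sym x u) !(eq_sym y u).
rewrite !eqxx (negbTE zx) (negbTE zy) (negbTE ux) (negbTE uy).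
rewrite (negbTE xy) (eq_sym y x) (negbTE xy).
rewrite ?(il_notin _ xB) ?(il_notin _ xC) ?(il_notin _ xD) ?(il_notin _ xE).
rewrite ?(il_notin _ yB) ?(il_notin _ yC) ?(il_notin _ yD) ?(il_notin _ yE).
rewrite ?(par_notin xB) ?(par_notin xC) ?(par_notin xD) ?(par_notin xE).
rewrite ?(par_notin yB) ?(par_notin yC) ?(par_notin yD) ?(par_notin yE) /=.
move: (par B z) (par C z) (par D z) (par E z) (par B u) (par C u) (par D u) (par E u).
move: (il B z u) (il C z u) (il D z u) (il E z u) => i j k l.
do 8!case=> //=; move=> _ _; by case: i; case: j; case: k; case: l.
Qed.

End Interlace.

Lemma two_occurrences u v w : u + (1 + (v + (1 + w))) = 2 -> u + (v + w) = 0.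
Proof. by lia. Qed.

Lemma odd_occurrences u v w :
  odd (u + (1 + v)) -> (u + (1 + v)) + w = 2 -> u + v = 0 /\ w = 1.
Proof. by case: u => [|[|u]]; case: v => [|[|v]] //=; lia. Qed.

(** * Circuits of a state and their pivots *)

Section Pivot.
Variables (G : framed4graph) (p : dart G -> dart G).
Hypothesis sp : state p.

(** [opp (p d)] is the partner of [d] in the other smoothing of its vertex, so the state changes
    exactly at the vertices in [S]. *)
Definition switch (S : pred (vertex G)) (d : dart G) : dart G :=
  if S (vert d) then opp (p d) else p d.

Lemma switch_state S : state (switch S).
Proof.
have pK := stateK sp; have po := state_opp sp; have pv := state_vert sp.
split=> d; rewrite /switch.
- by case Sd: (S (vert d)); rewrite ?vert_opp pv Sd // po oppK pK.
- by case: ifP; rewrite ?vert_opp pv.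
- case: ifP => _; last exact: state_neq.
  by rewrite (inv_eq (@oppK G)) state_opp_neq.
- case: ifP => _; last exact: state_opp_neq.
  by rewrite (inj_eq (@opp_inj G)) state_neq.
Qed.

Lemma switch_turn S d : turn (switch S) d =
  if S (vert (turn p d)) then opp (turn p d) else turn p d.
Proof. by rewrite /turn /switch (state_vert sp). Qed.

Lemma switch_path S d s : (forall e, e \in s -> ~~ S (vert e)) ->
  fpath (turn p) d s -> fpath (turn (switch S)) d s.
Proof.
elim: s d => [|e s IH] d //= av /andP[/eqP de pe].
rewrite switch_turn de (negbTE (av e _)) ?inE ?eqxx //= IH // => x xs.
by apply: av; rewrite inE xs orbT.
Qed.

(** Wherever the circuit enters one of the two vertices it now leaves along the opposite half-edge,
    that is from its other occurrence. The four segments keep their directions and follow each other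
    in the order [B], [E], [D], [C], all on one circuit. *)
Lemma circuit_pivot (dx dy : dart G) (B C D E : seq (dart G)) :
  circuit p (dx :: B ++ dy :: C ++ opp dx :: D ++ opp dy :: E) ->
  (forall e, e \in B ++ C ++ D ++ E -> vert e != vert dx /\ vert e != vert dy) ->
  circuit (switch (pred2 (vert dx) (vert dy)))
    (dx :: B ++ opp dy :: E ++ opp dx :: D ++ dy :: C).
Proof.
set S := pred2 _ _; case=> us cs os av.
have avS e : e \in B ++ C ++ D ++ E -> ~~ S (vert e).
  by move=> /av[h1 h2]; rewrite /= negb_or h1 h2.
have pm : perm_eq (dx :: B ++ dy :: C ++ opp dx :: D ++ opp dy :: E)
    (dx :: B ++ opp dy :: E ++ opp dx :: D ++ dy :: C).
  by apply/permP => P; rewrite /= !count_cat /= !count_cat /= !count_cat /=; lia.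
have Sx : S (vert dx) by rewrite /= eqxx.
have Sy : S (vert dy) by rewrite /= eqxx orbT.
split; first by rewrite -(perm_uniq pm).
  move: cs; rewrite /= !rcons_cat /= !rcons_cat /= !rcons_cat /= !cat_path /=.
  rewrite !cat_path /= !cat_path /= !rcons_path.
  case/and3P=> pB /eqP eB /and3P[pC /eqP eC /and3P[pD /eqP eD /andP[pE /eqP eE]]].
  have sub Y d : {subset Y <= B ++ C ++ D ++ E} -> fpath (turn p) d Y ->
      fpath (turn (switch S)) d Y.
    by move=> sY; apply: switch_path => e /sY; exact: avS.
  rewrite (sub B) // ?(sub C) // ?(sub D) // ?(sub E) //=; try by
    move=> e eY; rewrite !mem_cat eY ?orbT.
  by rewrite !switch_turn eB eC eD eE !vert_opp Sx Sy !oppK !eqxx.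
by move=> d; rewrite -!(perm_mem pm); exact: os.
Qed.

Lemma circuit_rot n s : circuit p s -> circuit p (rot n s).
Proof.
case=> us cs os; split; rewrite ?rot_uniq ?rot_cycle // => d.
by rewrite !mem_rot; exact: os.
Qed.

(** [p d] is the step after [edge d], so a circuit through [d] and [p d] would run along the edge of
    [d] in both directions. *)
Lemma circuit_notin s d : circuit p s -> d \in s -> p d \notin s.
Proof.
case=> us cs os ds; apply/negP => pds.
have co : fconnect (turn p) d (p d) by rewrite (fconnect_cycle cs ds).
have nf z : connect (strand p) d z -> p z != z by move=> _; exact: state_neq.
have /negP := turn_edge (stateK sp) nf (connect0 _ d); apply.
apply: connect_trans co _; rewrite (fconnect_sym (turn_inj (stateK sp))).
by rewrite (_ : p d = turn p (edge d)) ?fconnect1 // /turn edgeK.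
Qed.

Lemma circuit_vert s d e : circuit p s -> d \in s -> e \in s -> vert e = vert d ->
  e = d \/ e = opp d.
Proof.
move=> cs ds es /(state_mem sp); have [_ _ os] := cs.
rewrite !inE => /or4P[/eqP|/eqP|/eqP eE|/eqP eE]; [by left | by right | |].
  by have := circuit_notin cs ds; rewrite -eE es.
by have := circuit_notin cs (os _ ds); rewrite (state_opp sp) -eE es.
Qed.

Lemma circuit_count s d : circuit p s -> d \in s ->
  count_mem (vert d) (map (@vert G) s) = 2.
Proof.
move=> cs ds; rewrite count_map; have [us _ os] := cs.
transitivity (count (mem [:: d; opp d]) s).
  apply: eq_in_count => x xs /=; rewrite !inE; apply/eqP/orP => [|].
    by case/(circuit_vert cs ds xs) => ->; rewrite eqxx; [left | right].
  by case=> /eqP ->; rewrite ?vert_opp.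
rewrite -size_filter -[RHS]/(size [:: d; opp d]); apply: perm_size; apply: uniq_perm.
- exact: filter_uniq.
- by rewrite /= inE eq_sym opp_neq.
move=> x; rewrite mem_filter /= !inE; case: eqP => [->|_] /=; first by rewrite ds.
by case: eqP => [->|]; rewrite ?os.
Qed.

Lemma circuit_even s : circuit p s -> even_word (map (@vert G) s).
Proof.
move=> cs v; rewrite /par; have [/mapP[d ds ->]|nv] := boolP (v \in map (@vert G) s).
  by rewrite (circuit_count cs).
by rewrite (count_memPn nv).
Qed.

(** The parity [il] says that an odd number of the two occurrences of [y], hence exactly one, lies
    between those of [x]; rotating to [dx] gives the form required by the pivot. *)
Lemma circuit_interlaced s (x y : vertex G) : circuit p s ->
  adj (map (@vert G) s) x y ->
  exists n dx dy B C D E,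
    [/\ rot n s = dx :: B ++ dy :: C ++ opp dx :: D ++ opp dy :: E,
        vert dx = x, vert dy = y &
        forall e, e \in B ++ C ++ D ++ E -> vert e != x /\ vert e != y].
Proof.
move=> cs ad; have ev := circuit_even cs.
have : x \in map (@vert G) s by apply: (@adj_mem _ _ y); rewrite adj_sym.
case/mapP=> dx dxs xE; have [n t rE] := rot_to dxs.
have crs := circuit_rot n cs; have evr := circuit_even crs.
have xy : x != y by case/andP: ad.
have {}ad : il (map (@vert G) (rot n s)) x y.
  by rewrite map_rot il_rot //; case/andP: ad.
rewrite rE in crs evr ad; have [us _ os] := crs.
have cnt e : e \in dx :: t -> count_mem (vert e) (map (@vert G) (dx :: t)) = 2.
  exact: circuit_count.
have odx : opp dx \in t.
  by have := os dx; rewrite !inE eqxx (negbTE (opp_neq _)) => /(_ erefl).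
case/splitPr: odx rE crs us os ad evr cnt => S1 S2 rE crs us os ad evr cnt.
have c0 e : e \in [:: dx; opp dx] -> vert e = x.
  by rewrite !inE => /orP[] /eqP ->; rewrite ?vert_opp.
have nx e : e \in S1 ++ S2 -> vert e != x.
  have := cnt dx; rewrite inE eqxx => /(_ isT).
  rewrite /= map_cat /= !count_cat /= vert_opp -xE eqxx.
  move=> c2; have : count_mem x (map (@vert G) (S1 ++ S2)) = 0.
    by move: c2; rewrite map_cat count_cat /=; exact: (@two_occurrences 0).
  move=> /eqP; rewrite -leqn0 leqNgt -has_count => /hasPn h eS.
  exact: h (map_f _ eS).
have pS1 : par (map (@vert G) S1) y.
  move: ad; have xn S : {subset S <= S1 ++ S2} -> x \notin map (@vert G) S.
    move=> sS; apply/mapP => -[e /sS eS ex]; by have := nx e eS; rewrite ex eqxx.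
  rewrite /= map_cat /= !il_cat /= !par_cat !par_cons vert_opp -xE !eqxx (negbTE xy) /=.
  rewrite !il_notin ?xn ?(par_notin (xn S1 _)) //=; try by move=> e eS; rewrite mem_cat eS ?orbT.
  by case: (par _ y); case: (par _ y).
have : has (pred1 y) (map (@vert G) S1).
  by rewrite has_count; move: pS1; rewrite /par; case: (count_mem y _).
rewrite has_map => /hasP[dy dyS /eqP /= yE].
case/splitPr: dyS rE crs us os ad evr cnt nx pS1 => B C rE crs us os ad evr cnt nx pS1.
have mdy : dy \in dx :: (B ++ dy :: C) ++ opp dx :: S2.
  by rewrite inE mem_cat mem_cat inE eqxx !orbT.
pose k (S : seq (dart G)) := count (fun d => vert d == y) S.
have kE S : count_mem y (map (@vert G) S) = k S by rewrite count_map.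
have kcat S S' : k (S ++ S') = k S + k S' by exact: count_cat.
have kcons d S : k (d :: S) = (vert d == y) + k S by [].
have k0 S e : k S = 0 -> e \in S -> vert e != y.
  by move=> /eqP; rewrite -leqn0 leqNgt -has_count => /hasPn h /h.
have cy := cnt dy mdy; rewrite yE kE in cy.
rewrite /par kE in pS1.
have [kBC kS2] : k B + k C = 0 /\ k (opp dx :: S2) = 1.
  have kx : k (dx :: (B ++ dy :: C) ++ opp dx :: S2) =
      k (B ++ dy :: C) + k (opp dx :: S2).
    by rewrite (kcons dx) kcat -xE (negbTE xy).
  apply: odd_occurrences; first by move: pS1; rewrite kcat (kcons dy) yE eqxx.
  by rewrite -cy kx kcat (kcons dy) yE eqxx.
have ny e : e \in B ++ C -> vert e != y by apply: k0; rewrite kcat.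
have ody : opp dy \in S2.
  have := os dy mdy; rewrite !inE mem_cat mem_cat !inE (inj_eq (@opp_inj G)).
  rewrite (negbTE (opp_neq dy)) => /or3P[/eqP e|/or3P[e|//|e]|/orP[/eqP e|//]].
  - by move: xy; rewrite xE -yE -e vert_opp eqxx.
  - by have := ny (opp dy); rewrite mem_cat e vert_opp yE eqxx => /(_ isT).
  - by have := ny (opp dy); rewrite mem_cat e orbT vert_opp yE eqxx => /(_ isT).
  - by move: xy; rewrite xE -yE e eqxx.
case/splitPr: ody rE crs us os ad evr cnt nx cy mdy kS2 => D E rE crs us os ad evr cnt nx cy mdy kS2.
exists n, dx, dy, B, C, D, E; split=> //; first by rewrite rE /= -catA.
move=> e eS; split.
  apply: nx; move: eS; rewrite !mem_cat !inE.
  by case/or4P => ->; rewrite ?orbT.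
move: eS; rewrite catA mem_cat => /orP[/ny //|eDE].
apply: (k0 (D ++ E)) => //; rewrite kcat.
move: kS2; rewrite (kcons (opp dx)) kcat (kcons (opp dy)) !vert_opp -xE yE eqxx (negbTE xy) /=.
move: (k D) (k E) => a b; lia.
Qed.

(** Were only one end of [b] between the two ends of [a], the letter of [b] would have odd parity
    there, which is interlacement. *)
Lemma circuit_nested s a b : circuit p s -> a \in s -> b \in s ->
  ~~ adj (map (@vert G) s) (vert a) (vert b) ->
  index a s < index b s < index (opp a) s ->
  index a s < index (opp b) s < index (opp a) s.
Proof.
move=> cs ain bs nad iP; have [us _ os] := cs.
have ne : vert a != vert b.
  apply/eqP => e; have [E|E] := circuit_vert cs ain bs (esym e).
    by rewrite E ltnn in iP.
  by rewrite E ltnn andbF in iP.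
have cnt := circuit_count cs ain.
have oas := os _ ain; have obs := os _ bs.
have bv x : x \in s -> vert x = vert b -> x = b \/ x = opp b by exact: circuit_vert.
move: iP; case/splitPr: ain us os bs nad cnt oas obs bv {cs} => s1 s2.
rewrite cat_uniq /= negb_or => /and4P[u1 /andP[a1 h1] a2 u2] os bs nad cnt oas obs bv.
have ia : index a (s1 ++ a :: s2) = size s1 by rewrite index_cat (negbTE a1) /= eqxx addn0.
rewrite ia => /andP[ib io].
have oa2 : opp a \in s2.
  move: oas; rewrite mem_cat inE (negbTE (opp_neq a)) /= => /orP[|//].
  move=> o1; have lt : index (opp a) s1 < size s1 by rewrite index_mem.
  by move: io; rewrite [index (opp a) _]index_cat o1 => io; have := ltn_trans (ltn_trans ib io) lt; rewrite ltnn.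
move: ib io; case/splitPr: oa2 h1 a2 u2 os bs nad cnt oas obs bv ia => B C.
move=> h1 a2 u2 os bs nad cnt oas obs bv ia.
have [ob1 obB] : opp a \notin s1 /\ opp a \notin B.
  split; last by move: u2; rewrite cat_uniq /= negb_or => /and4P[_ /andP[]].
  by move: h1; rewrite has_cat /= !negb_or => /and3P[_ ].
have idx x : x \in B -> index x (s1 ++ a :: B ++ opp a :: C) = size s1 + (index x B).+1.
  move=> xB; rewrite index_cat.
  have /hasPn h : ~~ has (mem s1) (B ++ opp a :: C) := h1.
  have /negbTE -> : x \notin s1 by apply: (h x); rewrite mem_cat xB.
  rewrite /= index_cat xB; case: eqP => // ax.
  by move: a2; rewrite ax mem_cat xB.
have io : index (opp a) (s1 ++ a :: B ++ opp a :: C) = size s1 + (size B).+1.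
  rewrite index_cat (negbTE ob1) /= eq_sym (negbTE (opp_neq a)) index_cat (negbTE obB).
  by rewrite /= eqxx addn0.
rewrite io => ib ib'.
have bB : b \in B.
  move: bs ib ib'; rewrite mem_cat inE mem_cat inE => /or4P[b1|/eqP ->|//|].
  - have lt : index b s1 < size s1 by rewrite index_mem.
    by rewrite index_cat b1 => ib; have := ltn_trans ib lt; rewrite ltnn.
  - by rewrite ia ltnn.
  case/orP => [/eqP ->|bC]; first by rewrite io ltnn.
  have [//|nB] := boolP (b \in B); have [b1|n1] := boolP (b \in s1).
    have lt : index b s1 < size s1 by rewrite index_mem.
    by rewrite index_cat b1 => ib; have := ltn_trans ib lt; rewrite ltnn.
  rewrite index_cat (negbTE n1) /=; case: eqP => [_|_]; first by rewrite addn0 ltnn.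
  by rewrite index_cat (negbTE nB) ltn_add2l ltnS [_ + _ < _]ltnNge leq_addr.
have [obB'|nob] := boolP (opp b \in B).
  have lt : index (opp b) B < size B by rewrite index_mem.
  by rewrite idx // ltn_add2l ltnS lt andbT -[X in X < _]addn0 ltn_add2l.
case/negP: nad; rewrite /adj ne /=.
have nv Y : (forall x, x \in Y -> x \in s1 ++ B ++ C) -> vert a \notin map (@vert G) Y.
  move=> sY; apply/mapP => -[x xY e]; have xs := sY x xY.
  move: cnt; rewrite !(map_cat, map_cons) /= !(count_cat) /= ?(map_cat, map_cons) ?count_cat /=.
  rewrite !vert_opp !eqxx => cnt.
  have : 0 < count_mem (vert a) (map (@vert G) (s1 ++ B ++ C)).
    by rewrite -has_count; apply/hasP; exists (vert a); rewrite /= ?eqxx // e; exact: map_f.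
  by rewrite !map_cat !count_cat (two_occurrences cnt).
have sub1 x : x \in s1 -> x \in s1 ++ B ++ C by move=> h; rewrite mem_cat h.
have sub2 x : x \in B -> x \in s1 ++ B ++ C by move=> h; rewrite !mem_cat h orbT.
have sub3 x : x \in C -> x \in s1 ++ B ++ C by move=> h; rewrite !mem_cat h !orbT.
have vE : map (@vert G) (s1 ++ a :: B ++ opp a :: C) =
    map (@vert G) s1 ++ vert a :: map (@vert G) B ++ vert a :: map (@vert G) C.
  by rewrite map_cat /= map_cat /= vert_opp.
rewrite vE il_cat /= il_cat /= par_cat par_cons eqxx (negbTE ne) /=.
rewrite !(il_notin _ (nv _ _)) // !(par_notin (nv _ _)) //=.
have -> : par (map (@vert G) B) (vert b).
  rewrite /par count_map (_ : count _ B = count (pred1 b) B).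
    by rewrite count_uniq_mem ?bB //; move: u2; rewrite cat_uniq => /andP[].
  apply: eq_in_count => x xB /=; apply/eqP/eqP => [e|-> //].
  case: (bv x _ e) => // [|E]; first by rewrite mem_cat inE mem_cat xB !orbT.
  by rewrite -E xB in nob.
by case: (par _ _).
Qed.

End Pivot.

(** * Odd closed walks of interlaced vertices *)

Fixpoint words3 (n : nat) : seq (seq nat) :=
  if n is n'.+1 then flatten [seq [seq i :: w | w <- words3 n'] | i <- iota 0 3]
  else [:: [::]].

Lemma mem_words3 (w : seq nat) : all (fun i => i < 3) w -> w \in words3 (size w).
Proof.
elim: w => [|i w IH] //= /andP[i3 /IH wm].
by case: i i3 => [|[|[|//]]] _; rewrite !mem_cat map_f ?orbT.
Qed.

Lemma il_map (S T : eqType) (f : S -> T) (w : seq S) (z u : S) :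
  {in w, forall v, (f v == f z) = (v == z)} ->
  {in w, forall v, (f v == f u) = (v == u)} -> il (map f w) (f z) (f u) = il w z u.
Proof.
move=> fz fu; elim: w fz fu => [|x w IH] //= fz fu.
rewrite IH; [|by move=> v vw; rewrite fz // inE vw orbT|by move=> v vw; rewrite fu // inE vw orbT].
rewrite fz ?inE ?eqxx //; congr ((_ && _) (+) _); rewrite /par count_map; congr odd.
by apply: eq_in_count => v vw /=; rewrite fu // inE vw orbT.
Qed.

Definition interlaced_triple (w : seq nat) : bool :=
  [&& count_mem 0 w == 2, count_mem 1 w == 2, count_mem 2 w == 2,
      il w 0 1, il w 1 2 & il w 2 0].

Definition triples : seq (seq nat) :=
  [:: [:: 0; 1; 2]; [:: 0; 2; 1]; [:: 1; 0; 2]; [:: 1; 2; 0]; [:: 2; 0; 1]; [:: 2; 1; 0]].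

(** All 729 words of length 6 in three letters are checked by computation. *)
Lemma interlaced_tripleP :
  all (fun w => interlaced_triple w ==> (w \in [seq t ++ t | t <- triples])) (words3 6).
Proof. by vm_compute. Qed.

(** Renaming [x], [y], [z] to 0, 1, 2 reduces the claim to the finite check; the entry of [triples]
    found there gives the order of the three letters. *)
Lemma triangle_word (T : eqType) (w : seq T) (x y z : T) :
  (forall v, v \in [:: x; y; z] -> count_mem v w = 2) ->
  adj w x y -> adj w y z -> adj w z x ->
  exists a b c, uniq [:: a; b; c] /\
    [seq v <- w | v \in [:: a; b; c]] = [:: a; b; c; a; b; c].
Proof.
move=> c2 /andP[xy ixy] /andP[yz iyz] /andP[zx izx].
have uX : uniq [:: x; y; z] by rewrite /= !inE negb_or xy yz eq_sym zx.
set X := [:: x; y; z] in c2 uX *; pose wf := [seq v <- w | v \in X].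
pose f v := index v X.
have fx : f x = 0 by rewrite /f /= eqxx.
have fy : f y = 1 by rewrite /f /= (negbTE xy) eqxx.
have fz : f z = 2 by rewrite /f /= (eq_sym x z) (negbTE zx) (negbTE yz) eqxx.
have fI v u : v \in X -> u \in X -> (f v == f u) = (v == u).
  move=> vX uX'; apply/eqP/eqP => [e|-> //].
  by rewrite -(nth_index x vX) -(nth_index x uX') -/(f v) e.
have wfX v : v \in wf -> v \in X by rewrite mem_filter => /andP[].
have [xX yX zX] : [/\ x \in X, y \in X & z \in X] by rewrite !inE !eqxx ?orbT.
have cf v : v \in X -> count_mem (f v) (map f wf) = 2.
  move=> vX; rewrite -(c2 v vX) count_map count_filter; apply: eq_count => u /=.
  case: (boolP (u \in X)) => uX'; first by rewrite fI // andbT.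
  by rewrite andbF; apply/esym/negbTE; apply: contra uX' => /eqP ->.
have ilf v u : v \in X -> u \in X -> il (map f wf) (f v) (f u) = il w v u.
  move=> vX uX'; rewrite il_map; first exact: il_filter.
    by move=> t /wfX tX; exact: fI.
  by move=> t /wfX tX; exact: fI.
have tr : interlaced_triple (map f wf).
  have := (ilf x y xX yX, ilf y z yX zX, ilf z x zX xX).
  have := (cf x xX, cf y yX, cf z zX); rewrite fx fy fz => c i.
  by rewrite /interlaced_triple !c !i ixy iyz izx.
have sz : size (map f wf) = 6.
  rewrite size_map size_filter.
  transitivity (count_mem x w + (count_mem y w + count_mem z w)); last by rewrite !c2.
  elim: {c2 wf wfX cf ilf tr ixy iyz izx} w => [|v w IH] //=; rewrite IH /X !inE.
  case: (eqVneq v x) => [->|_]; first by rewrite (negbTE xy) eq_sym (negbTE zx) /=; lia.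
  case: (eqVneq v y) => [->|_]; first by rewrite (negbTE yz) /=; lia.
  by case: (v == z); lia.
have mw : map f wf \in words3 6.
  rewrite -sz; apply: mem_words3; apply/allP => i /mapP[v /wfX vX ->].
  by rewrite /f -[3]/(size X) index_mem.
have := allP interlaced_tripleP _ mw; rewrite tr => /mapP[t tt tE].
have wfE : wf = map (nth x X) t ++ map (nth x X) t.
  rewrite -map_cat -tE -map_comp -[LHS]map_id; apply/eq_in_map => v /wfX vX /=.
  by rewrite /f nth_index.
have [a [b [c [pX tE']]]] : exists a b c, perm_eq [:: a; b; c] X /\
    map (nth x X) t = [:: a; b; c].
  have go a b c : perm_eq [:: a; b; c] X -> map (nth x X) t = [:: a; b; c] ->
      exists a b c, perm_eq [:: a; b; c] X /\ map (nth x X) t = [:: a; b; c].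
    by move=> *; exists a, b, c.
  move: tt; rewrite !inE => /or4P[/eqP tt|/eqP tt|/eqP tt|/or3P[] /eqP tt]; rewrite tt in go *.
  - by apply: (go x y z).
  - by apply: (go x z y); [apply/permP => P /=; case: (P x); case: (P y); case: (P z) | ].
  - by apply: (go y x z); [apply/permP => P /=; case: (P x); case: (P y); case: (P z) | ].
  - by apply: (go y z x); [apply/permP => P /=; case: (P x); case: (P y); case: (P z) | ].
  - by apply: (go z x y); [apply/permP => P /=; case: (P x); case: (P y); case: (P z) | ].
  - by apply: (go z y x); [apply/permP => P /=; case: (P x); case: (P y); case: (P z) | ].
exists a, b, c; split; first by rewrite (perm_uniq pX).
rewrite -[RHS]/([:: a; b; c] ++ [:: a; b; c]) -tE' -wfE.
by apply: eq_filter => v; rewrite tE' (perm_mem pX).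
Qed.

(* A chordless odd closed walk is shortened by two steps by changing the state
   at two consecutive vertices, down to three pairwise interlaced vertices. *)
Lemma odd_walk_minor_Delta (m : nat) (G : framed4graph) (p : dart G -> dart G)
    (s : seq (dart G)) (f : nat -> vertex G) :
  state p -> circuit p s -> odd m -> walk (map (@vert G) s) m f -> minor Delta G.
Proof.
elim/ltn_ind: m p s f => m IH p s f sp cs om wk.
have ev := circuit_even sp cs; have [fs fp] := wk.
have vs i : f i \in map (@vert G) s.
  by apply: (@adj_mem _ _ (f i.+1)); rewrite adj_sym.
have m1 : m != 1.
  by apply/eqP => e; have := fs 0; rewrite -[1]/(0 + 1) -e fp /adj eqxx.
have [m3|m3] := eqVneq m 3.
  have c2 v : v \in [:: f 0; f 1; f 2] -> count_mem v (map (@vert G) s) = 2.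
    move=> vf; have : v \in map (@vert G) s by move: vf; rewrite !inE => /or3P[] /eqP ->.
    by case/mapP => d ds ->; exact: (circuit_count sp cs).
  have f3 : adj (map (@vert G) s) (f 2) (f 0).
    by have := fs 2; rewrite -[3]/(0 + 3) -m3 fp.
  have [a [b [c [uabc wE]]]] := triangle_word c2 (fs 0) (fs 1) f3.
  exact: minor_Delta_word sp cs uabc wE.
have m5 : 4 < m by case: m om m1 m3 {IH wk fp} => [|[|[|[|[|m]]]]].
have shorter m' f' : m' < m -> odd m' -> walk (map (@vert G) s) m' f' -> minor Delta G.
  by move=> lt o w'; exact: (IH m' lt p s f').
have chord k i : 2 <= i <= m - 2 ->
    adj (map (@vert G) s) (f k) (f (k + i)) || (f k == f (k + i)) -> minor Delta G.
  move=> iP; have := walk_chord ev (walk_shift k wk) om iP; rewrite addn0 => h /h.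
  by case=> m' [f' [lt o w']]; exact: shorter w'.
(* Chords are sought only at [f 0] and [f 1], where the pivot is going to take place. *)
case: (boolP [exists i : 'I_m, (2 <= i <= m - 2) &&
    [|| adj (map (@vert G) s) (f 0) (f i), f 0 == f i,
        adj (map (@vert G) s) (f 1) (f i.+1) | f 1 == f i.+1]]).
  case/existsP => i /andP[iP h]; have [h0|h0] := boolP (adj (map (@vert G) s) (f 0) (f i) || (f 0 == f i)).
    by apply: (chord 0 i).
  apply: (chord 1 i) => //; rewrite add1n; move: h0 h.
  by case: (adj _ _ _); case: (f 0 == f i).
rewrite negb_exists => /forallP nch.
have nch' i : 2 <= i <= m - 2 -> [/\ ~~ adj (map (@vert G) s) (f 0) (f i), f 0 != f i,
    ~~ adj (map (@vert G) s) (f 1) (f i.+1) & f 1 != f i.+1].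
  move=> iP; have im : i < m by lia.
  by have := nch (Ordinal im); rewrite /= iP /= !negb_or => /and4P[].
have [n [dx [dy [B [C [D [E [rE xE yE av]]]]]]]] := circuit_interlaced sp cs (fs 0).
set w := map (@vert G) s in ev fs fp wk vs shorter chord nch nch' *.
have crs := circuit_rot n cs; rewrite rE in crs.
have av' : forall e, e \in B ++ C ++ D ++ E -> vert e != vert dx /\ vert e != vert dy.
  by rewrite xE yE.
have ncs := circuit_pivot sp crs av'.
pose w1 := map (@vert G) (rot n s).
have il1 z u : il w1 z u = il w z u by rewrite /w1 map_rot il_rot.
have ev1 : even_word w1 by rewrite /w1; apply: (circuit_even sp); exact: circuit_rot.
pose v (Y : seq (dart G)) := map (@vert G) Y.
have w1E : w1 = f 0 :: v B ++ f 1 :: v C ++ f 0 :: v D ++ f 1 :: v E.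
  by rewrite /w1 rE /= !map_cat /= !map_cat /= !map_cat /= !vert_opp xE yE.
set s' := _ :: _ in ncs; have w'E : map (@vert G) s' =
    f 0 :: v B ++ f 1 :: v E ++ f 0 :: v D ++ f 1 :: v C.
  by rewrite /s' /= !map_cat /= !map_cat /= !map_cat /= !vert_opp xE yE.
have n0 : f 0 \notin v B ++ v C ++ v D ++ v E.
  by rewrite /v -!map_cat; apply/mapP => -[e /av[e0 _] ee]; rewrite ee eqxx in e0.
have n1 : f 1 \notin v B ++ v C ++ v D ++ v E.
  by rewrite /v -!map_cat; apply/mapP => -[e /av[_ e0] ee]; rewrite ee eqxx in e0.
have n01 : f 0 != f 1 by case/andP: (fs 0).
have pivot z u : z != f 0 -> z != f 1 -> u != f 0 -> u != f 1 ->
    il (map (@vert G) s') z u = il w z u (+)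
      ((il w (f 0) z && il w (f 1) u) (+) (il w (f 0) u && il w (f 1) z)).
  move=> z0 z1 u0 u1; rewrite w'E; rewrite w1E in ev1 il1.
  by rewrite (il_pivot n0 n1 z0 z1 u0 u1 n01 ev1) !il1.
have fm : f m = f 0 by rewrite -[m in LHS]add0n fp.
have fm1 : f m.+1 = f 1 by rewrite -add1n fp.
have f0 j : 2 <= j < m -> f 0 != f j.
  move=> jP; have [e|ne] := eqVneq j m.-1.
    have := fs j; rewrite e prednK; last lia.
    by rewrite fm => /andP[]; rewrite eq_sym.
  by have [] := nch' j ltac:(lia).
have f1 j : 2 <= j < m -> f 1 != f j.
  move=> jP; have [e|ne] := eqVneq j 2; first by rewrite e; case/andP: (fs 1).
  by have [_ _ _] := nch' j.-1 ltac:(lia); rewrite prednK //; lia.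
(* Without chords, [f 0] is adjacent only to [f m.-1] and [f 1] only to [f 2] among the remaining
   vertices of the walk, so the pivot changes only the adjacency of [f m.-1] and [f 2]. *)
have a0 j : 2 <= j < m -> il w (f 0) (f j) = (j == m.-1).
  move=> jP; have [e|ne] := eqVneq j m.-1.
    have := fs j; rewrite {2}e prednK; last lia.
    by rewrite fm adj_sym // => /andP[].
  have [h _ _ _] := nch' j ltac:(lia); move: h; rewrite /adj f0 //=.
  exact: negbTE.
have a1 j : 2 <= j < m -> il w (f 1) (f j) = (j == 2).
  move=> jP; have [e|ne] := eqVneq j 2; first by rewrite e; case/andP: (fs 1).
  have [_ _ h _] := nch' j.-1 ltac:(lia); move: h; rewrite prednK; last lia.
  by rewrite /adj f1 //= => /negbTE.
have pv i j : 2 <= i < m -> 2 <= j < m -> il (map (@vert G) s') (f i) (f j) =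
    il w (f i) (f j) (+) (((i == m.-1) && (j == 2)) (+) ((j == m.-1) && (i == 2))).
  by move=> iP jP; rewrite pivot; [rewrite !a0 // !a1 | rewrite eq_sym f0
    | rewrite eq_sym f1 | rewrite eq_sym f0 | rewrite eq_sym f1].
have o2 : odd (m - 2) by rewrite oddB ?om //; lia.
have wk' (t : seq (vertex G)) : (forall i, 2 <= i < m.-1 -> adj t (f i) (f i.+1)) ->
    adj t (f m.-1) (f 2) -> walk t (m - 2) (fun i => f (2 + i %% (m - 2))).
  move=> ti tc; apply: (@mk_walk _ t (m - 2) (fun i => f (2 + i))); first lia.
    by move=> i im; rewrite addnS; apply: ti; lia.
  by rewrite addn0 (_ : 2 + _ = m.-1) //; lia.
have neq : f m.-1 != f 2.
  apply/eqP => e; have := a0 m.-1 ltac:(lia); rewrite e a0 ?eqxx; last lia.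
  by move/eqP; lia.
(* If [f m.-1] and [f 2] are adjacent, they already close a walk of length [m - 2]; otherwise the
   pivot makes them adjacent. *)
case: (boolP (il w (f m.-1) (f 2))) => [i2|ni2].
  apply: (shorter (m - 2) _ _ o2); first lia.
  by apply: wk' => [i _|]; [exact: fs | rewrite /adj neq].
apply: (IH (m - 2) _ _ s' _ (switch_state sp _) ncs o2); first lia.
apply: wk' => [i iP|].
  rewrite /adj; have /andP[-> fi] := fs i; rewrite andTb.
  have [i1 i2] : 2 <= i < m /\ 2 <= i.+1 < m by move: iP; clear; lia.
  rewrite pv // fi; case: (i.+1 =P 2) => [e|_]; first by exfalso; move: iP e; clear; lia.
  by rewrite andbF; case: (i =P 2) => [|_]; [case: (i.+1 =P m.-1); lia | rewrite andbF].
rewrite /adj neq pv; [|lia|lia].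
by rewrite (negbTE ni2) !eqxx; case: (2 =P m.-1); lia.
Qed.

(** * Two-colourings and odd closed walks *)

Section TwoColouring.
Variables (T : finType) (e : rel T).
Hypothesis esym : symmetric e.

Let e2 : rel (T * bool) := fun a b => e a.1 b.1 && (b.2 == ~~ a.2).
Let e2sym : symmetric e2.
Proof. by move=> a b; rewrite /e2 esym; case: a.2; case: b.2. Qed.

(** In the double cover [e2] each step of [e] flips the bit. A path between the two copies of a
    vertex projects to an odd closed walk; if there is none, the colour of [x] is decided by which
    of its copies is joined to [(root, false)]. *)
Lemma two_colouring :
  (exists c : T -> bool, forall x y, e x y -> c x != c y) \/
  exists (m : nat) (f : nat -> T), [/\ odd m, forall i, e (f i) (f i.+1) &
    forall i, f (i + m) = f i].
Proof.
have sc := sym_connect_sym e2sym.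
have [/existsP[x cx]|nx] := boolP [exists x, connect e2 (x, false) (x, true)].
  right; case/connectP: cx => s ps ls.
  have odds a t : path e2 a t -> (last a t).2 = a.2 (+) odd (size t).
    elim: t a => [|b t IH] a /=; first by rewrite addbF.
    case/andP => /andP[_ /eqP ba] /IH ->; rewrite ba addbN addNb //.
  have os : odd (size s) by have := odds _ _ ps; rewrite -ls.
  pose h i := (nth (x, false) ((x, false) :: s) i).1.
  have hs i : i < size s -> e (h i) (h i.+1).
    by move=> lt; have /(pathP (x, false))/(_ i lt)/andP[] := ps.
  have s0 : 0 < size s by case: (size s) os.
  have hl : h (size s) = x by rewrite /h (last_nth (x, false)) in ls *; rewrite -ls.
  exists (size s), (fun i => h (i %% size s)); split=> // i; last by rewrite modnDr.
  rewrite -addn1 -modnDml addn1; have lt := ltn_pmod i s0.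
  have := hs _ lt; move: lt; rewrite leq_eqVlt => /orP[/eqP E|lt]; last by rewrite (modn_small lt).
  by rewrite E modnn hl.
left; have symc := sym_connect_sym esym.
exists (fun x => connect e2 (fingraph.root e x, false) (x, false)) => x y exy.
have rxy : fingraph.root e x = fingraph.root e y by apply/(fingraph.rootP symc); exact: connect1.
have lift a b : connect e a b -> forall c, exists d, connect e2 (a, c) (b, d).
  move=> /connectP[s]; elim: s a => [|z s IH] a /=; first by move=> _ -> c; exists c.
  case/andP=> az pz lz c; have [d cd] := IH z pz lz (~~ c); exists d.
  by apply: connect_trans cd; apply: connect1; rewrite /e2 /= az eqxx.
have xy b : e2 (x, b) (y, ~~ b) by rewrite /e2 /= exy eqxx.
have := nx; rewrite negb_exists => /forallP nx'.
have step b : connect e2 (fingraph.root e x, false) (x, b) = connect e2 (fingraph.root e x, false) (y, ~~ b).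
  by apply: same_connect_r => //; exact: connect1.
have cy : connect e (fingraph.root e x) y by rewrite rxy symc connect_root.
rewrite -rxy step /=; have [[] cd] := lift _ _ cy false; rewrite cd.
  apply/eqP => c2; have /negP := nx' y; apply; apply: connect_trans cd.
  by rewrite sc -c2.
apply/eqP => c2; have /negP := nx' y; apply; apply: (@connect_trans _ _ (fingraph.root e x, false)).
  by rewrite sc cd.
by rewrite c2.
Qed.
End TwoColouring.

(** * A maximal state and the colouring of its chords *)

Section MaximalState.
Variable G : framed4graph.

Lemma vertex_dart (v : vertex G) : {d : dart G | vert d == v}.
Proof.
apply: sigW; have : 0 < #|[set d | vert d == v]| by rewrite four_valent.
by case/card_gt0P => d; rewrite inE; exists d.
Qed.

Lemma vertex_adjacent (a : dart G) : {b : dart G | [&& vert b == vert a, b != a & b != opp a]}.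
Proof.
apply: sigW; have : ~~ ([set d | vert d == vert a] \subset [set a; opp a]).
  apply/negP => /subset_leq_card; rewrite four_valent cards2.
  by case: (_ != _).
by case/subsetPn => b; rewrite !inE negb_or => vb /andP[b1 b2]; exists b; rewrite vb b1 b2.
Qed.

(** At each vertex a chosen half-edge is paired with an adjacent one, and their opposites with each
    other. *)
Lemma state_ex : exists p : dart G -> dart G, state p.
Proof.
pose a v := sval (vertex_dart v); pose b v := sval (vertex_adjacent (a v)).
have va v : vert (a v) = v by rewrite /a; case: vertex_dart => d /= /eqP.
have bP v : [/\ vert (b v) = v, b v != a v & b v != opp (a v)].
  by rewrite /b; case: vertex_adjacent => d /= /and3P[/eqP -> -> ->]; rewrite va.
pose q v d := if d == a v then b v else if d == b v then a v
  else if d == opp (a v) then opp (b v) else opp (a v).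
exists (fun d => q (vert d) d).
have qE v : [/\ q v (a v) = b v, q v (b v) = a v, q v (opp (a v)) = opp (b v)
    & q v (opp (b v)) = opp (a v)].
  have [_ n1 n2] := bP v; have n3 : opp (b v) != a v by rewrite (inv_eq (@oppK G)).
  rewrite /q !eqxx (negbTE n1) (negbTE (opp_neq _)) (negbTE n3) (eq_sym _ (b v)) (negbTE n2).
  by rewrite (negbTE (opp_neq _)) (inj_eq (@opp_inj G)) (negbTE n1).
have P d : exists v, vert d = v /\ [\/ d = a v, d = opp (a v), d = b v | d = opp (b v)].
  exists (vert d); split=> //; have [vb n1 n2] := bP (vert d).
  have := @mem_vertex_opp G (a (vert d)) (b (vert d)) d.
  rewrite vb va => /(_ erefl n1 n2 erefl); rewrite !inE => /or4P[] /eqP e;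
    [by constructor 1 | by constructor 2 | by constructor 3 | by constructor 4].
split=> d; have [v [dv dE]] := P d; have [q1 q2 q3 q4] := qE v; have [vb n1 n2] := bP v.
- by rewrite dv; case: dE => ->; rewrite ?q1 ?q2 ?q3 ?q4 ?vert_opp ?vb ?va ?q1 ?q2 ?q3 ?q4.
- by rewrite dv; case: dE => ->; rewrite ?q1 ?q2 ?q3 ?q4 ?vert_opp ?vb ?va.
- rewrite dv; case: dE => ->; rewrite ?q1 ?q2 ?q3 ?q4 ?(inj_eq (@opp_inj G)) //.
    by rewrite eq_sym.
  by rewrite eq_sym.
rewrite dv; case: dE => ->; rewrite ?q1 ?q2 ?q3 ?q4 ?oppK //.
- by rewrite (inv_eq (@oppK G)).
- by rewrite eq_sym (inv_eq (@oppK G)).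
by rewrite eq_sym.
Qed.

(** The curve leaving along [d] first comes back to its vertex along [p d], since [opp d] is on
    another strand. The way from [d] to [p d] avoids the vertex in between and so survives the
    change of the state there. *)
Lemma switch_connect (p : dart G -> dart G) (d : dart G) :
  state p -> ~~ connect (strand p) d (opp d) ->
  connect (strand (switch p (pred1 (vert d)))) d (p d).
Proof.
move=> sp nd; have pK := stateK sp; have symp := strand_sym pK.
have nf z : connect (strand p) d z -> p z != z by move=> _; exact: state_neq.
set p' := switch _ _; pose phi := turn p.
pose n := (order phi d).-1.
have on : order phi d = n.+1 by rewrite prednK // order_gt0.
have edge_last : edge (iter n phi d) = p d.
  have : phi (iter n phi d) = d by rewrite -iterS -on iter_order //; exact: turn_inj.
  move=> e0; have e1 : p (edge (iter n phi d)) = d := e0.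
  by apply: (can_inj pK); rewrite e1 pK.
have away j : 0 < j <= n -> vert (iter j phi d) != vert d.
  move=> jP; apply/negP => /eqP /(state_mem sp).
  have cj : connect (strand p) d (iter j phi d) by apply: turn_strand; exact: fconnect_iter.
  have no : ~~ connect (strand p) d (p (opp d)).
    apply: contra nd => c; apply: connect_trans c (connect1 _).
    by rewrite /strand pK eqxx orbT.
  rewrite !inE => /or4P[/eqP e|/eqP e|/eqP e|/eqP e].
  - have lt : j < order phi d by rewrite on; lia.
    by have := findex_iter lt; rewrite e findex0; lia.
  - by rewrite -e cj in nd.
  - have /negP := turn_edge pK nf (connect0 _ d); apply.
    apply: (@connect_trans _ _ (p d)); first by rewrite -e; exact: fconnect_iter.
    rewrite (fconnect_sym (turn_inj pK)) (_ : p d = turn p (edge d)) ?fconnect1 //.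
    by rewrite /turn edgeK.
  by rewrite (state_opp sp) -e cj in no.
have st i : i <= n -> connect (strand p') d (edge (iter i phi d)).
  elim: i => [|i IH] i_n; first by apply: connect1; rewrite /strand eqxx.
  apply: connect_trans (IH (ltnW i_n)) _.
  apply: (@connect_trans _ _ (iter i.+1 phi d)); last by apply: connect1; rewrite /strand eqxx.
  apply: connect1; rewrite /strand /p' /switch iterS /phi {2}/turn.
  have := away i.+1 i_n; rewrite iterS {1}/phi {1}/turn (state_vert sp) /= => /negbTE ->.
  by rewrite eqxx orbT.
by rewrite -edge_last; exact: st.
Qed.

(* A state with the largest strand relation: if the two strands at a vertex were
   different, the other smoothing there would merge them. *)
Lemma maximal_state : exists p : dart G -> dart G, state p /\
  forall d, connect (strand p) d (opp d).
Proof.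
pose stb (p : {ffun dart G -> dart G}) := [forall d, [&& p (p d) == d,
  vert (p d) == vert d, p d != d & p d != opp d]].
have stP (p : {ffun dart G -> dart G}) : reflect (state p) (stb p).
  apply: (iffP forallP) => [h|[h1 h2 h3 h4] d]; last by rewrite h1 h2 h3 h4 !eqxx.
  by split=> d; have /and4P[/eqP h1 /eqP h2 h3 h4] := h d.
have [p0 sp0] := state_ex.
have sf0 : stb [ffun d => p0 d].
  case: sp0 => h1 h2 h3 h4; apply/forallP => d.
  by rewrite !ffunE h1 h2 h3 h4 !eqxx.
(* The number of related pairs measures the strand relation; finite functions make the set of states
   finite. *)
pose M (p : {ffun dart G -> dart G}) := #|[set xy : dart G * dart G | connect (strand p) xy.1 xy.2]|.
have [p /stP sp maxp] := arg_maxnP M sf0.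
exists p; split=> // d; apply/negPn/negP => nd.
have pK := stateK sp; have symp := strand_sym pK.
pose p' := switch p (pred1 (vert d)); have sp' := switch_state sp (pred1 (vert d)).
pose p1 := [ffun x => p' x].
have sE : strand p1 =2 strand p' by move=> x y; rewrite /strand ffunE.
have cE x y : connect (strand p1) x y = connect (strand p') x y by exact: eq_connect.
have sp1 : stb p1.
  apply/stP; case: sp' => h1 h2 h3 h4; split=> x; rewrite !ffunE.
  + exact: h1.
  + exact: h2.
  + exact: h3.
  + exact: h4.
have symp' := strand_sym (stateK sp').
have nod : ~~ connect (strand p) (opp d) (opp (opp d)) by rewrite oppK symp.
have c1 := switch_connect sp nd.
have c2 := switch_connect sp nod; rewrite vert_opp -/p' in c1 c2.
have sub x y : connect (strand p) x y -> connect (strand p') x y.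
  apply: connect_sub => {}x {}y /orP[/eqP ->|/eqP ->].
    by apply: connect1; rewrite /strand eqxx.
  have [vx|nvx] := eqVneq (vert x) (vert d); last first.
    by apply: connect1; rewrite /strand /p' /switch /= (negbTE nvx) eqxx orbT.
  have := state_mem sp vx; rewrite !inE => /or4P[] /eqP ->; rewrite -?(state_opp sp) ?pK //.
    by rewrite symp'.
  by rewrite symp'.
have : M p1 <= M p := maxp p1 sp1; rewrite leqNgt => /negP; apply.
apply: proper_card; apply/properP; split.
  by apply/subsetP => -[x y]; rewrite !inE /= cE; exact: sub.
(* This pair is new: it joins the two strands that met at [vert d]. *)
exists (d, p (opp d)); rewrite !inE /= ?cE.
  by apply: connect1; rewrite /strand /p' /switch /= eqxx (state_opp sp) eqxx orbT.
apply: contra nd => c; apply: connect_trans c (connect1 _).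
by rewrite /strand pK eqxx orbT.
Qed.

(** Since [d] and [opp d] are on one strand, the curve leaving along [d] either leaves along [opp d]
    as well, or arrives along [opp d] and leaves along [opp (p d)], which gives [Gamma]. As a root
    of the strand relation, [rep v] is the same for all vertices of a circuit and fixes its starting
    point. *)
Lemma chord_colouring : ~ minor Gamma G -> ~ minor Delta G ->
  exists (p : dart G -> dart G) (rep : vertex G -> dart G) (c : vertex G -> bool),
  [/\ state p,
      forall v, circuit p (orbit (turn p) (rep v)) /\
        v \in map (@vert G) (orbit (turn p) (rep v)),
      forall v u, u \in map (@vert G) (orbit (turn p) (rep v)) -> rep u = rep v &
      forall v u, c v = c u -> ~~ adj (map (@vert G) (orbit (turn p) (rep v))) v u].
Proof.
move=> nG nD; have [p [sp con]] := maximal_state.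
have pK := stateK sp; have symp := strand_sym pK.
have good d : fconnect (turn p) d (opp d).
  case: (strand_turn pK (con d)) => // c; case: nG.
  apply: (turn_opp_minor_Gamma sp (d := d)); apply: connect_trans c _.
  by rewrite (_ : opp (p d) = turn p (edge (opp d))) ?fconnect1 // /turn edgeK (state_opp sp).
pose rep v := fingraph.root (strand p) (sval (vertex_dart v)).
have vd v : vert (sval (vertex_dart v)) = v by case: vertex_dart => d /= /eqP.
have same d e : vert e = vert d -> connect (strand p) d e.
  have cp x : connect (strand p) x (p x) by apply: connect1; rewrite /strand eqxx orbT.
  move=> /(state_mem sp); rewrite !inE => /or4P[] /eqP -> //.
  exact: connect_trans (cp _) (con _).
have cir v : circuit p (orbit (turn p) (rep v)).
  split; [exact: orbit_uniq | by apply: cycle_orbit; exact: turn_inj |].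
  by move=> d; rewrite -!fconnect_orbit => h; exact: connect_trans h (good d).
have mem v : v \in map (@vert G) (orbit (turn p) (rep v)).
  have := connect_root (strand p) (sval (vertex_dart v)); rewrite -/(rep v) symp.
  case/(strand_turn pK) => c; apply/mapP.
    by exists (sval (vertex_dart v)); rewrite ?vd // -fconnect_orbit.
  exists (p (sval (vertex_dart v))); last by rewrite (state_vert sp) vd.
  rewrite -fconnect_orbit; apply: connect_trans c _.
  by rewrite (_ : p _ = turn p (edge (sval (vertex_dart v)))) ?fconnect1 // /turn edgeK.
have repE v u : u \in map (@vert G) (orbit (turn p) (rep v)) -> rep u = rep v.
  case/mapP=> d; rewrite -fconnect_orbit => /turn_strand c uE.
  apply/(fingraph.rootP symp); rewrite symp; apply: (@connect_trans _ _ (rep v)).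
    exact: connect_root.
  by apply: connect_trans c (same _ _ _); rewrite vd.
pose e v u := adj (map (@vert G) (orbit (turn p) (rep v))) v u.
have eE v u : e v u -> rep u = rep v by move=> /adj_mem /repE.
have esym : symmetric e.
  have es v u : e v u -> e u v.
    move=> ev; have r := eE _ _ ev; move: ev; rewrite /e r adj_sym //.
    exact: (circuit_even sp (cir v)).
  by move=> v u; apply/idP/idP; exact: es.
case: (two_colouring esym) => [[c cP]|[m [f [om fs fp]]]].
  exists p, rep, c; split=> // v u cvu; apply/negP => ev.
  by have := cP v u ev; rewrite cvu eqxx.
(* Interlaced vertices lie on one circuit, so the whole walk stays on that of [f 0]. *)
case: nD; apply: (odd_walk_minor_Delta (f := f) sp (cir (f 0)) om); split=> // i.
have -> : rep (f 0) = rep (f i) by elim: i => // i ->; rewrite (eE _ _ (fs i)).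
exact: fs.
Qed.
End MaximalState.

(** * [Delta] contains [Gamma] as an s-minor *)

Lemma even_subgraph_iso (G G' : framed4graph) : isomorphic G G' -> even_subgraph G G'.
Proof.
move=> /isomorphic_sym[fv [fd [bv bd hv hd nc]]].
exists [set: dart G], id, (ncirc G) => val W.
have val4 v : val v = 4.
  by rewrite -(four_valent v); apply: eq_card => d; rewrite !inE.
have -> : W = [set: vertex G] by apply/setP => v; rewrite !inE val4.
split=> //; first by move=> v; rewrite val4.
  by move=> d _; rewrite inE.
exact: pasted_all bv bd hv hd (esym nc).
Qed.

(* The subgraph of Delta formed by the two edges joining vertices 0 and 1 and
   the two joining vertices 0 and 2; [false] labels the loop through 2. *)
Section DeltaGamma.
Let D : finType := ('I_3 * bool * bool)%type.
Let i0 : 'I_3 := @Ordinal 3 0 isT.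
Let i1 : 'I_3 := @Ordinal 3 1 isT.
Let i2 : 'I_3 := @Ordinal 3 2 isT.
Let K : {set dart Delta} := [set d : D |
  [|| d.1.1 == i0, (d.1.1 == i1) && ~~ d.1.2 | (d.1.1 == i2) && d.1.2]].
Let loop (d : D) : bool := if d.1.1 == i0 then d.1.2 else d.1.1 == i1.

Let dartP (P : D -> Prop) :
  (forall s t, P (i0, s, t)) -> (forall s t, P (i1, s, t)) -> (forall s t, P (i2, s, t)) ->
  forall d, P d.
Proof.
move=> P0 P1 P2 [[[[|[|[|//]]] h] s] t].
- by rewrite (_ : Ordinal h = i0) //; exact: val_inj.
- by rewrite (_ : Ordinal h = i1) //; exact: val_inj.
- by rewrite (_ : Ordinal h = i2) //; exact: val_inj.
Qed.

Lemma even_subgraph_Delta_Gamma : even_subgraph Delta Gamma.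
Proof.
(* At the two vertices of valency 2 the half-edges kept are opposite, so [opp] pastes them. *)
exists K, (@opp Delta), 0 => val W.
have v0 : val i0 = 4.
  rewrite -(four_valent (i0 : vertex Delta)); apply: eq_card => d.
  by rewrite !inE; elim/dartP: d => [] [] t.
have v1 : val i1 = 2.
  transitivity #|[set ((i1, false, false) : D); (i1, false, true)]|; last by rewrite cards2.
  by apply: eq_card => d; rewrite !inE; elim/dartP: d => [] [] [].
have v2 : val i2 = 2.
  transitivity #|[set ((i2, true, false) : D); (i2, true, true)]|; last by rewrite cards2.
  by apply: eq_card => d; rewrite !inE; elim/dartP: d => [] [] [].
have WE v : (v \in W) = (v == i0).
  rewrite inE; move: v; case=> [[|[|[|//]]] h].
  - by rewrite (_ : Ordinal h = i0) ?v0 //; exact: val_inj.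
  - by rewrite (_ : Ordinal h = i1) ?v1 //; exact: val_inj.
  - by rewrite (_ : Ordinal h = i2) ?v2 //; exact: val_inj.
have edgeK' (d : D) : d \in K -> edge (d : dart Delta) \in K.
  by rewrite !inE; elim/dartP: d => [] [] t.
have oppK' (d : D) : d \in K -> opp (d : dart Delta) \in K.
  by rewrite !inE; elim/dartP: d => [] [] t.
have loop_edge (d : D) : d \in K -> loop (edge (d : dart Delta)) = loop d.
  by rewrite !inE; elim/dartP: d => [] [] t.
have loop_opp (d : D) : loop (opp (d : dart Delta)) = loop d.
  by elim/dartP: d => [] [] t.
have K0 (d : D) : d \in K -> (d.1.1 == i0) || ((edge (d : dart Delta) : D).1.1 == i0).
  by rewrite !inE; elim/dartP: d => [] [] t.
(* The label [loop] is constant along the chains and so separates the two edges of [Gamma]. *)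
have inv (x y : D) : x \in K -> connect (link W (@opp Delta)) x y ->
    y \in K /\ loop y = loop x.
  move=> xK /connectP[s]; elim/last_ind: s y => [|s z IH] y /=; first by move=> _ ->.
  rewrite rcons_path last_rcons => /andP[/IH /(_ erefl)].
  set w := last _ _ => -[wK wl] wz ->.
  case/orP: wz => [/eqP ->|/andP[_ /eqP ->]].
    by split; [exact: edgeK' | rewrite loop_edge].
  by split; [exact: oppK' | rewrite loop_opp].
pose fd (z : bool * bool) : D := (i0, z.1, z.2).
have fdK z : fd z \in K by rewrite inE eqxx.
split=> //.
- move=> v; move: v; case=> [[|[|[|//]]] h].
  + by rewrite (_ : Ordinal h = i0) ?v0 //; exact: val_inj.
  + by rewrite (_ : Ordinal h = i1) ?v1 //; exact: val_inj.
  + by rewrite (_ : Ordinal h = i2) ?v2 //; exact: val_inj.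
- move=> d dK _; split; [exact: oppK' | exact: vert_opp | exact: opp_neq | exact: oppK].
exists (fun=> i0), fd; split.
- split; first by case=> [] [].
  apply/setP => v; rewrite WE; apply/imsetP/eqP => [[_ _ -> //]|->].
  by exists tt.
- split; first by case=> l b [l' b'] [-> ->].
  apply/setP => d; rewrite inE WE; apply/imsetP/andP => [[z _ ->]|[_ /eqP]].
    by rewrite fdK eqxx.
  case: d => [[v s] t] e; exists (s, t); rewrite ?inE //.
  by congr (_, _, _); exact: e.
- by move=> z.
- apply: (@pasted_edge Delta Gamma W (@opp Delta) fd) => [z|z z' c].
    have lk (d e : D) : (e == edge (d : dart Delta)) || ((d.1.1 != i0) && (e == opp (d : dart Delta))) ->
        connect (link W (@opp Delta)) d e.
      by move=> h; apply: connect1; rewrite /link WE.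
    apply: (@connect_trans _ _ (edge (fd z : dart Delta))); first by apply: lk; rewrite eqxx.
    apply: (@connect_trans _ _ (opp (edge (fd z : dart Delta)))).
      by apply: lk; apply/orP; right; apply/andP; split; [case: z => [[] []] | exact: eqxx].
    by apply: lk; case: z => [[] []].
  have [_] := inv _ _ (fdK z) c; case: z {c} => l b; case: z' => l' b'; rewrite /loop /= => ->.
  by case: b; case: b'; auto.
rewrite (_ : closed_chains _ _ _ = set0) ?cards0 //.
apply/setP=> C; rewrite [in RHS]inE; apply/negbTE/negP => /imsetP[x].
rewrite inE => /andP[xK /forallP h].
case/orP: (K0 x xK) => e.
  by have := h x; rewrite connect0 WE e.
have c : connect (link W (@opp Delta)) x (edge x) by apply: connect1; rewrite /link eqxx.
by have := h (edge x); rewrite c WE /= => /negP; case; exact: e.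
Qed.
End DeltaGamma.

Lemma sminor_Delta_Gamma (G : framed4graph) : minor Delta G -> sminor Gamma G.
Proof.
elim=> {G} [G iso|G G1 sG _ IH|G G1 cG _ IH].
(* An isomorphism can only end a derivation of [sminor], so here it is recast as the passage to the
   full subgraph. *)
- apply: sminor_subgraph (even_subgraph_iso iso) _.
  apply: sminor_subgraph even_subgraph_Delta_Gamma (sminor_iso _).
  by exists id, id; split=> //; exists id.
- exact: sminor_smoothing sG IH.
- exact: sminor_component cG IH.
Qed.

Lemma sminor_of_minor (H G : framed4graph) : minor H G -> sminor H G.
Proof.
elim=> {G} [G iso|G G1 sG _ IH|G G1 cG _ IH].
- exact: sminor_iso.
- exact: sminor_smoothing sG IH.
- exact: sminor_component cG IH.
Qed.

(** * Layouts *)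

(* The circuits of a state are cut open and laid out one after the other on a
   line, each on the block of sites [lo d, .., hi d]; every vertex is a chord
   joining two sites.  The half-edge [d] leaves its site to the right if
   [out d]; only the edge from [hi d] back to [lo d] is not between consecutive
   sites.  Chords of the same colour do not cross. *)
Record layout (G : framed4graph) := Layout {
  site : dart G -> nat;
  out : dart G -> bool;
  col : vertex G -> bool;
  lo : dart G -> nat;
  hi : dart G -> nat;
  nsites : nat;
  site_lt : forall d, site d < nsites;
  site_inj : forall d e, site d = site e -> out d = out e -> d = e;
  site_vert : forall d e, site d = site e -> vert d = vert e;
  site_opp : forall d, site (opp d) != site d;
  vert_site : forall d e, vert d = vert e -> site e = site d \/ site e = site (opp d);
  site_mate : forall d, exists e, site e = site d /\ out e = ~~ out d;
  out_opp : forall d, out (opp d) = out d;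
  out_edge : forall d, out (edge d) = ~~ out d;
  site_edge : forall d, out d ->
    site (edge d) = (site d).+1 \/ site d = hi d /\ site (edge d) = lo d;
  site_block : forall d, lo d <= site d <= hi d;
  block_opp : forall d, lo (opp d) = lo d /\ hi (opp d) = hi d;
  block_edge : forall d, lo (edge d) = lo d /\ hi (edge d) = hi d;
  block_disjoint : forall d e, hi d < lo e \/ hi e < lo d \/ (lo d = lo e /\ hi d = hi e);
  site_nested : forall d e, col (vert d) = col (vert e) ->
    site d < site e < site (opp d) -> site d < site (opp e) < site (opp d)
}.

(** The circuits, listed one after the other in [S], provide the sites. A site is one passage of a
    circuit through a vertex; its half-edges are the one that leaves, which is in [S], and its
    partner under [p], along which the passage arrives. *)
Lemma layout_ex (G : framed4graph) :
  ~ minor Gamma G -> ~ minor Delta G -> inhabited (layout G).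
Proof.
move=> nG nD; have [p [rep [c [sp cir repE col]]]] := chord_colouring nG nD.
have pK := stateK sp; have po := state_opp sp; have pv := state_vert sp.
pose phi := turn p; have phiI : injective phi := turn_inj pK.
pose O v := orbit phi (rep v).
have cirO v : circuit p (O v) by case: (cir v).
have vO v : v \in map (@vert G) (O v) by case: (cir v).
pose L := undup [seq rep v | v <- enum (vertex G)].
pose S := flatten [seq orbit phi r | r <- L].
have LP r : reflect (exists v, r = rep v) (r \in L).
  rewrite mem_undup; apply: (iffP mapP) => [[v _ ->]|[v ->]]; exists v => //.
  by rewrite mem_enum.
have repO v d : d \in O v -> rep (vert d) = rep v.
  by move=> dO; apply: repE; exact: map_f.
have SP d : (d \in S) = (d \in O (vert d)).
  apply/flattenP/idP => [[t /mapP[r /LP[v ->] ->] dO]|dO].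
    by rewrite /O (repO _ _ dO).
  by exists (O (vert d)) => //; apply: map_f; apply/LP; exists (vert d).
have sub_flat L' d : {subset L' <= L} -> d \in flatten [seq orbit phi r | r <- L'] ->
    rep (vert d) \in L'.
  move=> sub /flattenP[t /mapP[r rL' ->] dr]; have /LP[v rE] := sub r rL'.
  by rewrite (repO v) -?rE // /O -rE.
have split_S v : exists A B, S = A ++ O v ++ B /\
    forall d, d \in A -> rep (vert d) != rep v.
  have rL : rep v \in L by apply/LP; exists v.
  have uL : uniq L := undup_uniq _.
  have sL : {subset L <= L} by [].
  move: sub_flat; rewrite /S; move: rL uL; move: (L) => L0 rL.
  case/splitPr: rL => L1 L2; rewrite cat_uniq /= negb_or.
  case/and4P => _ /andP[n1 _] n2 _ sub.
  exists (flatten [seq orbit phi r | r <- L1]), (flatten [seq orbit phi r | r <- L2]).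
  split; first by rewrite map_cat flatten_cat.
  move=> d dA; apply/eqP => e; have := sub L1 d _ dA.
  by rewrite e (negbTE n1) => /(_ _)/negP []; [move=> x xL; rewrite mem_cat xL |].
have OS v d : d \in O v -> d \in S by move=> dO; rewrite SP /O (repO _ _ dO).
have repin v : rep v \in O v by exact: in_orbit.
pose lov v := index (rep v) S; pose k v := order phi (rep v).
have indexO v d : d \in O v -> index d S = lov v + findex phi (rep v) d.
  have [A [B [SE nA]]] := split_S v.
  have ix e : e \in O v -> index e S = size A + index e (O v).
    move=> eO; rewrite SE index_cat ifN ?index_cat ?eO //.
    by apply/negP => /nA; rewrite (repO _ _ eO) eqxx.
  by move=> dO; rewrite /lov !ix // -[index (rep v) _]/(findex phi _ _) findex0 addn0.
have top v : lov v + k v <= size S.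
  have [A [B [SE nA]]] := split_S v.
  rewrite /lov SE index_cat ifN; last by apply/negP => /nA; rewrite (repO _ _ (repin v)) eqxx.
  rewrite index_cat repin -[index (rep v) _]/(findex phi _ _) findex0 addn0.
  by rewrite !size_cat size_orbit leq_add2l leq_addr.
have k0 v : 0 < k v by exact: order_gt0.
have nthP v z i : lov v <= i < lov v + k v -> nth z S i \in O v.
  have [A [B [SE nA]]] := split_S v.
  have lE : lov v = size A.
    rewrite /lov SE index_cat ifN; last by apply/negP => /nA; rewrite (repO _ _ (repin v)) eqxx.
    by rewrite index_cat repin -[index (rep v) _]/(findex phi _ _) findex0 addn0.
  rewrite lE => /andP[l1 l2]; rewrite SE nth_cat ltnNge l1 /=.
  by rewrite nth_cat size_orbit ltn_subLR // l2 mem_nth // size_orbit ltn_subLR.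
have nthO v d : d \in S -> lov v <= index d S < lov v + k v -> d \in O v.
  by move=> dS dr; have := nthP v d _ dr; rewrite nth_index.
have Sopp d : (opp d \in S) = (d \in S).
  have h e : e \in S -> opp e \in S.
    by rewrite !SP vert_opp; have [_ _ os] := cirO (vert e); exact: os.
  by apply/idP/idP => /h //; rewrite oppK.
have Sp d : (p d \in S) = (d \notin S).
  have n e : e \in S -> p e \notin S.
    by rewrite !SP pv => eO; exact: (circuit_notin sp (cirO _) eO).
  have [dS|dS] /= := boolP (d \in S); first exact/negbTE/n.
  have /mapP[e eO ve] := vO (vert d); have eS := OS _ _ eO.
  have := state_mem sp ve; rewrite !inE => /or4P[] /eqP E.
  - by rewrite E eS in dS.
  - by rewrite E Sopp eS in dS.
  - by rewrite E pK.
  by rewrite E po pK Sopp.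
(* The leaving half-edge of the passage to which [d] belongs. *)
pose od d := if d \in S then d else p d.
have odS d : od d \in S by rewrite /od; case: ifP => // dS; rewrite Sp dS.
have odv d : vert (od d) = vert d by rewrite /od; case: ifP.
have odO d : od d \in O (vert d) by rewrite -(odv d) -SP.
have odo d : od (opp d) = opp (od d) by rewrite /od Sopp; case: ifP.
have Ophi v d : d \in O v -> phi d \in O v.
  by rewrite -!fconnect_orbit => /connect_trans; apply; exact: fconnect1.
have rphi d : d \in S -> rep (vert (edge d)) = rep (vert d).
  by rewrite SP => /Ophi /repO; rewrite /phi /turn pv.
have eS d : (edge d \in S) = (d \notin S).
  have n e : e \in S -> edge e \notin S.
    by move=> eS; rewrite -Sp; move: eS; rewrite SP => /Ophi /OS.
  have [dS|dS] /= := boolP (d \in S); first exact/negbTE/n.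
  have pdS : p d \in S by rewrite Sp.
  have /mapP[e eO ve] := vO (vert d).
  have : fconnect phi (finv phi (p d)) (p d) by rewrite -{2}(f_finv phiI (p d)) fconnect1.
  have cs : fconnect phi (rep (vert (p d))) (p d) by rewrite fconnect_orbit -SP.
  rewrite (fconnect_sym phiI) => c1; have := connect_trans cs c1.
  rewrite fconnect_orbit => /OS; rewrite (_ : finv phi (p d) = edge d) //.
  by apply: (phiI); rewrite (f_finv phiI) /phi /turn edgeK.
have rep_edge d : rep (vert (edge d)) = rep (vert d).
  have [/rphi //|dS] := boolP (d \in S).
  by rewrite -[in RHS](edgeK d) (rphi (edge d)) // eS.
pose st d := index (od d) S.
have stO d : st d = lov (vert d) + findex phi (rep (vert d)) (od d) by exact: indexO.
have fk v d : d \in O v -> findex phi (rep v) d < k v.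
  by rewrite -fconnect_orbit; exact: findex_max.
have lovE v u : rep v = rep u -> lov v = lov u /\ k v = k u.
  by rewrite /lov /k => ->.
have odI d e : st d = st e -> od d = od e.
  by move=> E; rewrite -(nth_index d (odS d)) -/(st d) E nth_index.
constructor; apply: (@Layout G st (mem S) c (fun d => lov (vert d))
  (fun d => (lov (vert d) + k (vert d)).-1) (size S)).
- by move=> d; rewrite index_mem.
- move=> d e /odI; rewrite /od /= => E oe; move: E; rewrite -oe; case: ifP => // _.
  exact: (can_inj pK).
- by move=> d e /odI E; rewrite -(odv d) E odv.
- move=> d; apply/eqP => /odI /eqP; rewrite odo; exact/negP/opp_neq.
- move=> d e ve; have eO : od e \in O (vert d) by rewrite ve.
  have [E|E] := circuit_vert sp (cirO _) (odO d) eO (etrans (odv e) (esym (etrans (odv d) ve))).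
    by left; rewrite /st E.
  by right; rewrite /st odo E.
- move=> d; exists (p d); split; last by rewrite /= Sp.
  by rewrite /st /od Sp; case: (d \in S); rewrite /= ?pK.
- by move=> d; rewrite /= Sopp.
- by move=> d; rewrite /= eS.
- move=> d /= dS; have dO : d \in O (vert d) by rewrite -SP.
  have -> : st (edge d) = index (phi d) S by rewrite /st /od eS dS.
  have -> : st d = index d S by rewrite /st /od dS.
  rewrite (indexO (vert d)) ?(indexO _ _ dO); last exact: Ophi.
  have lt := fk _ _ dO.
  have E : phi d = iter (findex phi (rep (vert d)) d).+1 phi (rep (vert d)).
    by rewrite /= iter_findex // fconnect_orbit.
  move: lt; rewrite leq_eqVlt => /orP[/eqP e|lt].
    right; split; first by rewrite -e addnS.
    by rewrite E e iter_order // findex0 addn0.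
  by left; rewrite E findex_iter // addnS.
- move=> d; rewrite stO leq_addr /= -ltnS prednK; first by rewrite ltn_add2l fk.
  by rewrite addn_gt0 k0 orbT.
- by move=> d; rewrite vert_opp.
- by move=> d; have [-> ->] := lovE _ _ (rep_edge d).
(* Overlapping blocks share the larger of their first sites, so they belong to the same circuit. *)
- move=> d e; set i := maxn (lov (vert d)) (lov (vert e)).
  have [h1|h1] := ltnP ((lov (vert d) + k (vert d)).-1) (lov (vert e)); first by left.
  have [h2|h2] := ltnP ((lov (vert e) + k (vert e)).-1) (lov (vert d)); first by right; left.
  right; right.
  have [j1 j2] : i < lov (vert d) + k (vert d) /\ i < lov (vert e) + k (vert e).
    have := k0 (vert d); have := k0 (vert e); move: h1 h2; rewrite /i.
    move: (lov _) (k _) (lov _) (k _) => x1 x2 x3 x4; lia.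
  have xd : nth d S i \in O (vert d) by apply: nthP; rewrite leq_maxl.
  have xe : nth d S i \in O (vert e) by apply: nthP; rewrite leq_maxr.
  by have [-> ->] := lovE _ _ (etrans (esym (repO _ _ xd)) (repO _ _ xe)).
move=> d e cde /andP[h1 h2] /=.
(* A site between two sites of the block of [d] is on the same circuit. *)
have eO : od e \in O (vert d).
  apply: nthO => //; rewrite -/(st e); apply/andP; split.
    by apply: leq_trans (ltnW h1); rewrite stO leq_addr.
  by apply: ltn_trans h2 _; rewrite stO vert_opp ltn_add2l fk // -(vert_opp d).
have rE : rep (vert e) = rep (vert d) by rewrite -(odv e); exact: repO.
have [_ _ os] := cirO (vert d).
have nad : ~~ adj (map (@vert G) (O (vert d))) (vert (od d)) (vert (od e)).
  by rewrite !odv; exact: col.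
have shift x y : x \in O (vert d) -> y \in O (vert d) ->
  (index x S < index y S) = (index x (O (vert d)) < index y (O (vert d))).
  by move=> xO yO; rewrite !(indexO (vert d)) // ltn_add2l.
have := circuit_nested sp (cirO (vert d)) (odO d) eO nad.
rewrite -!shift ?os // ?odO // -!odo; apply.
by rewrite h1 h2.
Qed.

From mathcomp Require Import ring lra.
From mathcomp Require Import all_classical all_reals all_analysis.
Require Import Defs.
Import Order.TTheory GRing.Theory Num.Theory.
Import numFieldNormedType.Exports.
Local Open Scope classical_set_scope.
Local Open Scope ring_scope.

(** * Variation of the argument *)

(** A named form of continuity with the function as its argument, on which the tactic [ct] can
    match. *)
Definition cts (T U : topologicalType) (f : T -> U) : Prop := continuous f.

Section ContinuityKit.
Variables (R : realType) (T : topologicalType).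
Implicit Types f g : T -> R.

Lemma ctC (U : topologicalType) (c : U) : cts (fun _ : T => c).
Proof. by move=> x; apply: cvg_cst. Qed.

Lemma ctD f g : cts f -> cts g -> cts (fun x => f x + g x).
Proof. by move=> cf cg x; apply: cvgD; [exact: cf | exact: cg]. Qed.

Lemma ctN f : cts f -> cts (fun x => - f x).
Proof. by move=> cf x; apply: cvgN; exact: cf. Qed.

Lemma ctM f g : cts f -> cts g -> cts (fun x => f x * g x).
Proof. by move=> cf cg x; apply: cvgM; [exact: cf | exact: cg]. Qed.

Lemma ctV f : (forall x, f x != 0) -> cts f ->
  cts (fun x => (f x)^-1).
Proof. by move=> nf cf x; apply: cvgV; [exact: nf | exact: cf]. Qed.

Lemma ctmax f g : cts f -> cts g ->
  cts (fun x => Num.max (f x) (g x)).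
Proof. by move=> cf cg x; apply: continuous_max; [exact: cf | exact: cg]. Qed.

Lemma ctmin f g : cts f -> cts g ->
  cts (fun x => Num.min (f x) (g x)).
Proof. by move=> cf cg x; apply: continuous_min; [exact: cf | exact: cg]. Qed.

Lemma ctcomp (U V : topologicalType) (h : U -> V) (k : T -> U) :
  cts h -> cts k -> cts (fun x => h (k x)).
Proof. by move=> ch ck x; apply: (cvg_comp _ _ (ck x)); exact: ch. Qed.

Lemma ctP (U V : topologicalType) (h : T -> U) (k : T -> V) :
  cts h -> cts k -> cts (fun x => (h x, k x)).
Proof. by move=> ch ck x; apply: cvg_pair; [exact: ch | exact: ck]. Qed.

Lemma ct1 (U V : topologicalType) (h : T -> U * V) :
  cts h -> cts (fun x => (h x).1).
Proof. by move=> ch x; apply: (cvg_comp _ _ (ch x)); exact: cvg_fst. Qed.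

Lemma ct2 (U V : topologicalType) (h : T -> U * V) :
  cts h -> cts (fun x => (h x).2).
Proof. by move=> ch x; apply: (cvg_comp _ _ (ch x)); exact: cvg_snd. Qed.

Lemma ctid : cts (fun x : T => x).
Proof. by move=> x; apply: cvg_id. Qed.

Lemma ctsum (n : nat) (F : nat -> T -> R) :
  (forall k, (k < n)%N -> cts (F k)) ->
  cts (fun x => \sum_(k < n) F k x).
Proof.
elim: n => [|n IH] cF.
  rewrite (_ : (fun _ => _) = fun=> 0); first exact: ctC.
  by apply/funext => x; rewrite big_ord0.
rewrite (_ : (fun _ => _) = fun x => \sum_(k < n) F k x + F n x); last first.
  by apply/funext => x; rewrite big_ord_recr.
by apply: ctD; [apply: IH => k kn; apply: cF; lia | exact: cF].
Qed.
End ContinuityKit.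

Section Clamp.
Variable R : realType.

(** Composition with [clamp 0 1] extends curves from the unit interval to the line, so that
    continuity on the whole line can be used. *)
Definition clamp (a b t : R) : R := Num.max a (Num.min b t).

Lemma clamp_itv a b t : a <= b -> a <= clamp a b t <= b.
Proof.
by move=> ab; rewrite /clamp /Num.max /Num.min; case: ifP; case: ifP; lra.
Qed.

Lemma clamp_id a b t : a <= t <= b -> clamp a b t = t.
Proof. by rewrite /clamp /Num.max /Num.min; case: ifP; case: ifP; lra. Qed.

Lemma ct_clamp (T : topologicalType) a b (f : T -> R) :
  cts f -> cts (fun x => clamp a b (f x)).
Proof.
move=> cf; apply: (ctmax (f := fun=> a)); first exact: ctC.
by apply: (ctmin (f := fun=> b)); [exact: ctC | exact: cf].
Qed.

End Clamp.

Ltac ct := repeat lazymatch goal with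
  | |- cts (fun x => x) => apply: ctid
  | |- cts (fun _ => ?c) => apply: ctC
  | |- cts (fun x => @?f x + @?g x) => apply: (@ctD _ _ f g)
  | |- cts (fun x => - @?f x) => apply: (@ctN _ _ f)
  | |- cts (fun x => @?f x * @?g x) => apply: (@ctM _ _ f g)
  | |- cts (fun x => Num.max (@?f x) (@?g x)) => apply: (@ctmax _ _ f g)
  | |- cts (fun x => Num.min (@?f x) (@?g x)) => apply: (@ctmin _ _ f g)
  | |- cts (fun x => (@?f x, @?g x)) => apply: (@ctP _ _ _ f g)
  | |- cts (fun x => (@?f x).1) => apply: (@ct1 _ _ _ f)
  | |- cts (fun x => (@?f x).2) => apply: (@ct2 _ _ _ f)
  | |- cts (fun x => clamp ?a ?b (@?f x)) => apply: (@ct_clamp _ _ a b f)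
  | |- cts (fun x => ?h (@?f x)) =>
    first [ assumption | apply: (@ctcomp _ _ _ h f); [assumption|] ]
  | |- cts ?f => assumption
  end.

Section Angle.
Variable R : realType.
Local Notation plane := (R * R)%type.
Implicit Types (p q : plane) (u v : R).

Definition dot p q : R := p.1 * q.1 + p.2 * q.2.
Definition cross p q : R := p.1 * q.2 - p.2 * q.1.

(* [u] is an argument of [p]. *)
Definition ang p u : Prop :=
  p.1 * sin u = p.2 * cos u /\ 0 < p.1 * cos u + p.2 * sin u.

Lemma ang_polar p u : ang p u ->
  exists2 r : R, 0 < r & p = (r * cos u, r * sin u).
Proof.
case=> e1 e2; exists (p.1 * cos u + p.2 * sin u) => //.
have cs := cos2Dsin2 u; rewrite [LHS]surjective_pairing; congr (_, _).
  rewrite -[LHS]mulr1 -cs mulrDr [sin u ^+ 2]expr2 mulrA e1; ring.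
rewrite -[LHS]mulr1 -cs mulrDr [cos u ^+ 2]expr2 mulrA -e1; ring.
Qed.

(** Vectors at an acute angle differ in argument by the arctangent of the ratio of [cross] to
    [dot]. *)
Lemma ang_step p q u : ang q u -> 0 < dot q p ->
  ang p (u + atan (cross q p / dot q p)).
Proof.
move=> /ang_polar[r r0 ->]; rewrite /dot /cross /=.
set c := cos u; set s := sin u.
set w := p.2 * c - p.1 * s; set z := p.1 * c + p.2 * s.
rewrite (_ : r * c * p.2 - _ = r * w); last by rewrite /w; ring.
rewrite (_ : r * c * p.1 + _ = r * z); last by rewrite /z; ring.
rewrite pmulr_rgt0// => z0.
rewrite -mulf_div divff ?gt_eqF// mul1r.
set a := atan _.
have ca : 0 < cos a.
  by apply: cos_gt0_pihalf; rewrite atan_gtNpi2 atan_ltpi2.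
have tE : sin a = w / z * cos a.
  by have := atanK (w / z); rewrite /tan -/a => <-; rewrite divfK ?gt_eqF.
have zE : z * sin a = w * cos a.
  by rewrite tE mulrA mulrCA divff ?gt_eqF// mulr1.
rewrite /ang sinD cosD -/c -/s; split.
  apply/eqP; rewrite -subr_eq0; apply/eqP.
  transitivity (z * sin a - w * cos a); last by rewrite zE subrr.
  by rewrite /z /w; ring.
rewrite (_ : _ + _ = z * cos a + w * sin a); last by rewrite /z /w; ring.
apply: ltr_wpDr; last exact: mulr_gt0.
by rewrite tE !mulrA mulr_ge0 ?(ltW ca)// -expr2 mulr_ge0 ?sqr_ge0// invr_ge0 ltW.
Qed.

Lemma ang_uniq p u v : ang p u -> ang p v -> cos (v - u) = 1 /\ sin (v - u) = 0.
Proof.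
move=> /ang_polar[r r0 ->] /ang_polar[r' r'0 [e1 e2]].
have rr : r = r'.
  apply/eqP; rewrite -(@eqrXn2 _ 2) ?ltW//; apply/eqP.
  rewrite -[LHS]mulr1 -(cos2Dsin2 u) -[RHS]mulr1 -(cos2Dsin2 v).
  by rewrite !mulrDr -!exprMn e1 e2.
move: e1 e2; rewrite rr => /mulfI e1 /mulfI e2.
rewrite cosB sinB -e1 ?gt_eqF// -e2 ?gt_eqF//.
by rewrite -!expr2 cos2Dsin2; split=> //; ring.
Qed.

Lemma ang_shift p u v : ang p u -> cos v = 1 -> sin v = 0 -> ang p (u + v).
Proof.
by rewrite /ang sinD cosD => h -> ->; rewrite !mulr1 !mulr0 subr0 addr0.
Qed.

(** A nonzero vector has a positive scalar product with one of the four unit vectors on the axes,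
    from which [ang_step] starts. *)
Lemma ang_ex p : p != (0, 0) -> exists u, ang p u.
Proof.
move=> pn; have st q u : ang q u -> 0 < dot q p -> exists v, ang p v.
  by move=> /ang_step h /h; eexists; eauto.
have a0 : ang (1, 0) 0 by rewrite /ang /= cos0 sin0; split; lra.
have a1 : ang (-1, 0) pi by rewrite /ang /= cospi sinpi; split; lra.
have a2 : ang (0, 1) (pi / 2) by rewrite /ang /= cos_pihalf sin_pihalf; split; lra.
have a3 : ang (0, -1) (- (pi / 2)).
  by rewrite /ang /= cosN sinN cos_pihalf sin_pihalf; split; lra.
case: p pn st => x y pn st.
case: (ltrgt0P x) => x0; first by apply: (st _ _ a0); rewrite /dot /=; lra.
  by apply: (st _ _ a1); rewrite /dot /=; lra.
case: (ltrgt0P y) => y0; first by apply: (st _ _ a2); rewrite /dot /=; lra.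
  by apply: (st _ _ a3); rewrite /dot /=; lra.
by move: pn; rewrite x0 y0 eqxx.
Qed.

Lemma ang_opp p u : ang p u -> ang (- p.1, - p.2) (u + pi).
Proof. by rewrite /ang sinDpi cosDpi /= => -[e l]; split; lra. Qed.

Lemma ang_opp_neq p u : ang p u -> ang (- p.1, - p.2) u -> False.
Proof. by case=> _ /= l [_ /=]; lra. Qed.

(** Multiples of [2 pi] are isolated: if [f 0 < f 1], then [f] takes the value [f 0 + d] for some
    [d] with [0 < d <= pi / 2], where the cosine is less than 1. *)
Lemma cos1_const (f : R -> R) : cts f ->
  (forall t, 0 <= t <= 1 -> cos (f t) = 1) -> f 0 = f 1.
Proof.
move=> cf f1.
wlog : f cf f1 / f 0 <= f 1.
  move=> wl; case: (leP (f 0) (f 1)) => l01; first exact: wl.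
  apply: oppr_inj; apply: (wl (fun x => - f x)); last by rewrite lerN2 ltW.
    by ct.
  by move=> t /f1; rewrite cosN.
rewrite le_eqVlt => /orP[/eqP //|lt01].
have p0 : 0 < pi :> R := pi_gt0 R.
pose d : R := Num.min pi (f 1 - f 0) / 2.
have d0 : 0 < d by rewrite /d /Num.min; case: ifP; lra.
have d1 : d <= pi / 2 by rewrite /d /Num.min; case: ifP; lra.
have d2 : d <= f 1 - f 0 by rewrite /d /Num.min; case: ifP; lra.
have [c] : exists2 c, c \in `[0, 1] & f c = f 0 + d.
  apply: IVT => //; first exact: continuous_subspaceT.
  by rewrite ge_min le_max; apply/andP; split; apply/orP; [left|right]; lra.
rewrite in_itv /= => c01 fc.
have s0 : sin (f 0) = 0.
  by apply/eqP; rewrite -norm_cos_eq1 f1 ?normr1 //; lra.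
have : cos d = cos 0.
  have := f1 c c01; rewrite fc cosD s0 f1; last lra.
  by rewrite mul1r mul0r subr0 cos0.
by move/cos_inj; rewrite !in_itv /= => h; have := h _ _; lra.
Qed.

Definition lifts (f : R -> plane) (h : R -> R) : Prop :=
  cts h /\ forall t, 0 <= t <= 1 -> ang (f t) (h t).

(* The variation of the argument along [f], meaningful only for curves that
   avoid the origin. *)
Definition vr (f : R -> plane) : R :=
  let h := xget (fun=> 0) [set h | lifts f h] in h 1 - h 0.

(** Two lifts differ by a multiple of [2 pi] at each time, hence by a constant, so [vr] does not
    depend on the lift chosen by [xget]. *)
Lemma vrE f h : lifts f h -> vr f = h 1 - h 0.
Proof.
move=> lh; rewrite /vr; case: xgetP => [k _ lk|/(_ _ lh) //].
case: lh lk => ch ah [ck ak].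
have : h 0 - k 0 = h 1 - k 1.
  apply: (@cos1_const (fun t => h t - k t)); first by ct.
  by move=> t t01; have [] := ang_uniq (ak _ t01) (ah _ t01).
by lra.
Qed.

Lemma eq_vr (f g : R -> plane) :
  (forall t, 0 <= t <= 1 -> f t = g t) -> vr f = vr g.
Proof.
move=> fg; rewrite /vr.
suff -> : [set h | lifts f h] = [set h | lifts g h] by [].
apply/seteqP; split=> h [ch ah]; split=> // t t01; first by rewrite -fg //; apply: ah.
by rewrite fg //; apply: ah.
Qed.

Lemma ang_chain f h u : lifts f h -> ang (f 0) u -> ang (f 1) (u + vr f).
Proof.
move=> lh au; rewrite (vrE lh); case: lh => _ ah.
have [c s] := ang_uniq (ah 0 ltac:(lra)) au.
have := ang_shift (ah 1 ltac:(lra)) c s; congr (ang _ _); ring.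
Qed.


(** The argument is transported from the corner [(0, 0)] along rays: for a suitable [N] the values
    at the fractions [k / N] and [(k + 1) / N] of every ray form an acute angle, and the [N]
    arctangents are added up. *)
Lemma lift_square (Q : plane -> plane) : cts Q -> (forall z, Q z != (0, 0)) ->
  exists h : plane -> R, cts h /\
    forall t s, 0 <= t <= 1 -> 0 <= s <= 1 -> ang (Q (t, s)) (h (t, s)).
Proof.
move=> cQ nQ.
pose c01 := clamp (0 : R) 1.
have c01P x : 0 <= c01 x <= 1 by apply: clamp_itv.
pose D (r : plane) (z : plane) : R :=
  dot (Q (r.1 * z.1, r.1 * z.2)) (Q (r.2 * z.1, r.2 * z.2)).
pose K := (`[0, 1]%classic `*` `[0, 1]%classic) `*` `[(0 : R), 1]%classic : set (plane * R).
have cK : compact K.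
  by apply: compact_setX; [apply: compact_setX|]; exact: segment_compact.
have Dpos (z : plane) (r : R) : 0 < D (r, r) z.
  rewrite /D /dot /=; set q := Q _; have := nQ (r * z.1, r * z.2); rewrite -/q.
  case: q => x y; rewrite xpair_eqE negb_and /= -!expr2 => /orP[] n0.
    by apply: ltr_pwDl; rewrite ?sqr_ge0 // exprn_even_gt0.
  by apply: ltr_wpDl; rewrite ?sqr_ge0 // exprn_even_gt0.
(* Compactness yields one step length for all rays and all starting points on them. *)
have : \forall h \near (0 : R), K `<=` (fun zs => 0 < D (zs.2, zs.2 + h) zs.1).
  have nc := iffLR (compact_near_coveringP K) cK.
  apply: (nc R (nbhs (0 : R)) (fun h zs => 0 < D (zs.2, zs.2 + h) zs.1)) => -[z s] _.
  pose E (w : plane * R * R) : R := D (w.1.2, w.1.2 + w.2) w.1.1.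
  have cE : cts E.
    by rewrite /E /D /dot /=; ct.
  have E0 : 0 < E ((z, s), 0) by rewrite /E /= addr0.
  have EV : \forall w \near nbhs ((z, s), (0 : R)), 0 < E w.
    exact: (cvgr_gt _ (cE ((z, s), 0)) _ E0).
  by apply: filterS EV => -[[z' s'] h].
move/nbhs_norm0P => [e /= e0 near0].
pose N := (Num.Def.archi_bound e^-1).+1.
have N0 : (0 : R) < N%:R by rewrite ltr0n.
have Ne : N%:R^-1 < e.
  rewrite -[ltRHS]invrK ltf_pV2 ?posrE ?invr_gt0 //.
  apply: (lt_trans (archi_boundP _)); first by rewrite invr_ge0 ltW.
  by rewrite ltr_nat.
pose W (k : nat) (z : plane) : plane :=
  Q (k%:R / N%:R * c01 z.1, k%:R / N%:R * c01 z.2).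
have cW k : cts (W k).
  by rewrite /W /c01; ct.
have dW k z : (k < N)%N -> 0 < dot (W k z) (W k.+1 z).
  move=> kN; have -> : dot (W k z) (W k.+1 z) =
      D (k%:R / N%:R, k%:R / N%:R + N%:R^-1) (c01 z.1, c01 z.2).
    by rewrite /W /D /= -[k.+1%:R]natr1 [(_ + 1) / _]mulrDl mul1r.
  apply: (near0 N%:R^-1 _ ((c01 z.1, c01 z.2), k%:R / N%:R)).
    by rewrite /= ger0_norm // invr_ge0 ltW.
  split=> /=; first by split=> /=; rewrite in_itv /= c01P.
  rewrite in_itv /= divr_ge0 ?ler0n //= ler_pdivrMr // mul1r ler_nat; lia.
have [u0 au0] : exists u, ang (Q (0, 0)) u by apply: ang_ex.
pose F k z := atan (cross (W k z) (W k.+1 z) / dot (W k z) (W k.+1 z)).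
exists (fun z => u0 + \sum_(k < N) F k z); split.
  apply: (@ctD _ _ (fun=> u0)); [ct|]; apply: ctsum => k kN.
  apply: (ctcomp (h := @atan R)); first exact: continuous_atan.
  have ck := cW k; have ck1 := cW k.+1.
  apply: (ctM (f := fun z => cross (W k z) (W k.+1 z))
              (g := fun z => (dot (W k z) (W k.+1 z))^-1)).
    by rewrite /cross; ct.
  apply: (ctV (f := fun z => dot (W k z) (W k.+1 z))).
    by move=> z; rewrite gt_eqF // dW.
  by rewrite /dot; ct.
move=> t s t01 s01.
have step m : (m <= N)%N -> ang (W m (t, s)) (u0 + \sum_(k < m) F k (t, s)).
  elim: m => [|m IH] mN; first by rewrite big_ord0 addr0 /W !mul0r.
  by rewrite big_ord_recr /= addrA; apply: ang_step; [apply: IH; lia | exact: dW].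
have := step N (leqnn _); rewrite /W divff ?gt_eqF // !mul1r.
by rewrite /c01 !clamp_id.
Qed.

Lemma lift_path (f : R -> plane) : cts f -> (forall t, f t != (0, 0)) ->
  exists h, lifts f h.
Proof.
move=> cf nf; have [|//|h [ch ah]] := @lift_square (fun z => f z.1).
  by ct.
exists (fun t => h (t, 0)); split; first by ct.
by move=> t t01; apply: ah => //; lra.
Qed.

(** Homotopy invariance: a lift on the whole square has total variation zero around its boundary. *)
Lemma vr_square (Q : R -> R -> plane) :
  cts (fun z : plane => Q z.1 z.2) ->
  (forall t s, 0 <= t <= 1 -> 0 <= s <= 1 -> Q t s != (0, 0)) ->
  vr (Q^~ 1) - vr (Q^~ 0) = vr (Q 1) - vr (Q 0).
Proof.
move=> cQ nQ; pose c01 := clamp (0 : R) 1.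
have c01P x : 0 <= c01 x <= 1 by apply: clamp_itv.
have [|z|h [ch ah]] := @lift_square (fun z => Q (c01 z.1) (c01 z.2)).
- apply: (ctcomp (h := fun z : plane => Q z.1 z.2) (k := fun z => (c01 z.1, c01 z.2))) => //.
  by rewrite /c01; ct.
- by apply: nQ; apply: c01P.
have i0 : 0 <= (0 : R) <= 1 by lra.
have i1 : 0 <= (1 : R) <= 1 by lra.
have ahQ t s : 0 <= t <= 1 -> 0 <= s <= 1 -> ang (Q t s) (h (t, s)).
  by move=> t01 s01; have := ah _ _ t01 s01; rewrite /c01 /= !clamp_id.
rewrite (@vrE (Q^~ 1) (fun t => h (t, 1))); last first.
  by split; [ct | move=> t t01; exact: ahQ].
rewrite (@vrE (Q^~ 0) (fun t => h (t, 0))); last first.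
  by split; [ct | move=> t t01; exact: ahQ].
rewrite (@vrE (Q 1) (fun t => h (1, t))); last first.
  by split; [ct | move=> t t01; exact: ahQ].
rewrite (@vrE (Q 0) (fun t => h (0, t))); last first.
  by split; [ct | move=> t t01; exact: ahQ].
by ring.
Qed.

Definition vpath (f : R -> plane) : Prop :=
  cts f /\ forall t, 0 <= t <= 1 -> f t != (0, 0).

Lemma vpath_lifts f : vpath f -> exists h, lifts f h.
Proof.
move=> [cf nf]; have [||h [ch ah]] := @lift_path (fun t => f (clamp 0 1 t)).
- by ct.
- by move=> t; apply: nf; apply: clamp_itv.
by exists h; split=> // t t01; have := ah _ t01; rewrite clamp_id.
Qed.

Lemma vr_affine f a b c : vpath f -> 0 <= a <= 1 -> 0 <= b <= 1 -> 0 <= c <= 1 ->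
  vr (fun t => f (a + t * (c - a))) =
  vr (fun t => f (a + t * (b - a))) + vr (fun t => f (b + t * (c - b))).
Proof.
move=> /vpath_lifts[h [ch ah]] a01 b01 c01.
have lf u v : 0 <= u <= 1 -> 0 <= v <= 1 ->
    vr (fun t => f (u + t * (v - u))) = h v - h u.
  move=> u01 v01; rewrite (@vrE _ (fun t => h (u + t * (v - u)))).
    by rewrite mul1r mul0r addr0 [u + _]addrC subrK.
  split; first by ct.
  by move=> t t01; apply: ah; nra.
by rewrite !lf //; ring.
Qed.

Lemma vr_rev f : vpath f -> vr (fun t => f (1 - t)) = - vr f.
Proof.
move=> /vpath_lifts[h lh]; rewrite (vrE lh); case: lh => ch ah.
rewrite (@vrE _ (fun t => h (1 - t))); first by rewrite subrr subr0; ring.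
split; first by ct.
by move=> t t01; apply: ah; lra.
Qed.

Lemma vr_neg f : vpath f -> vr (fun t => (- (f t).1, - (f t).2)) = vr f.
Proof.
move=> /vpath_lifts[h lh]; rewrite (vrE lh); case: lh => ch ah.
rewrite (@vrE _ (fun t => h t + pi)); first by ring.
split; first by ct.
by move=> t t01; apply: ang_opp; exact: ah.
Qed.

Lemma vr_const p : p != (0, 0) -> vr (fun=> p) = 0.
Proof.
move=> /ang_ex[u au]; rewrite (@vrE _ (fun=> u)) ?subrr //.
by split; [ct | ].
Qed.

Lemma vr_ang f u : vpath f -> ang (f 0) u -> ang (f 1) (u + vr f).
Proof. by move=> /vpath_lifts[h lh]; apply: ang_chain lh. Qed.

End Angle.

(** * The jump at a crossing *)

Section LocalJump.
Variable R : realType.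
Local Notation plane := (R * R)%type.
Implicit Types (p q w v : plane).

Definition psub p q : plane := (p.1 - q.1, p.2 - q.2).

Lemma psub_eq0 p q : (psub p q == (0, 0)) = (p == q).
Proof.
by case: p q => a b [c d]; rewrite /psub !xpair_eqE /= !subr_eq0.
Qed.

Lemma mix_gt0 (s x y : R) : 0 <= s <= 1 -> 0 < x -> 0 < y ->
  0 < (1 - s) * x + s * y.
Proof.
move=> s01 x0 y0; case: (ltrP s 1) => s1; last first.
  by rewrite (_ : s = 1); lra.
by apply: ltr_pwDl; [apply: mulr_gt0 => //; lra | apply: mulr_ge0; lra].
Qed.

Definition in_square (e : R) w : Prop := -e <= w.1 <= e /\ -e <= w.2 <= e.

Variables (g : plane -> plane) (e : R).
Hypotheses (e0 : 0 < e) (cg : cts g).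
Hypothesis gI : forall w w', in_square e w -> in_square e w' -> g w = g w' -> w = w'.

Let gap w w' := psub (g w) (g w').
Let half v : plane := (v.1 / 2, v.2 / 2).
Let nhalf v : plane := (- (v.1 / 2), - (v.2 / 2)).
Let odd v := gap (half v) (nhalf v).
Let mix (s : R) w v : plane := ((1 - s) * w.1 + s * v.1, (1 - s) * w.2 + s * v.2).
(** The correction at one end of a homotopy: the variation while the pair [(w, w')] moves straight
    to [(half v, nhalf v)]. *)
Let move w w' v := vr (fun s => gap (mix s w (half v)) (mix s w' (nhalf v))).

Let gap_neq0 w w' : in_square e w -> in_square e w' -> w <> w' -> gap w w' != (0, 0).
Proof. by move=> sw sw' ww; rewrite psub_eq0; apply/eqP => /(gI sw sw'). Qed.

Let mix_square s w v : 0 <= s <= 1 -> in_square e w -> in_square e v ->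
  in_square e (mix s w v).
Proof. by rewrite /in_square /mix /= => s01 [w1 w2] [v1 v2]; split; nra. Qed.

Let half_square v : in_square e v -> in_square e (half v).
Proof. by rewrite /in_square /= => -[h1 h2]; split; lra. Qed.

Let nhalf_square v : in_square e v -> in_square e (nhalf v).
Proof. by rewrite /in_square /= => -[h1 h2]; split; lra. Qed.

Let odd_neq0 v : in_square e v -> v <> (0, 0) -> odd v != (0, 0).
Proof.
move=> sv v0; apply: gap_neq0; [exact: half_square | exact: nhalf_square |].
by case: v sv v0 => x y _ v0 [h1 h2]; apply: v0; congr (_, _); lra.
Qed.

Let oddN v : odd (- v.1, - v.2) = (- (odd v).1, - (odd v).2).
Proof.
have h1 : half (- v.1, - v.2) = nhalf v by rewrite /half /nhalf /= !mulNr.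
have h2 : nhalf (- v.1, - v.2) = half v by rewrite /half /nhalf /= !mulNr !opprK.
by rewrite /odd h1 h2 /gap /psub /= !opprB.
Qed.

(* The straight homotopy from the pair (w, w') to the symmetric pair
   (v / 2, - v / 2) keeps the two points apart as soon as the differences w - w'
   and v stay on the same side of some coordinate axis. *)
Let homotopy (w w' v : R -> plane) :
  cts w -> cts w' -> cts v ->
  (forall t, 0 <= t <= 1 -> in_square e (w t) /\ in_square e (w' t)) ->
  (forall t, 0 <= t <= 1 -> in_square e (v t)) ->
  (forall t, 0 <= t <= 1 ->
     (0 < (w t).1 - (w' t).1 /\ 0 < (v t).1) \/
     ((w t).1 - (w' t).1 < 0 /\ (v t).1 < 0) \/
     (0 < (w t).2 - (w' t).2 /\ 0 < (v t).2) \/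
     ((w t).2 - (w' t).2 < 0 /\ (v t).2 < 0)) ->
  vr (fun t => gap (w t) (w' t)) =
  vr (fun t => odd (v t)) - move (w 1) (w' 1) (v 1) + move (w 0) (w' 0) (v 0).
Proof.
move=> cw cw' cv sw sv dj.
pose Q t s := gap (mix s (w t) (half (v t))) (mix s (w' t) (nhalf (v t))).
have cQ : cts (fun z : plane => Q z.1 z.2).
  by rewrite /Q /gap /psub /mix /half /nhalf /=; ct.
have nQ t s : 0 <= t <= 1 -> 0 <= s <= 1 -> Q t s != (0, 0).
  move=> t01 s01; have [s1 s2] := sw _ t01.
  apply: gap_neq0.
  + by apply: mix_square => //; apply: half_square; apply: sv.
  + by apply: mix_square => //; apply: nhalf_square; apply: sv.
  rewrite /mix /=; case=> h1 h2; have := dj _ t01.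
  have h1' : (1 - s) * ((w t).1 - (w' t).1) + s * (v t).1 = 0 by lra.
  have h2' : (1 - s) * ((w t).2 - (w' t).2) + s * (v t).2 = 0 by lra.
  case=> [|[|[]]] [l1 l2].
  + by have := mix_gt0 s01 l1 l2; rewrite h1' ltxx.
  + have := @mix_gt0 s _ _ s01 (_ : 0 < - ((w t).1 - (w' t).1)) (_ : 0 < - (v t).1).
    by lra.
  + by have := mix_gt0 s01 l1 l2; rewrite h2' ltxx.
  + have := @mix_gt0 s _ _ s01 (_ : 0 < - ((w t).2 - (w' t).2)) (_ : 0 < - (v t).2).
    by lra.
have := vr_square cQ nQ; rewrite /Q.
 have -> : vr (fun t => gap (mix 1 (w t) (half (v t))) (mix 1 (w' t) (nhalf (v t))))
   = vr (fun t => odd (v t)).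
  by apply: eq_vr => t _; rewrite /odd /mix !subrr !mul0r !add0r !mul1r -!surjective_pairing.
have -> : vr (fun t => gap (mix 0 (w t) (half (v t))) (mix 0 (w' t) (nhalf (v t))))
   = vr (fun t => gap (w t) (w' t)).
  by apply: eq_vr => t _; rewrite /mix !subr0 !mul0r !addr0 !mul1r -!surjective_pairing.
by rewrite /move; lra.
Qed.

(* After deforming both points into opposite pairs, the left-hand side becomes
   twice the variation of an odd nowhere vanishing field along a loop around the
   origin, an odd multiple of [2 pi]. *)
Lemma local_jump (r s : R -> R) (h k : R) : cts r -> cts s ->
  r 0 = 0 -> s 0 = 0 ->
  (forall t, 0 < t <= 1 -> 0 < r t <= e) -> (forall t, 0 < t <= 1 -> 0 < s t <= e) ->
  0 < h <= e -> 0 < k <= e ->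
  vr (fun t => psub (g (r t, 0)) (g (0, h))) - vr (fun t => psub (g (- s t, 0)) (g (0, h)))
  - vr (fun t => psub (g (r t, 0)) (g (0, - k))) + vr (fun t => psub (g (- s t, 0)) (g (0, - k)))
  + vr (fun t => psub (g (- s 1, 0)) (g (0, - k + t * (h + k))))
  - vr (fun t => psub (g (r 1, 0)) (g (0, - k + t * (h + k)))) != 0.
Proof.
move=> cr cs r0 s0 rP sP hP kP.
have rP' t : 0 <= t <= 1 -> 0 <= r t <= e.
  move=> t01; have [->|t0] := eqVneq t 0; first by rewrite r0; lra.
  by have := rP t ltac:(lra); lra.
have sP' t : 0 <= t <= 1 -> 0 <= s t <= e.
  move=> t01; have [->|t0] := eqVneq t 0; first by rewrite s0; lra.
  by have := sP t ltac:(lra); lra.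
have r1 := rP 1 ltac:(lra); have s1 := sP 1 ltac:(lra).
(* The six paths [v] run along the sides of the square of half-width [e], each on the same side of
   an axis as the difference of the two points. They share their ends, so that the corrections
   [move] cancel in pairs. *)
rewrite (@homotopy (fun t => (r t, 0)) (fun=> (0, h)) (fun t => (t * e, - e)));
  [|by ct|by ct|by ct| | | ]; last 3 first.
- by move=> t t01; have := rP' _ t01; rewrite /in_square /=; lra.
- by move=> t t01; rewrite /in_square /=; split; nra.
- by move=> t t01 /=; right; right; right; lra.
rewrite (@homotopy (fun t => (- s t, 0)) (fun=> (0, h)) (fun t => (- (t * e), - e)));
  [|by ct|by ct|by ct| | | ]; last 3 first.
- by move=> t t01; have := sP' _ t01; rewrite /in_square /=; lra.
- by move=> t t01; rewrite /in_square /=; split; nra.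
- by move=> t t01 /=; right; right; right; lra.
rewrite (@homotopy (fun t => (r t, 0)) (fun=> (0, - k)) (fun t => (t * e, e)));
  [|by ct|by ct|by ct| | | ]; last 3 first.
- by move=> t t01; have := rP' _ t01; rewrite /in_square /=; lra.
- by move=> t t01; rewrite /in_square /=; split; nra.
- by move=> t t01 /=; right; right; left; lra.
rewrite (@homotopy (fun t => (- s t, 0)) (fun=> (0, - k)) (fun t => (- (t * e), e)));
  [|by ct|by ct|by ct| | | ]; last 3 first.
- by move=> t t01; have := sP' _ t01; rewrite /in_square /=; lra.
- by move=> t t01; rewrite /in_square /=; split; nra.
- by move=> t t01 /=; right; right; left; lra.
rewrite (@homotopy (fun t => (- s 1, 0)) (fun t => (0, - k + t * (h + k)))
  (fun t => (- e, e + t * (- e - e))));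
  [|by ct|by ct|by ct| | | ]; last 3 first.
- by move=> t t01; rewrite /in_square /=; split; split; nra.
- by move=> t t01; rewrite /in_square /=; split; nra.
- by move=> t t01 /=; right; left; lra.
rewrite (@homotopy (fun t => (r 1, 0)) (fun t => (0, - k + t * (h + k)))
  (fun t => (e, e + t * (- e - e))));
  [|by ct|by ct|by ct| | | ]; last 3 first.
- by move=> t t01; rewrite /in_square /=; split; split; nra.
- by move=> t t01; rewrite /in_square /=; split; nra.
- by move=> t t01 /=; left; lra.
rewrite /= !r0 !s0 !mul0r !mul1r !oppr0 !addr0.
rewrite (_ : - k + (h + k) = h); last by ring.
rewrite (_ : e + (- e - e) = - e); last by ring.
have po (v : R -> plane) : cts v ->
    (forall t, 0 <= t <= 1 -> in_square e (v t) /\ v t <> (0, 0)) ->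
    vpath (fun t => odd (v t)).
  move=> cv vP; split; first by rewrite /odd /gap /psub /half /nhalf; ct.
  by move=> t /vP[]; apply: odd_neq0.
set A := vr (fun t => odd (t * e, - e)).
set B := vr (fun t => odd (- (t * e), - e)).
set C := vr (fun t => odd (- e, e + t * (- e - e))).
have pA : vpath (fun t => odd (t * e, - e)).
  apply: po; first by ct.
  by move=> t t01; split; [rewrite /in_square /=; split; nra | case; lra].
have pB : vpath (fun t => odd (- (t * e), - e)).
  apply: po; first by ct.
  by move=> t t01; split; [rewrite /in_square /=; split; nra | case; lra].
have pC : vpath (fun t => odd (- e, e + t * (- e - e))).
  apply: po; first by ct.
  by move=> t t01; split; [rewrite /in_square /=; split; nra | case; lra].
have -> : vr (fun t => odd (t * e, e)) = B.
  rewrite /B -(vr_neg pB); apply: eq_vr => t _.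
  by rewrite -oddN /= !opprK.
have -> : vr (fun t => odd (- (t * e), e)) = A.
  rewrite /A -(vr_neg pA); apply: eq_vr => t _.
  by rewrite -oddN /= !opprK.
have -> : vr (fun t => odd (e, e + t * (- e - e))) = - C.
  have pC' : vpath (fun t => odd (e, e + t * (- e - e))).
    apply: po; first by ct.
    by move=> t t01; split; [rewrite /in_square /=; split; nra | case; lra].
  apply: oppr_inj; rewrite opprK /C -(vr_rev pC') -(vr_neg pC); apply: eq_vr => t _.
  by rewrite -oddN /= !opprK; congr (odd (_, _)); ring.
(* By oddness the other half of the boundary repeats [A], [B] and [C], so the whole sum is
   [2 (C - B + A)]. *)
apply/eqP => T0.
have ABC : C - B + A = 0 by lra.
(* The field would then have the same argument [u] at the opposite corners [(- e, e)] and
   [(e, - e)], where it takes opposite values. *)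
have [u au] : exists u, ang (odd (- e, e)) u.
  by apply: ang_ex; apply: odd_neq0; [rewrite /in_square /=; split; lra | case; lra].
have au1 : ang (odd (- e, - e)) (u + C).
  have := @vr_ang _ _ u pC; rewrite !mul0r !addr0 => /(_ au).
  by rewrite mul1r (_ : e + (- e - e) = - e) //; ring.
have pB' : vpath (fun t => odd (- ((1 - t) * e), - e)).
  apply: po; first by ct.
  by move=> t t01; split; [rewrite /in_square /=; split; nra | case; lra].
have au2 : ang (odd (0, - e)) (u + C - B).
  have := @vr_ang _ _ (u + C) pB'; rewrite subr0 mul1r => /(_ au1).
  by rewrite subrr mul0r oppr0 (vr_rev pB).
have au3 : ang (odd (e, - e)) (u + C - B + A).
  by have := @vr_ang _ _ (u + C - B) pA; rewrite mul0r mul1r => /(_ au2).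
apply: (ang_opp_neq au); rewrite -oddN /= opprK.
by move: au3; rewrite (_ : u + C - B + A = u) //; lra.
Qed.

End LocalJump.

(** * Winding number of a strand *)

Section IntervalArithmetic.
Variable R : realType.
Implicit Types e h k s t u v tau : R.

Lemma half_itv (c : bool) tau : 0 < tau < 1 / 2 -> 0 <= (if c then tau else 0) <= 1 / 2.
Proof. by case: c; lra. Qed.

Lemma cohalf_itv (c : bool) tau : 0 < tau < 1 / 2 -> 1 / 2 <= (if c then 1 - tau else 1) <= 1.
Proof. by case: c; lra. Qed.

Lemma between_itv u v t : 0 <= u <= 1 / 2 -> 1 / 2 <= v <= 1 -> 0 <= t <= 1 ->
  u <= u + t * (v - u) <= v.
Proof. by nra. Qed.

Lemma unit_between u v t : 0 <= u <= 1 / 2 -> 1 / 2 <= v <= 1 -> u <= t <= v -> 0 <= t <= 1.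
Proof. by lra. Qed.

Lemma unit_half u : 0 <= u <= 1 / 2 -> 0 <= u <= 1.
Proof. by lra. Qed.

Lemma unit_cohalf u : 1 / 2 <= u <= 1 -> 0 <= u <= 1.
Proof. by lra. Qed.

Lemma unit_flip t : 0 <= t <= 1 -> 0 <= 1 - t <= 1.
Proof. by lra. Qed.

Lemma shift_itv e h k s : 0 < h <= e -> 0 < k <= e -> 0 <= s <= 1 ->
  - e <= - k + s * (h + k) <= e.
Proof. by nra. Qed.

Lemma scale_itv t tau : 0 <= t <= 1 -> 0 < tau < 1 / 2 ->
  0 <= t * tau <= tau /\ 0 <= t * tau <= 1.
Proof. by nra. Qed.

Lemma scale_pos t tau : 0 < t <= 1 -> 0 < tau < 1 / 2 -> 0 < t * tau <= tau.
Proof. by nra. Qed.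

Lemma square_axis e t : 0 < e -> - e <= t <= e -> in_square e (0, t).
Proof. by rewrite /in_square /=; split; lra. Qed.

Lemma above_itv e h : 0 < h <= e -> - e <= h <= e /\ h <> 0.
Proof. by split; [|move=> h0]; lra. Qed.

Lemma below_itv e h : 0 < h <= e -> - e <= - h <= e /\ - h <> 0.
Proof. by split; [|move=> h0]; lra. Qed.

Lemma ct_psub (f : R -> R * R) (z : R * R) : cts f -> cts (fun t => psub (f t) z).
Proof. by move=> cf; rewrite /psub; ct. Qed.
End IntervalArithmetic.

Section Drawing.
Variables (R : realType) (G : framed4graph).
Local Notation plane := (R * R)%type.
Variables (pos : vertex G -> plane) (gam : dart G -> R -> plane).
Hypotheses (cgam : forall d, cts (gam d)) (gam0 : forall d, gam d 0 = pos (vert d)).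
Hypothesis gamE : forall d t, 0 <= t <= 1 -> gam (edge d) t = gam d (1 - t).
Hypotheses (posI : injective pos)
  (gam_pos : forall d v t, 0 < t < 1 -> gam d t <> pos v).
Hypothesis gamI : forall d d' t t', 0 < t < 1 -> 0 < t' < 1 -> gam d t = gam d' t' ->
  d' = d \/ d' = edge d.

(** The half-axes carry [a], [b], [opp a], [opp b] in this cyclic order. *)
Definition axis (a b x : dart G) (r : R) : plane :=
  if x == a then (r, 0) else if x == opp a then (- r, 0)
  else if x == b then (0, r) else (0, - r).

(** Only the inverse chart [g] is kept, with a square in which the drawing lies on the four
    half-axes. The bound [tau < 1 / 2] keeps the starts of the two halves of an edge apart. *)
Definition chart (a b : dart G) (g : plane -> plane) (e : R) : Prop :=
  [/\ 0 < e /\ cts g,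
      forall w w', in_square e w -> in_square e w' -> g w = g w' -> w = w',
      g (0, 0) = pos (vert a),
      forall x t w, in_square e w -> 0 <= t <= 1 -> gam x t = g w -> w <> (0, 0) ->
        exists x' r, [/\ x' = x \/ x' = edge x, vert x' = vert a, 0 < r
                       & w = axis a b x' r] &
      forall x, vert x = vert a -> exists (tau : R) (rho : R -> R),
        [/\ 0 < tau < 1 / 2, cts rho, rho 0 = 0
          & forall t, 0 < t <= tau -> 0 < rho t <= e /\ gam x t = g (axis a b x (rho t))]].

Hypothesis charts : forall a b, vert b = vert a -> b != a -> b != opp a ->
  exists g e, chart a b g e.

Lemma gam1 d : gam d 1 = pos (vert (edge d)).
Proof. by rewrite -gam0 gamE ?subr0 //; lra. Qed.

Lemma gam_at_pos d v t : 0 <= t <= 1 -> gam d t = pos v ->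
  (t = 0 /\ vert d = v) \/ (t = 1 /\ vert (edge d) = v).
Proof.
move=> t01 e; have [t0|t0] := eqVneq t 0.
  by left; split=> //; apply: posI; rewrite -e t0 gam0.
have [t1|t1] := eqVneq t 1.
  by right; split=> //; apply: posI; rewrite -e t1 gam1.
by have := @gam_pos d v t _ e; case; lra.
Qed.

Variables (q : dart G -> dart G) (a b : dart G).
Hypotheses (qK : involutive q) (qv : forall d, vert (q d) = vert d).
Hypotheses (vab : vert a = vert b) (qa : q a = opp a) (qb : q b = opp b).
Hypothesis nab : ~~ connect (strand q) a b.
Hypothesis nfq : forall d, connect (strand q) a d || connect (strand q) b d -> q d != d.
Hypothesis crs : forall c d, connect (strand q) a c -> connect (strand q) b d ->
  vert c = vert d -> q c = opp c -> vert c = vert a.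

Let phi := turn q.
Let phiI : injective phi := turn_inj qK.
Let symS := strand_sym qK.
Let Ca d := connect (strand q) a d.
Let Cb d := connect (strand q) b d.

Let Ca_edge d : Ca d -> Ca (edge d).
Proof. by move=> h; apply: connect_trans h (connect1 _); rewrite /strand eqxx. Qed.
Let Ca_q d : Ca d -> Ca (q d).
Proof. by move=> h; apply: connect_trans h (connect1 _); rewrite /strand eqxx orbT. Qed.
Let Cb_edge d : Cb d -> Cb (edge d).
Proof. by move=> h; apply: connect_trans h (connect1 _); rewrite /strand eqxx. Qed.
Let Cb_q d : Cb d -> Cb (q d).
Proof. by move=> h; apply: connect_trans h (connect1 _); rewrite /strand eqxx orbT. Qed.
Let Ca_nb d : Ca d -> Cb d -> False.
Proof.
by move=> ha hb; move/negP: nab; apply; apply: connect_trans ha _; rewrite symS.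
Qed.
Let Ca_phi d : d \in orbit phi a -> Ca d.
Proof. by rewrite -fconnect_orbit; exact: turn_strand. Qed.

Lemma sum_turn (F : dart G -> R) :
  \sum_(d <- orbit phi a) F (phi d) = \sum_(d <- orbit phi a) F d.
Proof.
rewrite -(big_map phi xpredT F); apply: perm_big.
have uo : uniq (orbit phi a) := orbit_uniq _ _.
apply: uniq_perm => //; first by rewrite map_inj_uniq.
move=> d; apply/mapP/idP => [[x xo ->]|dO].
  by rewrite -fconnect_orbit; apply: connect_trans (fconnect1 _ _); rewrite fconnect_orbit.
exists (finv phi d); last by rewrite f_finv.
by rewrite -fconnect_orbit; apply: (connect_trans _ (fconnect_finv _ _)); rewrite fconnect_orbit.
Qed.

(* [2 pi] times the winding number around [z] of the closed curve traced by the
   strand of [a]. *)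
Definition index (z : plane) : R :=
  \sum_(d <- orbit phi a) vr (fun t => psub (gam d t) z).

Lemma sum_move (c : dart G -> R -> plane) (m : R -> plane) :
  (forall d, cts (c d)) -> cts m ->
  (forall d t s, d \in orbit phi a -> 0 <= t <= 1 -> 0 <= s <= 1 -> c d t <> m s) ->
  \sum_(d <- orbit phi a) vr (fun t => psub (c d t) (m 1)) -
  \sum_(d <- orbit phi a) vr (fun t => psub (c d t) (m 0)) =
  \sum_(d <- orbit phi a) vr (fun s => psub (c d 1) (m s)) -
  \sum_(d <- orbit phi a) vr (fun s => psub (c d 0) (m s)).
Proof.
move=> cc cm av; rewrite -!sumrB; apply: eq_big_seq => d dO.
pose Q t s := psub (c d t) (m s).
have cQ : cts (fun z : plane => Q z.1 z.2).
  by have ccd := cc d; rewrite /Q /psub; ct.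
have nQ t s : 0 <= t <= 1 -> 0 <= s <= 1 -> Q t s != (0, 0).
  by move=> t01 s01; rewrite psub_eq0; apply/eqP; exact: av.
exact: vr_square cQ nQ.
Qed.

(** The edge of [d] ends where that of [turn q d] starts, so the boundary terms of [sum_move] cancel
    around the orbit. *)
Lemma index_move (m : R -> plane) : cts m ->
  (forall d t s, Ca d -> 0 <= t <= 1 -> 0 <= s <= 1 -> gam d t <> m s) ->
  index (m 1) = index (m 0).
Proof.
move=> cm av; apply/eqP; rewrite -subr_eq0; apply/eqP.
rewrite /index (sum_move (c := gam)) //; last first.
  by move=> d t s /Ca_phi; exact: av.
apply/eqP; rewrite subr_eq0; apply/eqP.
rewrite -[RHS]sum_turn; apply: eq_big_seq => d _.
by apply: eq_vr => s _; rewrite gam0 gam1 /phi /turn qv.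
Qed.

Let apart d d' t t' : Ca d -> Cb d' -> 0 <= t <= 1 -> 0 < t' < 1 -> gam d t <> gam d' t'.
Proof.
move=> cd cd' t01 t'01 e.
have [t0|t0] := eqVneq t 0.
  by apply: (@gam_pos d' (vert d) t' t'01); rewrite -e t0 gam0.
have [t1|t1] := eqVneq t 1.
  by apply: (@gam_pos d' (vert (edge d)) t' t'01); rewrite -e t1 gam1.
have [dd|dd] := @gamI _ _ t t' ltac:(lra) t'01 e.
  by apply: Ca_nb cd _; rewrite -dd.
by apply: Ca_nb (Ca_edge cd) _; rewrite -dd.
Qed.

Lemma index_interior d t t' : Cb d -> 0 < t < 1 -> 0 < t' < 1 ->
  index (gam d t) = index (gam d t').
Proof.
move=> cd t01 t'01; have cgd := @cgam d.
have := @index_move (fun s => gam d (t' + s * (t - t'))).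
rewrite mul1r mul0r addr0 [t' + _]addrC subrK; apply; first by ct.
move=> d' u s cd' u01 s01; apply: apart => //.
have := @mix_gt0 R s t' t s01 ltac:(lra) ltac:(lra).
have := @mix_gt0 R s (1 - t') (1 - t) s01 ltac:(lra) ltac:(lra).
by lra.
Qed.

(** If the other strand avoids the vertex, the point moves through it. Otherwise the strands only
    touch there: [d] and [q d] are adjacent, and the point crosses the quadrant between their
    half-axes, which the strand of [a] does not enter. *)
Lemma index_turn d : Cb d -> vert d <> vert a ->
  index (gam d 2^-1) = index (gam (q d) 2^-1).
Proof.
move=> cd nX; have cqd := Cb_q cd.
have [[c cc vc]|nc] := pselect (exists2 c, Ca c & vert c = vert d); last first.
  have to0 x : Cb x -> vert x = vert d -> index (gam x 2^-1) = index (pos (vert d)).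
    move=> cx vx; have cgx := @cgam x.
    have := @index_move (fun s => gam x (s * 2^-1)).
    rewrite mul1r mul0r gam0 vx; apply; first by ct.
    move=> d' u s cd' u01 s01; have [s0|s0] := eqVneq s 0.
      rewrite s0 mul0r gam0 vx => /(gam_at_pos u01) [] [_ v'].
        by apply: nc; exists d'.
      by apply: nc; exists (edge d') => //; exact: Ca_edge.
    by apply: apart => //; lra.
  by rewrite (to0 d) // (to0 (q d)).
have nqc : q c <> opp c by move=> e; apply: nX; rewrite -vc; exact: (crs cc cd vc e).
have ccq := Ca_q cc.
have nq : q d != d by apply: nfq; apply/orP; right.
have nqq : q c != c by apply: nfq; apply/orP; left.
have neq x y : Ca x -> Cb y -> x != y.
  by move=> cx cy; apply/eqP => e; apply: (Ca_nb cx); rewrite e.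
(* Were [d] and [q d] opposite, [c] and [q c] would be so too, which is a second crossing. *)
have nqo : q d != opp d.
  apply/eqP => e; apply: nqc.
  have := @mem_vertex4 G [:: c; q c; d; q d] (vert d).
  move=> /(_ _ erefl _ (opp c) _); rewrite vert_opp => h.
  have : opp c \in [:: c; q c; d; q d].
    apply: h => //.
      rewrite /= !inE !negb_or (eq_sym c (q c)) nqq (neq _ _ cc cd) (neq _ _ cc cqd).
      by rewrite (neq _ _ ccq cd) (neq _ _ ccq cqd) (eq_sym d) nq.
    by move=> x; rewrite !inE => /or4P[] /eqP ->; rewrite ?qv.
  rewrite !inE (negbTE (opp_neq _)) /= => /or3P[/eqP -> //|/eqP o|/eqP o].
    by case: (Ca_nb ccq); rewrite (_ : q c = q d) //; case/negP: (neq _ _ cc cqd);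
       rewrite -(oppK c) o e.
  by case/negP: (neq _ _ cc cd); rewrite -(oppK c) o e oppK.
have [g [e [[e0 cg] gI g0 gax gst]]] := charts (qv d) nq nqo.
have [t1 [r1 [t1P _ _ h1]]] := gst d erefl.
have [t2 [r2 [t2P _ _ h2]]] := gst (q d) (qv d).
have [r1P e1] := h1 t1 ltac:(lra); have [r2P e2] := h2 t2 ltac:(lra).
rewrite (@index_interior d _ t1) //; [|lra|lra].
rewrite (@index_interior (q d) _ t2) //; [|lra|lra].
rewrite e1 e2 /axis eqxx (negbTE nq) (negbTE nqo) eqxx.
apply/esym; have := @index_move (fun s => g ((1 - s) * r1 t1, s * r2 t2)).
rewrite subrr subr0 !mul0r !mul1r; apply; first by ct.
move=> d' u s cd' u01 s01 ed.
have p := @mix_gt0 R s (r1 t1) (r2 t2) s01 ltac:(lra) ltac:(lra).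
have [||x' [r [xx vx r0]]] := gax _ _ _ _ u01 ed.
- by rewrite /in_square /=; split; nra.
- by case=> z1 z2; move: p; rewrite z1 z2 addr0 ltxx.
have cx' : Ca x' by case: xx => ->; [|exact: Ca_edge].
rewrite /axis (negbTE (neq _ _ cx' cd)) (negbTE (neq _ _ cx' cqd)).
have A : 0 <= (1 - s) * r1 t1 by apply: mulr_ge0; lra.
have B : 0 <= s * r2 t2 by apply: mulr_ge0; lra.
by case: ifP => _ [z1 z2]; [move: A; rewrite z1 | move: B; rewrite z2]; rewrite oppr_ge0 leNgt r0.
Qed.

Let nfa d : Ca d -> q d != d.
Proof. by move=> cd; apply: nfq; apply/orP; left. Qed.
Let nfb d : Cb d -> q d != d.
Proof. by move=> cd; apply: nfq; apply/orP; right. Qed.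
Let Ca_a : Ca a.
Proof. exact: connect0. Qed.
Let Cb_b : Cb b.
Proof. exact: connect0. Qed.
Let ba : b != a.
Proof. by apply/eqP => e; apply: (@Ca_nb a); rewrite // -e. Qed.
Let boa : b != opp a.
Proof. by apply/eqP => e; apply: (@Ca_nb (opp a)); rewrite -?qa ?Ca_q // qa -e. Qed.

Let Ca_vert x : Ca x -> vert x = vert a -> x = a \/ x = opp a.
Proof.
move=> cx vx; have := mem_vertex_opp (esym vab) ba boa vx.
rewrite !inE => /or4P[] /eqP e; [by left | by right | |].
  by case: (Ca_nb cx); rewrite e.
by case: (Ca_nb cx); rewrite e -qb Cb_q.
Qed.

Let Cb_vert x : Cb x -> vert x = vert a -> x = b \/ x = opp b.
Proof.
move=> cx vx; have := mem_vertex_opp (esym vab) ba boa vx.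
rewrite !inE => /or4P[] /eqP e; [| |by left | by right].
  by case: (@Ca_nb x); rewrite // e.
by case: (@Ca_nb x); rewrite // e -qa Ca_q.
Qed.

(** The half-edge of the orbit whose edge arrives at the crossing, along [opp a]. *)
Let l := finv phi a.
Let phil : phi l = a.
Proof. by rewrite /l f_finv. Qed.
Let edgel : edge l = opp a.
Proof. by rewrite -qa -phil /phi /turn qK. Qed.
Let lO : l \in orbit phi a.
Proof. by rewrite -fconnect_orbit fconnect_finv. Qed.
Let aO : a \in orbit phi a.
Proof. by rewrite -fconnect_orbit connect0. Qed.

Let O_edge d : d \in orbit phi a -> edge d \notin orbit phi a.
Proof.
by rewrite -!fconnect_orbit => h; apply: (turn_edge qK _ h) => x; exact: nfa.
Qed.

Let O_vert d : d \in orbit phi a -> vert d = vert a -> d = a.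
Proof.
move=> dO /(Ca_vert (Ca_phi dO))[//|e].
by have := O_edge lO; rewrite edgel -e dO.
Qed.

Let O_vert_edge d : d \in orbit phi a -> vert (edge d) = vert a -> d = l.
Proof.
move=> dO /(Ca_vert (Ca_edge (Ca_phi dO)))[e|e].
  by have := O_edge dO; rewrite e aO.
by apply: (@edge_inj G); rewrite e edgel.
Qed.

Let sum_single (x : dart G) (F : dart G -> R) : x \in orbit phi a ->
  (forall d, d \in orbit phi a -> d != x -> F d = 0) ->
  \sum_(d <- orbit phi a) F d = F x.
Proof.
move=> xO F0; rewrite (bigD1_seq x) ?orbit_uniq //= big_seq_cond big1 ?addr0 //.
by move=> d /andP[]; exact: F0.
Qed.

(* Crossing the strand of [a] at its vertex changes the winding number. *)
Lemma index_jump (g : plane -> plane) (e : R) : chart a b g e ->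
  exists h k : R, [/\ 0 < h <= e, 0 < k <= e,
    exists2 t, 0 < t < 1 & gam b t = g (0, h),
    exists2 t, 0 < t < 1 & gam (opp b) t = g (0, - k)
    & index (g (0, h)) <> index (g (0, - k))].
Proof.
case=> -[e0 cg] gI g0 gax gst.
have nao : opp a == a = false by apply/negbTE; exact: opp_neq.
have nbo : opp b == a = false.
  by apply/eqP => E; move: boa; rewrite -E oppK eqxx.
have nboo : opp b == opp a = false.
  by apply/eqP => /(@opp_inj G) E; move: ba; rewrite E eqxx.
have nbb : opp b == b = false by apply/negbTE; exact: opp_neq.
have [ta [ra [taP cra ra0 ha]]] := gst a erefl.
have [to [ro [toP cro ro0 ho]]] := gst (opp a) (vert_opp a).
have [tb [rb [tbP crb rb0 hb]]] := gst b (esym vab).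
have [tc [rc [tcP crc rc0 hc]]] := gst (opp b) (etrans (vert_opp b) (esym vab)).
have [hP hE] := hb tb ltac:(lra); have [kP kE] := hc tc ltac:(lra).
move: hE kE; rewrite /axis (negbTE ba) (negbTE boa) eqxx nbo nboo nbb => hE kE.
exists (rb tb), (rc tc); split=> //.
- by exists tb => //; lra.
- by exists tc => //; lra.
set h := rb tb in hP *; set k := rc tc in kP *.
have gamA t : 0 <= t <= ta -> gam a t = g (ra t, 0).
  move=> tP; have [->|t0] := eqVneq t 0; first by rewrite gam0 ra0 g0.
  by have [_ ->] := ha t ltac:(lra); rewrite /axis eqxx.
have gamO t : 0 <= t <= to -> gam (opp a) t = g (- ro t, 0).
  move=> tP; have [->|t0] := eqVneq t 0; first by rewrite gam0 vert_opp ro0 oppr0 g0.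
  by have [_ ->] := ho t ltac:(lra); rewrite /axis nao eqxx.
have avoid d t y : Ca d -> 0 <= t <= 1 -> - e <= y <= e -> gam d t = g (0, y) -> y = 0.
  move=> cd tP yP E; have [//|y0] := eqVneq y 0.
  have [||x [r [xx vx r0]]] := gax d t (0, y) _ tP E.
  - exact: square_axis.
  - by case=> /eqP; rewrite (negbTE y0).
  have cx : Ca x by case: xx => ->; [|exact: Ca_edge].
  have [->|->] := Ca_vert cx vx; rewrite /axis ?nao eqxx => -[z _].
    by move: r0; rewrite -z ltxx.
  by move: r0; rewrite -oppr_lt0 -z ltxx.
(* The closed curve is cut open near the crossing: the remaining curves [c] miss the image under [g]
   of the segment from [(0, - k)] to [(0, h)]. *)
pose lo d := if d == a then ta else 0.
pose hi d := if d == l then 1 - to else 1.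
have loP d : 0 <= lo d <= 1 / 2 by exact: half_itv.
have hiP d : 1 / 2 <= hi d <= 1 by exact: cohalf_itv.
pose c d t := gam d (clamp 0 1 (lo d + t * (hi d - lo d))).
have cc d : cts (c d) by have cgd := @cgam d; rewrite /c; ct.
have cE d t : 0 <= t <= 1 -> c d t = gam d (lo d + t * (hi d - lo d)).
  move=> tP; rewrite /c clamp_id //.
  exact: unit_between (loP d) (hiP d) (between_itv (loP d) (hiP d) tP).
have c0 d : c d 0 = gam d (lo d) by rewrite cE ?mul0r ?addr0 // lexx ler01.
have c1 d : c d 1 = gam d (hi d).
  by rewrite cE ?lexx ?ler01 // mul1r addrC subrK.
pose m s := g (0, - k + s * (h + k)).
have cm : cts m by rewrite /m; ct.
have m0 : m 0 = g (0, - k) by rewrite /m mul0r addr0.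
have m1 : m 1 = g (0, h) by rewrite /m mul1r; congr (g (_, _)); ring.
have av d t s : d \in orbit phi a -> 0 <= t <= 1 -> 0 <= s <= 1 -> c d t <> m s.
  move=> dO tP sP; rewrite cE // /m.
  set y := - k + _; set u := lo d + _ => E.
  have uP : lo d <= u <= hi d := between_itv (loP d) (hiP d) tP.
  have uP' : 0 <= u <= 1 := unit_between (loP d) (hiP d) uP.
  have y0 : y = 0.
    by apply: (avoid d u) => //; [exact: Ca_phi | exact: shift_itv].
  move: E; rewrite y0 g0 => /(gam_at_pos uP')[] [u0 vd].
    by move: uP; rewrite /lo (O_vert dO vd) eqxx u0 leNgt; case/andP: taP => ->.
  move: uP; rewrite /hi (O_vert_edge dO vd) eqxx u0 lerBrDr gerDl => /andP[_].
  by rewrite leNgt; case/andP: toP => ->.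
have split_index y : - e <= y <= e -> y <> 0 ->
    index (g (0, y)) = vr (fun t => psub (g (ra (t * ta), 0)) (g (0, y)))
      - vr (fun t => psub (g (- ro (t * to), 0)) (g (0, y)))
      + \sum_(d <- orbit phi a) vr (fun t => psub (c d t) (g (0, y))).
  move=> yP y0; set z := g (0, y).
  have vp d : Ca d -> vpath (fun t => psub (gam d t) z).
    move=> cd; have cgd := @cgam d; split; first by rewrite /psub; ct.
    by move=> t tP; rewrite psub_eq0; apply/eqP => /(avoid _ _ _ cd tP yP).
  have part d : d \in orbit phi a -> vr (fun t => psub (gam d t) z) =
      vr (fun t => psub (gam d (t * lo d)) z) + vr (fun t => psub (c d t) z)
      + vr (fun t => psub (gam d (hi d + t * (1 - hi d))) z).
    move=> /Ca_phi/vp V; have P0 : 0 <= (0 : R) <= 1 by rewrite lexx ler01.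
    have P1 : 0 <= (1 : R) <= 1 by rewrite lexx ler01.
    have Plo := unit_half (loP d).
    have Phi := unit_cohalf (hiP d).
    transitivity (vr (fun t => psub (gam d (0 + t * (1 - 0))) z)).
      by apply: eq_vr => t _; rewrite add0r subr0 mulr1.
    rewrite (vr_affine V P0 Phi P1) (vr_affine V P0 Plo Phi); congr (_ + _ + _).
      by apply: eq_vr => t _; rewrite add0r subr0.
    by apply: eq_vr => t tP; rewrite cE.
  have -> : index z =
      \sum_(d <- orbit phi a) vr (fun t => psub (gam d (t * lo d)) z)
      + \sum_(d <- orbit phi a) vr (fun t => psub (c d t) z)
      + \sum_(d <- orbit phi a) vr (fun t => psub (gam d (hi d + t * (1 - hi d))) z).
    by rewrite -!big_split; apply: eq_big_seq => d /part.
  have -> : \sum_(d <- orbit phi a) vr (fun t => psub (gam d (t * lo d)) z) =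
      vr (fun t => psub (g (ra (t * ta), 0)) z).
    rewrite (sum_single (F := fun d => vr (fun t => psub (gam d (t * lo d)) z)) aO).
      by apply: eq_vr => t tP; rewrite /lo eqxx gamA //; have [] := scale_itv tP taP.
    move=> d dO /negbTE nd; transitivity (vr (fun=> psub (gam d 0) z)).
      by apply: eq_vr => t _; rewrite /lo nd mulr0.
    by apply: vr_const; apply: (vp d (Ca_phi dO)).2; rewrite lexx ler01.
  have -> : \sum_(d <- orbit phi a) vr (fun t => psub (gam d (hi d + t * (1 - hi d))) z) =
      - vr (fun t => psub (g (- ro (t * to), 0)) z).
    rewrite (sum_single (F := fun d => vr (fun t => psub (gam d (hi d + t * (1 - hi d))) z)) lO).
      have V : vpath (fun t => psub (gam (opp a) (clamp 0 1 (t * to))) z).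
        have Coa : Ca (opp a) by rewrite -qa; exact: Ca_q.
        have [cV nV] := vp _ Coa.
        split; first by apply: ct_psub; apply: (ctcomp (@cgam (opp a))); ct.
        by move=> t tP; apply: nV; apply: clamp_itv.
      have -> : vr (fun t => psub (g (- ro (t * to), 0)) z) =
          vr (fun t => psub (gam (opp a) (clamp 0 1 (t * to))) z).
        by apply: eq_vr => t tP; have [h1 h2] := scale_itv tP toP; rewrite clamp_id ?gamO.
      rewrite -(vr_rev V); apply: eq_vr => t tP; rewrite /hi eqxx.
      have [_ h1] := scale_itv (unit_flip tP) toP.
      rewrite clamp_id // -edgel gamE //.
      by congr (psub (gam _ _) _); ring.
    move=> d dO /negbTE nd; transitivity (vr (fun=> psub (gam d 1) z)).
      by apply: eq_vr => t _; rewrite /hi nd subrr mulr0 addr0.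
    by apply: vr_const; apply: (vp d (Ca_phi dO)).2; rewrite lexx ler01.
  by ring.
(* While the point moves along the segment, the cut curve contributes only at its two free ends. *)
have tele : \sum_(d <- orbit phi a) vr (fun t => psub (c d t) (m 1)) -
    \sum_(d <- orbit phi a) vr (fun t => psub (c d t) (m 0)) =
    vr (fun s => psub (g (- ro to, 0)) (m s)) - vr (fun s => psub (g (ra ta, 0)) (m s)).
  rewrite (sum_move cc cm av).
  rewrite -[X in _ - X](sum_turn (fun d => vr (fun s => psub (c d 0) (m s)))) -sumrB.
  rewrite (sum_single (F := fun d => vr (fun s => psub (c d 1) (m s)) -
                                     vr (fun s => psub (c (phi d) 0) (m s))) lO).
    rewrite phil c1 c0 /lo /hi !eqxx gamA; last by rewrite lexx andbT; case/andP: taP => /ltW.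
    by rewrite -gamE ?edgel ?gamO //; lra.
  move=> d dO nd; apply/eqP; rewrite subr_eq0; apply/eqP; apply: eq_vr => s _.
  rewrite c1 c0 /hi (negbTE nd) gam1.
  by rewrite /lo -{1}phil (inj_eq phiI) (negbTE nd) gam0 /phi /turn qv.
(* Without a jump the six terms of [local_jump] would add up to zero. *)
move=> E.
have cr : cts (fun t : R => ra (t * ta)) by ct.
have cs : cts (fun t : R => ro (t * to)) by ct.
have r0 : ra (0 * ta) = 0 by rewrite mul0r.
have s0 : ro (0 * to) = 0 by rewrite mul0r.
have rP t : 0 < t <= 1 -> 0 < ra (t * ta) <= e.
  by move=> tP; apply: (ha (t * ta) _).1; exact: scale_pos.
have sP t : 0 < t <= 1 -> 0 < ro (t * to) <= e.
  by move=> tP; apply: (ho (t * to) _).1; exact: scale_pos.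
have /eqP := local_jump cg gI cr cs r0 s0 rP sP hP kP; apply.
rewrite !mul1r; move: tele; rewrite m0 m1 /m => T.
have [h1 h2] := above_itv hP; have Eh := split_index h h1 h2.
have [k1 k2] := below_itv kP; have Ek := split_index (- k) k1 k2.
by rewrite E in Eh; rewrite Eh in Ek; lra.
Qed.

(** The index at the midpoint of an edge, a point shared by its two halves, is constant along the
    strand of [b] from [b] to its return along [opp b]; but it differs on the two sides of the
    crossing. *)
Lemma crossing_contradiction : False.
Proof.
have [g [e ch]] := charts (esym vab) ba boa.
have [h [k [hP kP [t tP et] [t' t'P et'] []]]] := index_jump ch.
have Cob : Cb (opp b) by rewrite -qb; exact: Cb_q.
rewrite -et -et' (index_interior (t' := 2^-1) Cb_b tP); last by lra.
rewrite (index_interior (t' := 2^-1) Cob t'P); last by lra.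
pose n := (order phi b).-1.
have on : order phi b = n.+1 by rewrite prednK // order_gt0.
have cbi i : Cb (iter i phi b) by apply: turn_strand; exact: fconnect_iter.
have half : 1 - 2^-1 = 2^-1 :> R by lra.
have J_edge d : index (gam (edge d) 2^-1) = index (gam d 2^-1).
  by rewrite gamE ?half //; lra.
have bl : edge (iter n phi b) = opp b.
  have : phi (iter n phi b) = b by rewrite -iterS -on iter_order.
  by rewrite {1}/phi /turn -{2}(qK b) qb => /(can_inj qK).
have Ji i : (i <= n)%N -> index (gam (iter i phi b) 2^-1) = index (gam b 2^-1).
  elim: i => [//|i IH] i_n; rewrite -(IH (ltnW i_n)) -[RHS]J_edge /=.
  apply/esym/index_turn; first exact: Cb_edge.
  (* Before its last step the strand of [b] does not come back to the crossing: it would have to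
     leave along [b] or [opp b]. *)
  move=> v; have := @Cb_vert (iter i.+1 phi b) (cbi _).
  rewrite /= {1}/phi /turn qv => /(_ v)[] E.
    have iE : iter i.+1 phi b = b := E.
    have lt_i : (i.+1 < order phi b)%N by rewrite on ltnS.
    by have := findex_iter lt_i; rewrite iE findex0.
  have := turn_edge qK nfb (fconnect_iter phi n b).
  by rewrite bl -E -/phi -iterS fconnect_iter.
by rewrite -(Ji n (leqnn n)) -J_edge bl.
Qed.

End Drawing.

(** * Charts from the framing condition *)

Lemma fin_radius (R : realType) (T : finType) (P : T -> R -> Prop) :
  (forall x e e', 0 < e' <= e -> P x e -> P x e') ->
  (forall x, exists2 e, 0 < e & P x e) -> exists2 e, 0 < e & forall x, P x e.
Proof.
move=> mono /(_ _)/cid2 ex; pose f x := sval (ex x).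
have [f0 fP] : (forall x, 0 < f x) /\ (forall x, P x (f x)).
  by split=> x; rewrite /f; case: (ex x).
have H (s : seq T) : exists2 e, 0 < e & forall x, x \in s -> P x e.
  elim: s => [|x s [e e0 eP]]; first by exists 1.
  exists (Num.min (f x) e); first by rewrite lt_min f0 e0.
  move=> y; rewrite inE => /predU1P[->|/eP ye].
    by apply: mono (fP x); rewrite lt_min f0 e0 /= ge_min lexx.
  by apply: mono ye; rewrite lt_min f0 e0 /= ge_min lexx orbT.
have [e e0 eP] := H (enum T); exists e => // x; apply: eP.
by rewrite mem_enum.
Qed.

Section NearPoint.
Variable R : realType.
Local Notation plane := (R * R)%type.

Lemma near_square (P : plane -> Prop) : (\forall w \near nbhs ((0, 0) : plane), P w) ->
  exists2 e, 0 < e & forall w, in_square e w -> P w.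
Proof.
move=> /nbhs_ballP[e /= e0 eP]; exists (e / 2); first by rewrite divr_gt0.
move=> w [w1 w2]; apply: eP; rewrite ball_prod_normE /ball_ /= prod_normE /=.
rewrite gt_max !add0r !normrN !ltr_norml; apply/andP; split; lra.
Qed.

Lemma near_right (P : R -> Prop) : (\forall t \near 0^'+, P t) ->
  exists2 e, 0 < e & forall t, 0 < t < e -> P t.
Proof.
rewrite /at_right near_withinE => /nbhs_ballP[e /= e0 eP]; exists e => // t tP.
by apply: eP; [rewrite -ball_normE /ball_ /= sub0r normrN gtr0_norm | ]; lra.
Qed.

Lemma near_zero (P : R -> Prop) : (\forall t \near nbhs (0 : R), P t) ->
  exists2 e, 0 < e & forall t, - e < t < e -> P t.
Proof.
move=> /nbhs_ballP[e /= e0 eP]; exists e => // t tP.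
by apply: eP; rewrite -ball_normE /ball_ /= sub0r normrN ltr_norml.
Qed.

Lemma square_near (e : R) : 0 < e -> \forall w \near nbhs ((0, 0) : plane), in_square e w.
Proof.
move=> e0; apply/nbhs_ballP; exists e => // w.
rewrite ball_prod_normE /ball_ /= prod_normE /= gt_max !add0r !normrN !ltr_norml.
by move=> /andP[w1 w2]; split; lra.
Qed.

Lemma curve_away (c : R -> plane) (u v : R) (p : plane) : cts c ->
  (forall t, u <= t <= v -> c t <> p) ->
  \forall z \near nbhs p, forall t, u <= t <= v -> c t <> z.
Proof.
move=> cc av; have cK := @segment_compact R u v.
have nc := iffLR (compact_near_coveringP _) cK.
pose E (tz : R * plane) : R := (c tz.1).1 - tz.2.1.
pose F (tz : R * plane) : R := (c tz.1).2 - tz.2.2.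
pose D tz : R := E tz * E tz + F tz * F tz.
have cD : cts D by rewrite /D /E /F; ct.
have H : \forall z \near nbhs p, `[u, v]%classic `<=` (fun t => c t <> z).
  apply: (nc plane (nbhs p) (fun z t => c t <> z)) => t /=; rewrite in_itv /= => tP.
  have D0 : 0 < D (t, p).
    have : c t <> p by exact: av.
    rewrite /D /E /F /=; case: (c t) => c1 c2; case: {av} p => p1 p2 /= n.
    have [e1|e1] := eqVneq c1 p1; last first.
      by apply: ltr_pwDl; rewrite -expr2 ?sqr_ge0 // exprn_even_gt0 //= subr_eq0.
    have e2 : c2 != p2 by apply/eqP => e2; apply: n; rewrite e1 e2.
    by apply: ltr_wpDl; rewrite -expr2 ?sqr_ge0 // exprn_even_gt0 //= subr_eq0.
  have EV : \forall w \near nbhs (t, p), 0 < D w by exact: (cvgr_gt _ (cD (t, p)) _ D0).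
  apply: filterS EV => -[t' z] /= D1 ct'; move: D1.
  by rewrite /D /E /F /= ct' !subrr mulr0 addr0 ltxx.
by apply: filterS H => z Hz t tP; apply: Hz; rewrite /= in_itv.
Qed.

End NearPoint.

Section Charts.
Variables (R : realType) (G : framed4graph).
Local Notation plane := (R * R)%type.
Variables (pos : vertex G -> plane) (gam : dart G -> R -> plane).
Hypotheses (cgam : forall d, cts (gam d)) (gam0 : forall d, gam d 0 = pos (vert d)).
Hypothesis gamE : forall d t, 0 <= t <= 1 -> gam (edge d) t = gam d (1 - t).
Hypotheses (posI : injective pos)
  (gam_pos : forall d v t, 0 < t < 1 -> gam d t <> pos v).

Lemma chart_change (a b a' b' : dart G) (g T : plane -> plane) (e : R) :
  vert a' = vert a -> cts T -> injective T -> T (0, 0) = (0, 0) ->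
  (forall w, in_square e w -> in_square e (T w)) ->
  (forall x r, vert x = vert a -> T (axis a' b' x r) = axis a b x r) ->
  chart pos gam a b g e -> chart pos gam a' b' (g \o T) e.
Proof.
move=> va cT TI T0 Tsq Tax [[e0 cg] gI g0 gax gst]; split.
- by split=> //; apply: (ctcomp cg cT).
- by move=> w w' sw sw' /(gI _ _ (Tsq _ sw) (Tsq _ sw')) /TI.
- by rewrite /= T0 va.
- move=> x t w sw t01 E w0.
  have [|x' [r [xx vx r0 wE]]] := gax x t (T w) (Tsq _ sw) t01 E.
    by move=> Tw; apply: w0; apply: TI; rewrite T0.
  by exists x', r; rewrite va; split=> //; apply: TI; rewrite Tax.
move=> x; rewrite va => vx; have [tau [rho [tP cr r0 h]]] := gst x vx.
by exists tau, rho; split=> // t tP'; rewrite /= Tax //; exact: h.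
Qed.

Lemma axis_cases (a b x : dart G) : vert b = vert a -> b != a -> b != opp a ->
  vert x = vert a -> [/\ opp a != a, opp b != a, opp b != opp a & opp b != b] /\
  [\/ x = a, x = opp a, x = b | x = opp b].
Proof.
move=> vb ba boa vx; split; last first.
  have := mem_vertex_opp vb ba boa vx; rewrite !inE => /or4P[] /eqP ->;
  by [constructor 1 | constructor 2 | constructor 3 | constructor 4].
split; rewrite ?opp_neq ?(inj_eq (@opp_inj G)) //.
by rewrite (inv_eq (@oppK G)).
Qed.

Lemma chart_rot (a b : dart G) g e : vert b = vert a -> b != a -> b != opp a ->
  chart pos gam a b g e -> exists g' e', chart pos gam b (opp a) g' e'.
Proof.
move=> vb ba boa ch; exists (g \o (fun w => (- w.2, w.1))), e.
apply: chart_change ch => //.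
- by ct.
- by case=> x y [x' y'] /= [/oppr_inj -> ->].
- by rewrite /= oppr0.
- by move=> w [w1 w2]; split=> /=; lra.
move=> x r vx; have [[n1 n2 n3 n4] xc] := axis_cases vb ba boa vx.
have n1' : a == opp a = false by rewrite eq_sym; apply/negbTE.
have n2' : a == opp b = false by rewrite eq_sym; apply/negbTE.
have n3' : a == b = false by rewrite eq_sym; apply/negbTE.
have n4' : opp a == b = false by rewrite eq_sym; apply/negbTE.
have n5' : opp a == opp b = false by rewrite eq_sym; apply/negbTE.
rewrite /axis; case: xc => ->; rewrite ?oppK ?eqxx ?(negbTE n1) ?(negbTE n2)
  ?(negbTE n3) ?(negbTE n4) ?(negbTE ba) ?(negbTE boa) ?n1' ?n2' ?n3' ?n4' ?n5'
  ?eqxx /= ?oppr0 ?opprK //.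
Qed.

Lemma chart_flip (a b : dart G) g e : vert b = vert a -> b != a -> b != opp a ->
  chart pos gam a b g e -> exists g' e', chart pos gam a (opp b) g' e'.
Proof.
move=> vb ba boa ch; exists (g \o (fun w => (w.1, - w.2))), e.
apply: chart_change ch => //.
- by ct.
- by case=> x y [x' y'] /= [-> /oppr_inj ->].
- by rewrite /= oppr0.
- by move=> w [w1 w2]; split=> /=; lra.
move=> x r vx; have [[n1 n2 n3 n4] xc] := axis_cases vb ba boa vx.
have n4' : b == opp b = false by rewrite eq_sym; apply/negbTE.
rewrite /axis; case: xc => ->; rewrite ?oppK ?eqxx ?(negbTE n1) ?(negbTE n2)
  ?(negbTE n3) ?(negbTE n4) ?(negbTE ba) ?(negbTE boa) ?n4' ?eqxx /= ?oppr0 ?opprK //.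
Qed.

(** The framing condition provides a chart for one pair only; the quarter turn and the reflection
    generate those of all eight ordered pairs of adjacent half-edges. *)
Lemma chart_any (a b c d : dart G) g e : vert b = vert a -> b != a -> b != opp a ->
  chart pos gam a b g e -> vert c = vert a -> vert d = vert c -> d != c -> d != opp c ->
  exists g' e', chart pos gam c d g' e'.
Proof.
move=> vb ba boa ch vc vd dc doc.
have any x y : vert y = vert x -> y != x -> y != opp x ->
    (exists g' e', chart pos gam x y g' e') -> c = x -> exists g' e', chart pos gam c d g' e'.
  move=> vy yx yox [g' [e' ch']] cx; subst x.
  have [_ []] := axis_cases vy yx yox vd => dE.
  - by rewrite dE eqxx in dc.
  - by rewrite dE eqxx in doc.
  - by rewrite dE; exists g', e'.
  by rewrite dE; exact: chart_flip ch'.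
have [[n1 n2 n3 n4] cc] := axis_cases vb ba boa vc.
have ch1 : exists g' e', chart pos gam b (opp a) g' e' by exact: chart_rot ch.
have n5 : opp a != b by rewrite eq_sym.
have n6 : opp a != opp b by rewrite eq_sym.
have ch2 : exists g' e', chart pos gam (opp a) (opp b) g' e'.
  by have [g' [e' ch']] := ch1; apply: chart_rot ch'; rewrite ?vert_opp.
have n7 : opp b != opp (opp a) by rewrite oppK.
have ch3 : exists g' e', chart pos gam (opp b) (opp (opp a)) g' e'.
  by have [g' [e' ch']] := ch2; apply: chart_rot ch'; rewrite ?vert_opp.
case: cc => cE.
- by apply: (any a b) => //; exists g, e.
- by apply: (any (opp a) (opp b)); rewrite ?vert_opp.
- by apply: (any b (opp a)); rewrite ?vert_opp.
by rewrite oppK in ch3; apply: (any (opp b) a); rewrite ?vert_opp ?oppK // eq_sym.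
Qed.

Lemma half_min (x y : R) : 0 < x -> 0 < y ->
  0 < Num.min x y / 2 /\ Num.min x y / 2 < x /\ Num.min x y / 2 < y.
Proof. by rewrite /Num.min; case: ifP => ? ? ?; split; [|split| |split]; lra. Qed.

(** The framing controls only the germs at the vertex. Beyond a common initial time [eta] the edges
    stay, by compactness, away from the vertex, so a small enough square meets only the initial
    arcs. *)
Lemma framing_chart (v : vertex G) : framing_preserved pos gam v ->
  exists a b g e, [/\ vert a = v, vert b = v, b != a, b != opp a & chart pos gam a b g e].
Proof.
case=> U [V [f [g0 [a [b [[[oU oV] fU gV cf cg] [Uv fv] [va vb ba boa] [s1 s2] [s3 s4]]]]]]].
have {}ba : b != a by apply/eqP.
have {}boa : b != opp a by apply/eqP.
have vba : vert b = vert a by rewrite vb va.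
have dirs x : vert x = v -> exists2 eta, 0 < eta & forall t, 0 < t < eta ->
    exists2 r, 0 < r & f (gam x t) = axis a b x r.
  rewrite -va => vx; have [[n1 n2 n3 n4] xc] := axis_cases vba ba boa vx.
  have st (u : plane) (k : R -> plane) : (forall r, k r = (r * u.1, r * u.2)) ->
      starts_along f (gam x) u -> exists2 eta, 0 < eta & forall t, 0 < t < eta ->
        exists2 r, 0 < r & f (gam x t) = k r.
    move=> kE /near_right[eta eta0 H]; exists eta => // t /H[r r0 ->].
    by exists r; rewrite // kE.
  have ax r := erefl (axis a b x r); move: ax; rewrite /axis.
  case: xc st => -> st _; rewrite ?(negbTE n1) ?(negbTE n2) ?(negbTE n3) ?(negbTE n4)
    ?(negbTE ba) ?(negbTE boa) ?eqxx.
  - by apply: st s1 => r /=; rewrite mulr1 mulr0.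
  - by apply: st s2 => r /=; rewrite mulrN1 mulr0.
  - by apply: st s3 => r /=; rewrite mulr1 mulr0.
  - by apply: st s4 => r /=; rewrite mulrN1 mulr0.
have [eta0 eta00 etaP] : exists2 eta : R, 0 < eta & forall x, vert x = v ->
    forall t, 0 < t < eta -> exists2 r, 0 < r & f (gam x t) = axis a b x r.
  apply: fin_radius => [x e e' ee' H vx t tP|x].
    by apply: H => //; lra.
  have [vx|nvx] := eqVneq (vert x) v; last by exists 1 => // vx; rewrite vx eqxx in nvx.
  by have [eta e0 H] := dirs x vx; exists eta.
(* The bound [1 / 3] keeps the two ends of an edge apart. *)
pose eta := Num.min eta0 (1 / 3).
have etaP' : 0 < eta <= eta0 /\ eta <= 1 / 3.
  by rewrite /eta /Num.min; case: ifP => ?; split; lra.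
pose lo x := if vert x == v then eta else 0.
pose hi x := if vert (edge x) == v then 1 - eta else 1.
have V0 : V (0, 0) by have [] := fU _ Uv; rewrite fv.
have g00 : g0 (0, 0) = pos v by have [] := fU _ Uv; rewrite fv.
have posx x t : 0 <= t <= 1 -> gam x t = pos v ->
    (t = 0 /\ vert x = v) \/ (t = 1 /\ vert (edge x) = v).
  exact: (gam_at_pos gam0 gamE posI gam_pos).
have far x : exists2 e, 0 < e & forall w, in_square e w ->
    forall t, lo x <= t <= hi x -> gam x t <> g0 w.
  apply: (@near_square R (fun w => forall t, lo x <= t <= hi x -> gam x t <> g0 w)).
  have : \forall z \near nbhs (pos v), forall t, lo x <= t <= hi x -> gam x t <> z.
    apply: curve_away => [|t tP E]; first exact: cgam.
    have tP' : 0 <= t <= 1.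
      by move: tP; rewrite /lo /hi; do 2 case: ifP => _; lra.
    case: (posx x t tP' E) => -[t0 vx]; move: tP; rewrite t0 /lo /hi vx eqxx; lra.
  by rewrite -g00 => /(cg _ V0).
have [e1 e10 e1P] : exists2 e : R, 0 < e & forall x w, in_square e w ->
    forall t, lo x <= t <= hi x -> gam x t <> g0 w.
  apply: fin_radius => [x e e' ee' H w sw|x //]; apply: H.
  by case: sw => w1 w2; split; lra.
have [e2 e20 e2P] : exists2 e : R, 0 < e & forall w, in_square e w -> V w.
  by apply: near_square; apply: open_nbhs_nbhs.
pose e := Num.min e1 e2.
have eP : 0 < e /\ e <= e1 /\ e <= e2.
  by rewrite /e /Num.min; case: ifP => ?; split=> //; split=> //; lra.
have sq1 w : in_square e w -> in_square e1 w by case=> w1 w2; split; lra.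
have sqV w : in_square e w -> V w by move=> [w1 w2]; apply: e2P; split; lra.
pose cl (w : plane) : plane := (clamp (- e) e w.1, clamp (- e) e w.2).
have clsq w : in_square e (cl w) by split; apply: clamp_itv; lra.
have clid w : in_square e w -> cl w = w.
  by case: w => w1 w2 [h1 h2]; rewrite /cl !clamp_id.
pose g w := g0 (cl w).
have gE w : in_square e w -> g w = g0 w by move=> sw; rewrite /g clid.
have ccl : cts cl by rewrite /cl; ct.
have fg0 w : in_square e w -> f (g0 w) = w by move=> /sqV/gV[].
have s00 : in_square e (0, 0) by split=> /=; lra.
exists a, b, g, e; split=> //; split.
- split; first by lra.
  move=> w; apply: (cvg_comp _ _ (ccl w)); apply: cg; apply: sqV; exact: clsq.
- by move=> w w' sw sw'; rewrite !gE // => E; rewrite -(fg0 w) // E fg0.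
- by rewrite gE // va.
- move=> x t w sw tP; rewrite gE // => E w0.
  have nt : ~ (lo x <= t <= hi x) by move=> tP'; exact: (e1P x w (sq1 _ sw) t tP').
  have hit y s : vert y = v -> 0 <= s < eta -> gam y s = g0 w ->
      exists2 r, 0 < r & w = axis a b y r.
    move=> vy sP Ey; have [s0|s0] := eqVneq s 0.
      case: w0; rewrite -(fg0 w) // -Ey s0 gam0 vy; exact: fv.
    have [r r0 rE] := etaP y vy s ltac:(lra).
    by exists r; rewrite // -rE Ey fg0.
  have [lt|ge] := ltP t (lo x).
    have vx : vert x = v.
      move: lt; rewrite /lo; case: eqP => // _ lt0.
      by have /andP[t0 _] := tP; rewrite ltNge t0 in lt0.
    have [|r r0 wE] := hit x t vx _ E; first by move: lt; rewrite /lo vx eqxx; lra.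
    by exists x, r; split=> //; [left | rewrite vx].
  have gt : hi x < t by rewrite ltNge; apply/negP => le; apply: nt; rewrite ge le.
  have vx : vert (edge x) = v.
    move: gt; rewrite /hi; case: eqP => // _ lt0.
    by have /andP[_ t1] := tP; rewrite ltNge t1 in lt0.
  have [||r r0 wE] := hit (edge x) (1 - t) vx.
  - by move: gt; rewrite /hi vx eqxx; lra.
  - by rewrite gamE; [rewrite opprB addrC subrK | lra].
  by exists (edge x), r; split=> //; [right | rewrite vx].
move=> x; rewrite va => vx.
have near_t : \forall t \near nbhs (0 : R), U (gam x t) /\ in_square e (f (gam x t)).
  have c0 : gam x t @[t --> nbhs (0 : R)] --> pos v by rewrite -vx -gam0; exact: cgam.
  have nU : \forall z \near nbhs (pos v), U z by apply: open_nbhs_nbhs.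
  have nS : \forall z \near nbhs (pos v), in_square e (f z).
    have H : f z @[z --> pos v] --> f (pos v) := cf _ Uv.
    rewrite fv in H.
    by apply: (H (in_square e)); apply: square_near; lra.
  near=> t; split; first by near: t; apply: (c0 U).
  by near: t; exact: (c0 (fun z => in_square e (f z))).
have [e3 e30 e3P] := near_zero near_t.
pose tau := Num.min e3 eta / 2.
have tauP : 0 < tau /\ tau < e3 /\ tau < eta.
  by apply: half_min => //; case: etaP' => /andP[].
(* The position along the half-axis, read off as a scalar product; the clamp makes it continuous on
   the whole line. *)
pose rho t := dot (f (gam x (clamp 0 tau t))) (axis a b x 1).
have clP t : 0 <= clamp 0 tau t <= tau by apply: clamp_itv; lra.
have axE r : dot (axis a b x r) (axis a b x 1) = r.
  by rewrite /dot /axis; case: ifP => _; [|case: ifP => _; [|case: ifP => _]] => /=; ring.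
exists tau, rho; split.
- lra.
- have cfg : cts (fun t => f (gam x (clamp 0 tau t))).
    have cgc : cts (fun t => gam x (clamp 0 tau t)) by have cgx := @cgam x; ct.
    move=> t; apply: (cvg_comp _ _ (cgc t)); apply: cf.
    by apply: (e3P _ _).1; have := clP t; lra.
  by rewrite /rho /dot; ct.
- rewrite /rho clamp_id; last lra.
  by rewrite gam0 vx fv /dot /= !mul0r addr0.
move=> t tP; have [r r0 rE] := etaP x vx t ltac:(lra).
have rhoE : rho t = r by rewrite /rho clamp_id ?rE ?axE //; lra.
have [Ut sqt] := e3P t ltac:(lra).
have re : r <= e.
  move: sqt; rewrite rE /axis /in_square.
  by case: ifP => _; [|case: ifP => _; [|case: ifP => _]] => /= -[/andP[h1 h2] /andP[h3 h4]];
    rewrite ?lerN2 in h1 h3.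
rewrite rhoE -rE gE //; split; first by rewrite r0 re.
by have [_ ->] := fU _ Ut.
Unshelve. all: by end_near. Qed.

End Charts.

Lemma crossing_circuits_nonplanar (R : realType) (G : framed4graph) :
  crossing_circuits G -> ~ planar R G.
Proof.
case=> q [a [b [[qK qv] [vab qa qb] nab nf cr]]].
case=> pos [gam0 [kap [[h1 _ [h3 h3'] h4 _] fr]]].
(* The edges are extended by constants beyond the unit interval. *)
pose gam d t := gam0 d (clamp 0 1 t).
have gE d t : 0 <= t <= 1 -> gam d t = gam0 d t by move=> tP; rewrite /gam clamp_id.
have cg d : cts (gam d).
  have [cd _ _] := h1 d; move=> t.
  have c01 : 0 <= clamp 0 1 t <= (1 : R) by apply: clamp_itv.
  move/subspace_continuousP: cd => /(_ (clamp 0 1 t)); rewrite /= in_itv /= => /(_ c01).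
  move=> cd P /cd H.
  have cc : cts (fun t : R => clamp 0 1 t) by ct.
  have H2 : \forall s \near t, 0 <= clamp 0 1 s <= (1 : R) -> P (gam0 d (clamp 0 1 s)).
    apply: (cc t (fun u : R => 0 <= u <= 1 -> P (gam0 d u))).
    have H1 : nbhs (clamp 0 1 t) (fun u : R => `[0, 1]%classic u -> P (gam0 d u)) := H.
    by apply: filterS H1 => s /=; rewrite in_itv.
  by apply: filterS H2 => s; apply; exact: clamp_itv.
have g0 d : gam d 0 = pos (vert d) by have [_ e _] := h1 d; rewrite gE // lexx ler01.
have gS d t : 0 <= t <= 1 -> gam (edge d) t = gam d (1 - t).
  by move=> tP; have [_ _ e] := h1 d; rewrite !gE ?e //; lra.
have gP d v t : 0 < t < 1 -> gam d t <> pos v by move=> tP; rewrite gE; [exact: h3' | lra].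
have gI d d' t t' : 0 < t < 1 -> 0 < t' < 1 -> gam d t = gam d' t' -> d' = d \/ d' = edge d.
  move=> tP t'P; rewrite !gE; [|lra|lra].
  by case/(h4 _ _ _ _ tP t'P) => -[]; [left | right].
have frg v : framing_preserved pos gam v.
  have [U [V [f [g [x [y [h Uv vx [s1 s2] [s3 s4]]]]]]]] := fr v.
  have st d u : starts_along f (gam0 d) u -> starts_along f (gam d) u.
    move=> /near_right[e e0 H]; rewrite /starts_along /at_right near_withinE; apply/nbhs_ballP.
    exists (Num.min e 1) => /=; first by rewrite lt_min e0 ltr01.
    move=> t; rewrite -ball_normE /ball_ /= sub0r normrN lt_min => /andP[te t1] t0.
    move: te t1; rewrite gtr0_norm // => te t1.
    by rewrite gE; [apply: H; lra | lra].
  by exists U, V, f, g, x, y; split=> //; split; exact: st.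
apply: (@crossing_contradiction R G pos gam cg g0 gS h3 gP gI _ q a b) => //.
move=> x y vy yx yox.
have [c [d [g [e [vc vd dc doc ch]]]]] := framing_chart cg g0 gS h3 gP (frg (vert x)).
by apply: (chart_any _ dc doc ch) => //; rewrite ?vc ?vd.
Qed.

(** * Drawing a layout *)

Section HalfEdge.
Variable R : realType.

Definition sgn (b : bool) : R := if b then 1 else -1.

(** The piecewise linear function with the values [a], [b], [c], [d], [e] at 0, 1/4, 1/2, 3/4, 1; as
    a sum of clamps it is continuous at once. *)
Definition polyline (a b c d e t : R) : R :=
  a + (b - a) * clamp 0 1 (4 * t) + (c - b) * clamp 0 1 (4 * t - 1)
    + (d - c) * clamp 0 1 (4 * t - 2) + (e - d) * clamp 0 1 (4 * t - 3).

Lemma clamp_le (t : R) : t <= 0 -> clamp 0 1 t = 0.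
Proof. by rewrite /clamp /Num.max /Num.min; case: ifP; case: ifP; lra. Qed.

Lemma clamp_ge (t : R) : 1 <= t -> clamp 0 1 t = 1.
Proof. by rewrite /clamp /Num.max /Num.min; case: ifP; case: ifP; lra. Qed.

Lemma polyline1 (a b c d e t : R) : 0 <= t <= 1/4 ->
  polyline a b c d e t = a + (b - a) * (4 * t).
Proof.
move=> tP; rewrite /polyline (@clamp_id _ _ _ (4 * t)); last lra.
by rewrite (@clamp_le (4 * t - 1)) ?(@clamp_le (4 * t - 2)) ?(@clamp_le (4 * t - 3)); lra.
Qed.

Lemma polyline2 (a b c d e t : R) : 1/4 <= t <= 1/2 ->
  polyline a b c d e t = b + (c - b) * (4 * t - 1).
Proof.
move=> tP; rewrite /polyline (@clamp_id _ _ _ (4 * t - 1)); last lra.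
by rewrite (@clamp_ge (4 * t)) ?(@clamp_le (4 * t - 2)) ?(@clamp_le (4 * t - 3)); lra.
Qed.

Lemma polyline3 (a b c d e t : R) : 1/2 <= t <= 3/4 ->
  polyline a b c d e t = c + (d - c) * (4 * t - 2).
Proof.
move=> tP; rewrite /polyline (@clamp_id _ _ _ (4 * t - 2)); last lra.
by rewrite (@clamp_ge (4 * t)) ?(@clamp_ge (4 * t - 1)) ?(@clamp_le (4 * t - 3)); lra.
Qed.

Lemma polyline4 (a b c d e t : R) : 3/4 <= t <= 1 ->
  polyline a b c d e t = d + (e - d) * (4 * t - 3).
Proof.
move=> tP; rewrite /polyline (@clamp_id _ _ _ (4 * t - 3)); last lra.
by rewrite (@clamp_ge (4 * t)) ?(@clamp_ge (4 * t - 1)) ?(@clamp_ge (4 * t - 2)); lra.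
Qed.

Variables (S O : R) (l o g : bool).

(* The drawing of half an edge leaving, at the site [S], the vertex with sites
   [S] and [O]; [l] and [o] tell whether [S] is the left end of the chord and
   whether the half-edge leaves [S] to the right, [g] the side of the line.  It
   runs from the apex [((S + O) / 2, |O - S|)], first along one of two straight
   lines crossing there, then parallel to the side of an isosceles triangle
   over the chord down to the line, and on to the midpoint [(E, Y)] of the edge,
   passing over the whole drawing if [Y] is positive. *)
Definition half_x (E t : R) : R :=
  polyline ((S + O) / 2) ((S + O) / 2 - sgn l / 16) (S + (3 * sgn o - sgn l) / 16)
    (S + 3 * sgn o / 8) E t.

Definition half_y (Y t : R) : R :=
  polyline (sgn g * sgn l * (O - S)) (sgn g * (sgn l * (O - S) - 3 * sgn o * sgn l / 8))
    0 Y Y t.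

Hypothesis SO : 1 <= sgn l * (O - S).
Variables (E Y t : R).
Local Notation x := (half_x E t).
Local Notation y := (half_y Y t).
Local Notation U := (x - sgn g * y / 2).
Local Notation W := (x + sgn g * y / 2).

(** At the apex [U] is the left and [W] the right end of the chord. The coordinate belonging to [S]
    stays within 1/4 of [S]; the last clause puts the four half-edges at the apex into different
    sectors, whose common boundary rays are met only at [t = 0]. *)
Lemma arch_bounds : 0 <= t <= 1/2 ->
  [/\ U <= W, if l then S - 1/4 <= U <= S + 1/4 /\ W <= O + 1/4
              else S - 1/4 <= W <= S + 1/4 /\ O - 1/4 <= U,
      y = 0 -> t = 1/2 /\ x = S + (3 * sgn o - sgn l) / 16 &
      if l then (U = S -> t = 0) /\ (if o then S <= U /\ W - O <= -2 * (U - S)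
                 else U <= S /\ W - O <= - (U - S) / 2)
      else (W = S -> t = 0) /\ (if o then S <= W /\ -2 * (U - O) <= W - S
                 else [/\ W <= S, O <= U & - (U - O) / 2 <= W - S])].
Proof.
move=> tP; have [t4|t4] := leP t (1/4).
  rewrite /half_x /half_y !polyline1; try lra.
  move: SO; rewrite /sgn; case: l; case: o; case: g => D; split; try split; try split; lra.
have tP2 : 1/4 <= t <= 1/2 by lra.
(* On the second segment [z] is the distance from the line; it decreases from [k] to 0. *)
pose k := sgn l * (O - S) - 3/8 * sgn o * sgn l; pose z := k * (2 - 4 * t).
have k0 : 5/8 <= k by move: SO; rewrite /k /sgn; case: l; case: o; lra.
have z0 : 0 <= z by apply: mulr_ge0; lra.
have z1 : z <= k by apply: ler_piMr; lra.
have z2 : z <= 0 -> t = 1/2 by rewrite pmulr_rle0; lra.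
have xE : x = S + (3 * sgn o - sgn l) / 16 + sgn l * z / 2.
  rewrite /half_x !(polyline2 _ _ _ _ _ tP2) /z /k /sgn.
  by case: l; case: o; lra.
have yE : y = sgn g * z.
  rewrite /half_y !(polyline2 _ _ _ _ _ tP2) /z /k /sgn.
  by case: l; case: o; case: g; lra.
have gE : sgn g * (sgn g * z) = z by rewrite /sgn; case: g; lra.
have h3 : y = 0 -> t = 1/2 /\ x = S + (3 * sgn o - sgn l) / 16.
  rewrite xE yE => y0; have zE : z = 0 by rewrite -gE y0 mulr0.
  by split; [apply: z2; rewrite zE | rewrite zE; lra].
have h1 : U <= W by rewrite xE yE gE; lra.
split=> //; rewrite xE yE gE; clear h3 h1 z2 xE yE gE; clearbody z; rewrite /k in k0 z1.
  by move: SO k0 z1; rewrite /sgn; case: l; case: o => D k0 z1; split; lra.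
by move: SO k0 z1; rewrite /sgn; case: l; case: o => D k0 z1; split; try split; lra.
Qed.

Lemma tail_open : E = S + sgn o / 2 -> Y = 0 -> 1/2 <= t <= 1 ->
  [/\ y = 0, 1/8 <= sgn o * (x - S) <= 1/2 & sgn o * (x - S) = 1/2 -> t = 1].
Proof.
move=> -> -> tP; have [t4|t4] := leP t (3/4).
  have tP2 : 1/2 <= t <= 3/4 by lra.
  rewrite /half_x /half_y !(polyline3 _ _ _ _ _ tP2).
  by rewrite /sgn; case: l; case: o; split; lra.
have tP2 : 3/4 <= t <= 1 by lra.
rewrite /half_x /half_y !(polyline4 _ _ _ _ _ tP2).
by rewrite /sgn; case: l; case: o; split; lra.
Qed.

(** A closing edge climbs beside its site to the height [Y] and then runs horizontally to [E]; the
    final alternative separates the two phases. *)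
Lemma tail_closing : o = ~~ l -> 0 <= sgn o * (S - E) -> 2 <= Y -> 1/2 <= t <= 1 ->
  [/\ 0 <= y <= Y, sgn o * (x - S) <= 3/8, 0 <= sgn o * (x - E), x = E -> t = 1 &
      y = 0 -> t = 1/2 /\ x = S + sgn o / 4] /\
  (1/4 <= sgn o * (x - S) \/ y = Y).
Proof.
move=> ol SE Y2 tP; have [t4|t4] := leP t (3/4).
  have tP2 : 1/2 <= t <= 3/4 by lra.
  rewrite /half_x /half_y !(polyline3 _ _ _ _ _ tP2).
  have z0 : 0 <= Y * (4 * t - 2) by apply: mulr_ge0; lra.
  have z1 : Y * (4 * t - 2) <= Y by apply: ler_piMr; lra.
  have z2 : Y * (4 * t - 2) <= 0 -> t = 1/2 by rewrite pmulr_rle0; lra.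
  move: ol SE; rewrite /sgn; case: l => /= -> SE; split; try (by left; lra); split; try lra.
have tP2 : 3/4 <= t <= 1 by lra.
rewrite /half_x /half_y !(polyline4 _ _ _ _ _ tP2).
have k0 : 3/8 <= sgn o * (S + 3 * sgn o / 8 - E) by rewrite /sgn; case: o SE; rewrite /sgn; lra.
have z0 : 0 <= sgn o * (S + 3 * sgn o / 8 - E) * (4 - 4 * t) by apply: mulr_ge0; lra.
have z1 : sgn o * (S + 3 * sgn o / 8 - E) * (4 - 4 * t) <= sgn o * (S + 3 * sgn o / 8 - E).
  by apply: ler_piMr; lra.
have z2 : sgn o * (S + 3 * sgn o / 8 - E) * (4 - 4 * t) <= 0 -> t = 1.
  by rewrite pmulr_rle0; lra.
move: SE z0 z1 z2; rewrite /sgn; case: o => SE z0 z1 z2; split; try (by right; lra);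
  split; try lra.
Qed.

End HalfEdge.

Section HalfEdgeInjective.
Variable R : realType.
Variables (S O : R) (l o g : bool) (E Y : R).
Hypothesis SO : 1 <= sgn R l * (O - S).

Definition half_eq (t t' : R) : Prop :=
  half_x S O l o E t = half_x S O l o E t' /\ half_y S O l o g Y t = half_y S O l o g Y t'.

Lemma arch_inj (t t' : R) : half_eq t t' -> 0 <= t <= 1/2 -> 0 <= t' <= 1/2 -> t = t'.
Proof.
wlog tt : t t' / t <= t'.
  move=> h e tP tP'; have [tt|tt] := leP t t'; first exact: h.
  by apply/esym/h; [lra | case: e | |].
case; rewrite /half_x /half_y => xE yE tP tP'.
pose k := sgn R l * (O - S) - 3/8 * sgn R o * sgn R l.
have k0 : 0 < k by move: SO; rewrite /k /sgn; case: l; case: o; lra.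
have [t4|t4] := leP t' (1/4).
  have t0 : 0 <= t <= 1/4 by lra.
  have t0' : 0 <= t' <= 1/4 by lra.
  rewrite !(polyline1 _ _ _ _ _ t0) !(polyline1 _ _ _ _ _ t0') in xE yE.
  by move: xE; rewrite /sgn; case: l; lra.
have t0' : 1/4 <= t' <= 1/2 by lra.
rewrite !(polyline2 _ _ _ _ _ t0') in xE yE.
have [t5|t5] := leP t (1/4).
  have t0 : 0 <= t <= 1/4 by lra.
  rewrite !(polyline1 _ _ _ _ _ t0) in xE yE.
  have z0 : 0 <= k * (4 * t' - 1) by apply: mulr_ge0; lra.
  have z1 : k * (4 * t' - 1) <= 0 -> t' = 1/4 by rewrite pmulr_rle0; lra.
  move: xE yE z0 z1; rewrite /k /sgn; case: l; case: o; case: g; lra.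
have t0 : 1/4 <= t <= 1/2 by lra.
rewrite !(polyline2 _ _ _ _ _ t0) in xE yE.
have : k * t = k * t'.
  by move: xE yE; rewrite /k /sgn; case: l; case: o; case: g; lra.
by apply: mulfI; rewrite gt_eqF.
Qed.

Lemma tail_open_inj (t t' : R) : E = S + sgn R o / 2 -> half_eq t t' ->
  1/2 <= t <= 1 -> 1/2 <= t' <= 1 -> t = t'.
Proof.
move=> EE; wlog tt : t t' / t <= t'.
  move=> h e tP tP'; have [tt|tt] := leP t t'; first exact: h.
  by apply/esym/h; [lra | case: e | |].
case; rewrite /half_x EE => xE _ tP tP'.
have [t4|t4] := leP t' (3/4).
  have t0 : 1/2 <= t <= 3/4 by lra.
  have t0' : 1/2 <= t' <= 3/4 by lra.
  rewrite (polyline3 _ _ _ _ _ t0) (polyline3 _ _ _ _ _ t0') in xE.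
  by move: xE; rewrite /sgn; case: l; case: o; lra.
have t0' : 3/4 <= t' <= 1 by lra.
rewrite (polyline4 _ _ _ _ _ t0') in xE.
have [t5|t5] := leP t (3/4).
  have t0 : 1/2 <= t <= 3/4 by lra.
  rewrite (polyline3 _ _ _ _ _ t0) in xE.
  by move: xE; rewrite /sgn; case: l; case: o; lra.
have t0 : 3/4 <= t <= 1 by lra.
rewrite (polyline4 _ _ _ _ _ t0) in xE.
by move: xE; rewrite /sgn; case: o; lra.
Qed.

Lemma tail_closing_inj (t t' : R) : 0 <= sgn R o * (S - E) -> 2 <= Y -> half_eq t t' ->
  1/2 <= t <= 1 -> 1/2 <= t' <= 1 -> t = t'.
Proof.
move=> SE Y2; wlog tt : t t' / t <= t'.
  move=> h e tP tP'; have [tt|tt] := leP t t'; first exact: h.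
  by apply/esym/h; [lra | case: e | |].
case; rewrite /half_x /half_y => xE yE tP tP'.
pose k := sgn R o * (S + 3 * sgn R o / 8 - E).
have k0 : 0 < k by move: SE; rewrite /k /sgn; case: o; lra.
have y0 : Y != 0 by rewrite gt_eqF //; lra.
have [t4|t4] := leP t' (3/4).
  have t0 : 1/2 <= t <= 3/4 by lra.
  have t0' : 1/2 <= t' <= 3/4 by lra.
  rewrite (polyline3 _ _ _ _ _ t0) (polyline3 _ _ _ _ _ t0') in yE.
  by apply: (mulfI y0); lra.
have t0' : 3/4 <= t' <= 1 by lra.
rewrite !(polyline4 _ _ _ _ _ t0') in xE yE.
have [t5|t5] := leP t (3/4).
  have t0 : 1/2 <= t <= 3/4 by lra.
  rewrite !(polyline3 _ _ _ _ _ t0) in xE yE.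
  have t34 : t = 3/4 by apply: (mulfI y0); lra.
  have z1 : k * t' = k * (3/4) by move: xE; rewrite t34 /k /sgn; case: o; lra.
  by rewrite t34; apply/esym; move: z1; apply: mulfI; rewrite gt_eqF.
have t0 : 3/4 <= t <= 1 by lra.
rewrite (polyline4 _ _ _ _ _ t0) in xE.
have z1 : k * t = k * t' by move: xE; rewrite /k /sgn; case: o; lra.
by move: z1; apply: mulfI; rewrite gt_eqF.
Qed.

End HalfEdgeInjective.

(** * Half-edges of a layout meet only at vertices and midpoints *)

Section LayoutDrawing.
Variables (R : realType) (G : framed4graph) (l : layout G).
Implicit Types d e : dart G.

Definition spot d : R := (site l d)%:R.
Definition is_left d : bool := (site l d < site l (opp d))%N.
Definition upper d : bool := col l (vert d).
(** Whether [d] is on the edge that returns from the last site of the block to the first. *)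
Definition closing d : bool := site l d == (if out l d then hi l d else lo l d).
Definition bottom d : R := (lo l d)%:R.
Definition top d : R := (hi l d)%:R.
(** Above every apex, whose height [|O - S|] is less than [nsites]. *)
Definition roof : R := (nsites l).+2%:R.
Definition end_x d : R :=
  if closing d then (bottom d + top d) / 2 else spot d + sgn R (out l d) / 2.
Definition end_y d : R := if closing d then roof else 0.
Definition hx d t := half_x (spot d) (spot (opp d)) (is_left d) (out l d) (end_x d) t.
Definition hy d t := half_y (spot d) (spot (opp d)) (is_left d) (out l d) (upper d) (end_y d) t.

(** Replaces any goal by a false inequality, which [lra] can derive from contradictory
    hypotheses. *)
Lemma absurd_le (P : Prop) : (1 : R) <= 0 -> P.
Proof. by rewrite ler10. Qed.

Lemma nat_sep (m n : nat) :
  [\/ (m%:R : R) + 1 <= n%:R, m = n | (n%:R : R) + 1 <= m%:R].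
Proof.
case: (ltngtP m n) => h; [constructor 1|constructor 3|by constructor 2].
  by rewrite -(natrD _ _ 1) ler_nat addn1.
by rewrite -(natrD _ _ 1) ler_nat addn1.
Qed.

Lemma nat_lt (m n : nat) : (m < n)%N -> (m%:R : R) + 1 <= n%:R.
Proof. by move=> h; rewrite -(natrD _ _ 1) ler_nat addn1. Qed.

Lemma spot_opp d : 1 <= sgn R (is_left d) * (spot (opp d) - spot d).
Proof.
rewrite /is_left /spot /sgn; case: ltngtP => [/nat_lt|/nat_lt|h]; try lra.
by have := site_opp l d; rewrite h eqxx.
Qed.

Lemma spot_block d : [/\ bottom d <= spot d, spot d <= top d, bottom d <= spot (opp d),
  spot (opp d) <= top d & 0 <= spot d /\ spot d + 1 <= roof - 2].
Proof.
have /andP[h1 h2] := site_block l d; have /andP[] := site_block l (opp d).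
have [-> ->] := block_opp l d => h3 h4.
rewrite /bottom /spot /top !ler_nat h1 h2 h3 h4 ler0n; split=> //; split=> //.
by have := nat_lt (site_lt l d); rewrite /roof -addn2 natrD; lra.
Qed.

Lemma closing_out d : closing d -> out l d = ~~ is_left d.
Proof.
have /andP[h3 h4] := site_block l (opp d).
rewrite /closing /is_left => /eqP dE; have := site_opp l d.
move: h3 h4; have [-> ->] := block_opp l d; move: dE; case: (out l d) => -> h3 h4 h5.
  by rewrite -leqNgt h4.
by rewrite ltn_neqAle eq_sym h5 h3.
Qed.

Lemma closing_end d : closing d ->
  0 <= sgn R (out l d) * (spot d - end_x d) /\ 2 <= end_y d.
Proof.
move=> cl; have [h1 h2 h3 h4 [h5 h6]] := spot_block d.
rewrite /end_x /end_y cl; split; last lra.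
move/eqP: cl; rewrite /spot /bottom /top /sgn => E.
have := h1; have := h2; rewrite /spot /bottom /top E; case: (out l d); lra.
Qed.

Lemma closing_spot d : closing d -> spot d = if out l d then top d else bottom d.
Proof. by rewrite /spot /top /bottom => /eqP ->; case: (out l d). Qed.

Lemma closing_edge_out d : out l d -> closing d ->
  closing (edge d) /\ site l (edge d) = lo l d.
Proof.
move=> od; rewrite /closing out_edge od /= => /eqP dE.
have /andP[h1 h2] := site_block l (edge d).
move: h1 h2; have [-> ->] := block_edge l d => h1 h2.
have [E|[_ ->]] := site_edge od; last by rewrite eqxx.
by rewrite E dE ltnn in h2.
Qed.

Lemma open_edge_out d : out l d -> ~~ closing d ->
  ~~ closing (edge d) /\ site l (edge d) = (site l d).+1.
Proof.
move=> od; rewrite /closing out_edge od /= => dE.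
have /andP[h1 h2] := site_block l d.
have [E|[E _]] := site_edge od; last by rewrite E eqxx in dE.
rewrite E; have [-> _] := block_edge l d; split=> //.
by rewrite gtn_eqF.
Qed.

Lemma closing_edge d : closing (edge d) = closing d.
Proof.
have h e : out l e -> closing (edge e) = closing e.
  move=> oe; have [/(closing_edge_out oe)[-> _]//|/(open_edge_out oe)[/negbTE -> _] //] := boolP (closing e).
have [/h //|od] := boolP (out l d).
by rewrite -[in RHS](edgeK d) (h (edge d)) // out_edge.
Qed.

Lemma end_x_edge d : end_x (edge d) = end_x d.
Proof.
have h e : out l e -> end_x (edge e) = end_x e.
  move=> oe; rewrite /end_x closing_edge /bottom /top.
  have [-> ->] := block_edge l e; case: (boolP (closing e)) => // nc.
  have [_ E] := open_edge_out oe nc.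
  by rewrite /spot E out_edge oe /sgn /= -addn1 natrD; lra.
have [/h //|od] := boolP (out l d).
by rewrite -[in RHS](edgeK d) (h (edge d)) // out_edge.
Qed.

Lemma end_y_edge d : end_y (edge d) = end_y d.
Proof. by rewrite /end_y closing_edge. Qed.

Lemma same_spot d e : spot d = spot e -> out l d = out l e -> d = e.
Proof. by rewrite /spot => /eqP; rewrite eqr_nat => /eqP; exact: site_inj. Qed.

Lemma spot_sep d e : [\/ spot d + 1 <= spot e, site l d = site l e | spot e + 1 <= spot d].
Proof. exact: nat_sep. Qed.

Lemma hx1 d : hx d 1 = end_x d.
Proof. by rewrite /hx /half_x polyline4; lra. Qed.

Lemma hy1 d : hy d 1 = end_y d.
Proof. by rewrite /hy /half_y polyline4; lra. Qed.

Lemma hx0 d : hx d 0 = (spot d + spot (opp d)) / 2.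
Proof. by rewrite /hx /half_x polyline1; lra. Qed.

Lemma hy0 d : hy d 0 = sgn R (upper d) * (sgn R (is_left d) * (spot (opp d) - spot d)).
Proof. by rewrite /hy /half_y polyline1; lra. Qed.

(* In these coordinates the sides of the triangles over the chords are parallel
   to the axes. *)
Definition U d t := hx d t - sgn R (upper d) * hy d t / 2.
Definition W d t := hx d t + sgn R (upper d) * hy d t / 2.

Lemma arch_facts d t : 0 <= t <= 1/2 ->
  [/\ U d t <= W d t,
      if is_left d then spot d - 1/4 <= U d t <= spot d + 1/4 /\ W d t <= spot (opp d) + 1/4
      else spot d - 1/4 <= W d t <= spot d + 1/4 /\ spot (opp d) - 1/4 <= U d t,
      hy d t = 0 -> t = 1/2 /\ hx d t = spot d + (3 * sgn R (out l d) - sgn R (is_left d)) / 16 &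
      if is_left d then (U d t = spot d -> t = 0) /\
        (if out l d then spot d <= U d t /\ W d t - spot (opp d) <= -2 * (U d t - spot d)
         else U d t <= spot d /\ W d t - spot (opp d) <= - (U d t - spot d) / 2)
      else (W d t = spot d -> t = 0) /\
        (if out l d then spot d <= W d t /\ -2 * (U d t - spot (opp d)) <= W d t - spot d
         else [/\ W d t <= spot d, spot (opp d) <= U d t &
                  - (U d t - spot (opp d)) / 2 <= W d t - spot d])].
Proof. exact: arch_bounds (spot_opp d) _ _ _. Qed.

Lemma arch_level d e t t' : 0 <= t <= 1/2 -> 0 <= t' <= 1/2 -> hx d t = hx e t' ->
  hy d t = 0 -> hy e t' = 0 -> vert d = vert e.
Proof.
move=> tP tP' xE y0 y0'.
have [_ _ /(_ y0)[_ E1] _] := arch_facts d tP; have [_ _ /(_ y0')[_ E2] _] := arch_facts e tP'.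
apply: (site_vert (l := l)); move: E1 E2; rewrite xE /sgn.
by case: (spot_sep d e) => [h||h] // E1 E2; apply: absurd_le; move: E1 E2 h;
  case: (out l d); case: (out l e); case: (is_left d); case: (is_left e); lra.
Qed.

(** If a left arch met a right arch of another vertex on the same side, [U] and [W] would place the
    sites in the order [opp e], [d], [e], [opp d]: two crossing chords of one colour, against
    [site_nested]. *)
Lemma arch_nested d e t t' : 0 <= t <= 1/2 -> 0 <= t' <= 1/2 ->
  hx d t = hx e t' -> hy d t = hy e t' -> upper d = upper e -> is_left d -> ~~ is_left e -> vert d = vert e.
Proof.
move=> tP tP' xE yE cE ld le.
have UE : U d t = U e t' by rewrite /U xE yE cE.
have WE : W d t = W e t' by rewrite /W xE yE cE.
have [UW h _ _] := arch_facts d tP; have [_ h' _ _] := arch_facts e tP'.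
rewrite ld (negbTE le) -UE -WE in h h'.
have lte : (site l (opp e) < site l e)%N.
  by move: le; rewrite /is_left -leqNgt leq_eqVlt (negbTE (site_opp _ _)).
have lt (m n : nat) : (m%:R : R) + 1 <= n%:R -> (m < n)%N.
  by move=> mn; rewrite -(ltr_nat R); lra.
case: (spot_sep d e) => h1; [|by apply: site_vert h1|by apply: absurd_le; lra].
case: (spot_sep e (opp d)) => h2; [|by rewrite -(vert_opp d); apply/esym/(site_vert h2)|
  by apply: absurd_le; lra].
case: (spot_sep d (opp e)) => h3; [by apply: absurd_le; lra|
  by rewrite -(vert_opp e); apply/(site_vert h3)|].
have := @site_nested G l d e cE; rewrite (lt _ _ h1) (lt _ _ h2) => /(_ isT)/andP[h4 _].
by have := ltn_trans h4 (lt _ _ h3); rewrite ltnn.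
Qed.

(** For two left arches the common [U], for two right ones the common [W], is within 1/4 of both
    sites, which therefore agree; arches on different sides can meet only on the line. *)
Lemma arch_vert d e t t' : 0 <= t <= 1/2 -> 0 <= t' <= 1/2 ->
  hx d t = hx e t' -> hy d t = hy e t' -> vert d = vert e.
Proof.
move=> tP tP' xE yE; have [cE|cE] := eqVneq (upper d) (upper e).
  case: (boolP (is_left d)) => ld; case: (boolP (is_left e)) => le.
  - have [_ h _ _] := arch_facts d tP; have [_ h' _ _] := arch_facts e tP'.
    rewrite ld le /U /W -cE -xE -yE in h h'.
    by case: (spot_sep d e) => h1; [|by apply: site_vert h1|]; apply: absurd_le; lra.
  - exact: arch_nested tP tP' xE yE cE ld le.
  - by apply/esym; exact: arch_nested tP' tP (esym xE) (esym yE) (esym cE) le ld.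
  have [_ h _ _] := arch_facts d tP; have [_ h' _ _] := arch_facts e tP'.
  rewrite (negbTE ld) (negbTE le) /U /W -cE -xE -yE in h h'.
  by case: (spot_sep d e) => h1; [|by apply: site_vert h1|]; apply: absurd_le; lra.
have [h _ _ _] := arch_facts d tP; have [h' _ _ _] := arch_facts e tP'.
have y0 : hy d t = 0.
  move: cE h h'; rewrite /U /W -xE -yE /sgn; case: (upper d); case: (upper e) => // _; lra.
by apply: (@arch_level d e t t') => //; rewrite -yE.
Qed.

Lemma vertex_sites d e : vert d = vert e ->
  (site l e = site l d /\ site l (opp e) = site l (opp d)) \/
  (site l e = site l (opp d) /\ site l (opp e) = site l d).
Proof.
move=> vE; have vE' : vert d = vert (opp e) by rewrite vert_opp.
have := site_opp l e; case: (vert_site l vE) => ->; case: (vert_site l vE') => -> ne.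
- by rewrite eqxx in ne.
- by left.
- by right.
by rewrite eqxx in ne.
Qed.

Lemma is_left_opp d : is_left (opp d) = ~~ is_left d.
Proof.
rewrite /is_left oppK; case: ltngtP => //= h.
by have := site_opp l d; rewrite h eqxx.
Qed.

Lemma arch_same_vertex d e t t' : 0 <= t <= 1/2 -> 0 <= t' <= 1/2 ->
  hx d t = hx e t' -> hy d t = hy e t' -> vert d = vert e -> d <> e -> t = 0 /\ t' = 0.
Proof.
move=> tP tP' xE yE vE de.
have cE : upper d = upper e by rewrite /upper vE.
have [_ _ _ h] := arch_facts d tP; have [_ _ _ h'] := arch_facts e tP'.
rewrite /U /W -cE -xE -yE in h h'.
have D := spot_opp d.
have [[sE sE']|[sE sE']] := vertex_sites vE.
  have lE : is_left e = is_left d by rewrite /is_left sE sE'.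
  have oE : out l e != out l d.
    by apply/eqP => oE; apply: de; apply/esym; exact: (site_inj sE oE).
  rewrite lE /spot sE sE' -!/(spot _) in h'.
  move: oE h h' D; rewrite /sgn; case: (out l e); case: (out l d) => // _; case: (is_left d) => h h' D;
    by case: h h' => h1 h2 [h3 h4]; try (case: h2 => ? ? ?); try (case: h4 => ? ? ?);
      split; [apply: h1 | apply: h3]; lra.
have lE : is_left e = ~~ is_left d by rewrite -is_left_opp /is_left oppK sE sE'.
rewrite lE /spot sE sE' -!/(spot _) in h'.
move: h h' D; rewrite /sgn; case: (is_left d) => /= h h' D; case: (out l e) h'; case: (out l d) h => h h';
  by case: h h' => h1 h2 [h3 h4]; try (case: h2 => ? ? ?); try (case: h4 => ? ? ?);
      split; [apply: h1 | apply: h3]; lra.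
Qed.

Lemma open_tail d t : ~~ closing d -> 1/2 <= t <= 1 ->
  [/\ hy d t = 0, 1/8 <= sgn R (out l d) * (hx d t - spot d) <= 1/2 &
      sgn R (out l d) * (hx d t - spot d) = 1/2 -> t = 1].
Proof. by move=> nc; apply: tail_open; rewrite /end_x /end_y (negbTE nc). Qed.

Lemma closing_tail d t : closing d -> 1/2 <= t <= 1 ->
  [/\ 0 <= hy d t <= end_y d, sgn R (out l d) * (hx d t - spot d) <= 3/8,
      0 <= sgn R (out l d) * (hx d t - end_x d), hx d t = end_x d -> t = 1 &
      hy d t = 0 -> t = 1/2 /\ hx d t = spot d + sgn R (out l d) / 4] /\
  (1/4 <= sgn R (out l d) * (hx d t - spot d) \/ hy d t = end_y d).
Proof.
move=> cl; have [h1 h2] := closing_end cl.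
by apply: tail_closing => //; exact: closing_out.
Qed.

Lemma level_tail d t : 1/2 <= t <= 1 -> hy d t = 0 ->
  1/8 <= sgn R (out l d) * (hx d t - spot d) <= 1/2.
Proof.
move=> tP y0; have [cl|nc] := boolP (closing d); last by have [_ h _] := open_tail nc tP.
have [[_ _ _ _ /(_ y0)[_ ->]] _] := closing_tail cl tP.
by rewrite /sgn; case: (out l d); lra.
Qed.

Lemma tail_inj d t t' : 1/2 <= t <= 1 -> 1/2 <= t' <= 1 ->
  hx d t = hx d t' -> hy d t = hy d t' -> t = t'.
Proof.
move=> tP tP' xE yE; have [cl|nc] := boolP (closing d).
  have [h1 h2] := closing_end cl.
  exact: (tail_closing_inj h1 h2 (conj xE yE)).
have EE : end_x d = spot d + sgn R (out l d) / 2 by rewrite /end_x (negbTE nc).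
exact: (tail_open_inj EE (conj xE yE)).
Qed.

Lemma arch_tail_level d e t t' : 0 <= t <= 1/2 -> 1/2 <= t' <= 1 ->
  hx d t = hx e t' -> hy d t = 0 -> hy e t' = 0 -> [/\ d = e, t = 1/2 & t' = 1/2].
Proof.
move=> tP tP' xE y0 y0'; have [_ _ /(_ y0)[t2 xd] _] := arch_facts d tP.
have h := level_tail tP' y0'.
have de : d = e.
  have oE : out l d = out l e /\ spot d = spot e.
    case: (spot_sep d e) => h1.
    - apply: absurd_le; move: h xd h1; rewrite -xE /sgn.
      by case: (out l d); case: (out l e); case: (is_left d); lra.
    - split; last by rewrite /spot h1.
      have E : spot d = spot e by rewrite /spot h1.
      apply/eqP/negP; move=> n; apply: absurd_le; move: n h xd; rewrite -xE -E /sgn.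
      by case: (out l d); case: (out l e) => //= _; case: (is_left d); lra.
    apply: absurd_le; move: h xd h1; rewrite -xE /sgn.
    by case: (out l d); case: (out l e); case: (is_left d); lra.
  by case: oE => oE sE; exact: same_spot.
split=> //; apply: (@tail_inj e) => //; first lra.
  by rewrite -xE de -t2.
by rewrite y0' -y0 de -t2.
Qed.

Lemma arch_block d t : 0 <= t <= 1/2 -> bottom d - 1/4 <= U d t /\ W d t <= top d + 1/4.
Proof.
move=> tP; have [_ h _ _] := arch_facts d tP.
by have [h1 h2 h3 h4 _] := spot_block d; case: (is_left d) h; lra.
Qed.

Lemma arch_roof d t : 0 <= t <= 1/2 -> -1/4 <= U d t /\ W d t <= roof - 2.
Proof.
move=> tP; have [_ h _ _] := arch_facts d tP.
have [_ _ _ _ h1] := spot_block d; have [_ _ _ _ h2] := spot_block (opp d).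
by case: (is_left d) h; lra.
Qed.

(** Open tails stay on the line. A closing tail rises at least 1/4 beyond the end of its block, out
    of reach of the arches, and runs over the block only at the height of the roof. *)
Lemma arch_tail d e t t' : 0 <= t <= 1/2 -> 1/2 <= t' <= 1 ->
  hx d t = hx e t' -> hy d t = hy e t' -> [/\ d = e, t = 1/2 & t' = 1/2].
Proof.
move=> tP tP' xE yE; have [y0|y0] := eqVneq (hy d t) 0.
  by apply: arch_tail_level => //; rewrite -yE.
have [cl|nc] := boolP (closing e); last first.
  by have [y1 _ _] := open_tail nc tP'; rewrite yE y1 eqxx in y0.
have [[h1 h2 _ _ _] h3] := closing_tail cl tP'; rewrite -xE -yE in h1 h2 h3.
have y1 : 0 < hy d t by rewrite lt_def y0; case/andP: h1.
have [h4 _ _ _] := arch_facts d tP.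
have [h5 h6] := arch_block d tP; have [h7 h8] := arch_roof d tP.
have cd : upper d by move: h4 y1; rewrite /U /W /sgn; case: (upper d) => // ? ?; apply: absurd_le; lra.
rewrite /U /W cd /sgn in h4 h5 h6 h7 h8.
have ey : end_y e = roof by rewrite /end_y cl.
have [h9 h10 _ _ _] := spot_block e.
apply: absurd_le; have sE := closing_spot cl.
have sep : [\/ top d + 1 <= bottom e, top e + 1 <= bottom d | bottom d = bottom e /\ top d = top e].
  have [/nat_lt h|[/nat_lt h|[h h']]] := block_disjoint l d e.
  - by constructor 1.
  - by constructor 2.
  by constructor 3; rewrite /bottom /top h h'.
have h11 : 1/4 <= sgn R (out l e) * (hx d t - spot e) by case: h3 => // E; lra.
move: h11 h2 sE h9 h10; rewrite /sgn; case: (out l e) => h11 h2 sE h9 h10; case: sep => [?|?|[? ?]]; lra.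
Qed.

(** Open tails cover half the distance to the next site, and the two closing tails of a block
    approach its centre from both sides, so opposite tails meet only at their ends. *)
Lemma tail_tail d e t t' : 1/2 <= t <= 1 -> 1/2 <= t' <= 1 ->
  hx d t = hx e t' -> hy d t = hy e t' -> out l d -> ~~ out l e ->
  [/\ t = 1, t' = 1 & e = edge d].
Proof.
move=> tP tP' xE yE od oe.
have [cd|nd] := boolP (closing d); have [ce|ne] := boolP (closing e).
- have [[_ h1 h2 h3 _] _] := closing_tail cd tP; have [[_ h1' h2' h3' _] _] := closing_tail ce tP'.
  rewrite od (negbTE oe) -xE /sgn in h1 h2 h1' h2'.
  have := closing_spot cd; have := closing_spot ce; rewrite od (negbTE oe) => sE' sE.
  have [/nat_lt h|[/nat_lt h|[h h']]] := block_disjoint l d e.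
  - apply: absurd_le; rewrite -/(top d) -/(bottom e) in h; lra.
  - apply: absurd_le; rewrite -/(top e) -/(bottom d) in h.
    by rewrite /end_x cd ce in h2 h2'; have [? ? _ _ _] := spot_block d; have [? ? _ _ _] := spot_block e; lra.
  have EE : end_x e = end_x d by rewrite /end_x cd ce /bottom /top h h'.
  have xe : hx d t = end_x d by lra.
  split; [exact: h3 | by apply: h3'; rewrite EE -xE |].
  apply: (@site_inj G l); last by rewrite out_edge od (negbTE oe).
  have [_ ->] := closing_edge_out od cd.
  by move/eqP: ce; rewrite (negbTE oe) => ->.
- have [[_ h1 h2 h3 h4] _] := closing_tail cd tP; have [y0 h5 _] := open_tail ne tP'.
  have [_ xd] : t = 1/2 /\ hx d t = spot d + sgn R (out l d) / 4 by apply: h4; rewrite yE.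
  apply: absurd_le; rewrite od (negbTE oe) -xE /sgn in h5 xd.
  case: (spot_sep d e) => h; try lra.
  by have E : spot d = spot e; [rewrite /spot h | lra].
- have [y0 h5 _] := open_tail nd tP; have [[_ h1 h2 h3 h4] _] := closing_tail ce tP'.
  have [_ xd] : t' = 1/2 /\ hx e t' = spot e + sgn R (out l e) / 4 by apply: h4; rewrite -yE.
  apply: absurd_le; rewrite od (negbTE oe) -xE /sgn in h5 xd.
  case: (spot_sep d e) => h; try lra.
  by have E : spot d = spot e; [rewrite /spot h | lra].
have [_ h1 h2] := open_tail nd tP; have [_ h1' h2'] := open_tail ne tP'.
rewrite od (negbTE oe) -xE /sgn in h1 h2 h1' h2'.
have sE : spot e = spot d + 1.
  have := nat_sep (site l e) (site l d).+1; rewrite -addn1 natrD -!/(spot _).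
  by case=> h; [lra | by rewrite /spot h natrD | lra].
split; [by apply: h2; lra | by apply: h2'; lra |].
have [_ E] := open_edge_out od nd.
apply: same_spot; last by rewrite out_edge od (negbTE oe).
by rewrite sE /spot E -addn1 natrD.
Qed.

Lemma tail_same d e t t' : 1/2 <= t <= 1 -> 1/2 <= t' <= 1 ->
  hx d t = hx e t' -> hy d t = hy e t' -> out l d = out l e -> d = e.
Proof.
move=> tP tP' xE yE oE; apply: same_spot => //.
have key d1 e1 s s' : 1/2 <= s <= 1 -> 1/2 <= s' <= 1 -> hx d1 s = hx e1 s' ->
    hy d1 s = hy e1 s' -> out l d1 = out l e1 -> spot d1 + 1 <= spot e1 -> False.
  move=> sP sP' x1 y1 o1 lt; have [y0|y0] := eqVneq (hy d1 s) 0.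
    have h := level_tail sP y0; have h' := level_tail sP' (etrans (esym y1) y0).
    rewrite -x1 -o1 /sgn in h h'; apply: absurd_le.
    by case: (out l d1) h h'; lra.
  have [cd|nd] := boolP (closing d1); last by have [z _ _] := open_tail nd sP; rewrite z eqxx in y0.
  have [ce|ne] := boolP (closing e1); last first.
    by have [z _ _] := open_tail ne sP'; rewrite y1 z eqxx in y0.
  have [[_ h1 h2 _ _] _] := closing_tail cd sP; have [[_ h1' h2' _ _] _] := closing_tail ce sP'.
  rewrite -x1 -o1 /end_x cd ce in h1 h2 h1' h2'.
  have := closing_spot cd; have := closing_spot ce; rewrite -o1 => sE' sE.
  have [? ? _ _ _] := spot_block d1; have [? ? _ _ _] := spot_block e1.
  apply: absurd_le; have [/nat_lt h|[/nat_lt h|[h h']]] := block_disjoint l d1 e1.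
  - rewrite -/(top d1) -/(bottom e1) in h; rewrite /sgn in h1 h2 h1' h2'.
    by case: (out l d1) h1 h2 h1' h2' sE sE'; lra.
  - rewrite -/(top e1) -/(bottom d1) in h; rewrite /sgn in h1 h2 h1' h2'.
    by case: (out l d1) h1 h2 h1' h2' sE sE'; lra.
  have [? ?] : bottom e1 = bottom d1 /\ top e1 = top d1 by rewrite /bottom /top h h'.
  by case: (out l d1) sE sE'; lra.
case: (spot_sep d e) => h; [by case: (key d e t t') | by rewrite /spot h |].
by case: (key e d t' t).
Qed.

Lemma half_edge_inj d e t t' : 0 <= t <= 1 -> 0 <= t' <= 1 ->
  hx d t = hx e t' -> hy d t = hy e t' ->
  [\/ d = e /\ t = t', [/\ t = 0, t' = 0 & vert d = vert e] |
      [/\ t = 1, t' = 1 & e = edge d]].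
Proof.
move=> tP tP' xE yE; have [t2|t2] := leP t (1/2); have [t2'|t2'] := leP t' (1/2).
- have tQ : 0 <= t <= 1/2 by lra.
  have tQ' : 0 <= t' <= 1/2 by lra.
  have vE := arch_vert tQ tQ' xE yE; have [de|/eqP de] := eqVneq d e.
    subst e; constructor 1; split=> //.
    exact: (arch_inj (spot_opp d) (conj xE yE)).
  by have [? ?] := arch_same_vertex tQ tQ' xE yE vE de; constructor 2.
- have tQ : 0 <= t <= 1/2 by lra.
  have tQ' : 1/2 <= t' <= 1 by lra.
  by have [de -> ->] := arch_tail tQ tQ' xE yE; constructor 1.
- have tQ : 1/2 <= t <= 1 by lra.
  have tQ' : 0 <= t' <= 1/2 by lra.
  by have [de -> ->] := arch_tail tQ' tQ (esym xE) (esym yE); constructor 1.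
have tQ : 1/2 <= t <= 1 by lra.
have tQ' : 1/2 <= t' <= 1 by lra.
have [oE|oE] := eqVneq (out l d) (out l e).
  have de := tail_same tQ tQ' xE yE oE; subst e; constructor 1; split=> //.
  exact: tail_inj xE yE.
have [od|od] := boolP (out l d).
  by have [] := tail_tail tQ tQ' xE yE od; [move: oE; rewrite od; case: (out l e) | constructor 3].
have oe : out l e by move: oE; rewrite (negbTE od); case: (out l e).
have [? ? E] := tail_tail tQ' tQ (esym xE) (esym yE) oe od.
by constructor 3; split=> //; rewrite E edgeK.
Qed.

(** Makes room for the circles, which are drawn at abscissas at most -2. *)
Lemma half_edge_right d t : 0 <= t <= 1 -> -1 < hx d t.
Proof.
move=> tP; have [h0 _ _ _ [h1 _]] := spot_block d; have [t2|t2] := leP t (1/2).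
  have tQ : 0 <= t <= 1/2 by lra.
  have [h _ _ _] := arch_facts d tQ; have [h' _] := arch_roof d tQ.
  by move: h h'; rewrite /U /W; lra.
have tQ : 1/2 <= t <= 1 by lra.
have [cl|nc] := boolP (closing d).
  have [[_ h2 h3 _ _] _] := closing_tail cl tQ.
  have [h4 h5 _ _ _] := spot_block d; have b0 : 0 <= bottom d by exact: ler0n.
  rewrite /end_x cl in h3; have := closing_spot cl.
  by move: h2 h3; rewrite /sgn; case: (out l d); lra.
have [_ h2 _] := open_tail nc tQ.
by move: h2; rewrite /sgn; case: (out l d); lra.
Qed.

End LayoutDrawing.

(** * The embedding and its framing *)

Section LayoutPlanar.
Variables (R : realType) (G : framed4graph) (l : layout G).
Local Notation plane := (R * R)%type.
Implicit Types d e : dart G.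

Definition half_edge d (t : R) : plane := (hx l d t, hy l d t).

(** At every time one of the two terms stands still at the common midpoint of the halves, which is
    subtracted; in this form continuity is immediate. *)
Definition drawn_edge d (t : R) : plane :=
  (hx l d (clamp 0 1 (2 * t)) + hx l (edge d) (clamp 0 1 (2 - 2 * t)) - end_x R l d,
   hy l d (clamp 0 1 (2 * t)) + hy l (edge d) (clamp 0 1 (2 - 2 * t)) - end_y R l d).

Definition drawn_vertex (v : vertex G) : plane := half_edge (sval (vertex_dart v)) 0.

(** The boundary of a right triangle of width 1; the shift by [2 i + 3] keeps these triangles apart
    and to the left of the rest. *)
Definition drawn_circle (i : nat) (t : R) : plane :=
  (clamp 0 1 (3 * t) - clamp 0 1 (3 * t - 1) - (2 * i%:R + 3),
   clamp 0 1 (3 * t - 1) - clamp 0 1 (3 * t - 2)).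

Lemma drawn_edge1 d t : 0 <= t <= 1/2 -> drawn_edge d t = half_edge d (2 * t).
Proof.
move=> tP; rewrite /drawn_edge (@clamp_id _ _ _ (2 * t)); last lra.
rewrite (@clamp_ge _ (2 - 2 * t)); last lra.
by rewrite hx1 hy1 end_x_edge end_y_edge !addrK.
Qed.

Lemma drawn_edge2 d t : 1/2 <= t <= 1 -> drawn_edge d t = half_edge (edge d) (2 - 2 * t).
Proof.
move=> tP; rewrite /drawn_edge (@clamp_id _ _ _ (2 - 2 * t)); last lra.
rewrite (@clamp_ge _ (2 * t)); last lra.
rewrite hx1 hy1 /half_edge; congr pair; ring.
Qed.

Lemma drawn_edge_half d t : 0 <= t <= 1 -> exists e s,
  [/\ drawn_edge d t = half_edge e s, 0 <= s <= 1 &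
      e = d /\ s = 2 * t \/ e = edge d /\ s = 2 - 2 * t].
Proof.
move=> tP; have [t2|t2] := leP t (1/2).
  by exists d, (2 * t); rewrite drawn_edge1; [split; [| lra | left] | lra].
by exists (edge d), (2 - 2 * t); rewrite drawn_edge2; [split; [| lra | right] | lra].
Qed.

Lemma half_edgeP d e t t' : 0 <= t <= 1 -> 0 <= t' <= 1 ->
  half_edge d t = half_edge e t' ->
  [\/ d = e /\ t = t', [/\ t = 0, t' = 0 & vert d = vert e] |
      [/\ t = 1, t' = 1 & e = edge d]].
Proof. by move=> tP tP' [xE yE]; exact: half_edge_inj tP tP' xE yE. Qed.

Lemma half_edge0 d e : vert d = vert e -> half_edge d 0 = half_edge e 0.
Proof.
move=> vE; rewrite /half_edge !hx0 !hy0.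
have cE : upper l d = upper l e by rewrite /upper vE.
have [[sE sE']|[sE sE']] := vertex_sites l vE.
  by rewrite cE /is_left /spot sE sE'.
have lE : is_left l e = ~~ is_left l d by rewrite -is_left_opp /is_left oppK sE sE'.
rewrite cE lE /spot sE sE' addrC; congr pair; congr (_ * _).
by rewrite /sgn; case: (is_left l d) => /=; ring.
Qed.

Lemma drawn_vertexE d : drawn_vertex (vert d) = half_edge d 0.
Proof. by apply: half_edge0; case: (vertex_dart (vert d)) => e /= /eqP. Qed.

Lemma cts_polyline (a b c d e : R) : cts (polyline a b c d e).
Proof. by rewrite /polyline; ct. Qed.

Lemma cts_hx d (f : R -> R) : cts f -> cts (fun t => hx l d (f t)).
Proof. exact: ctcomp (@cts_polyline _ _ _ _ _). Qed.

Lemma cts_hy d (f : R -> R) : cts f -> cts (fun t => hy l d (f t)).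
Proof. exact: ctcomp (@cts_polyline _ _ _ _ _). Qed.

Lemma cts_drawn_edge d : cts (drawn_edge d).
Proof.
have c1 : cts (fun t : R => clamp 0 1 (2 * t)) by ct.
have c2 : cts (fun t : R => clamp 0 1 (2 - 2 * t)) by ct.
apply: ctP; apply: ctD; try exact: ctC; apply: ctD;
  [exact: cts_hx c1 | exact: cts_hx c2 | exact: cts_hy c1 | exact: cts_hy c2].
Qed.

Lemma cts_drawn_circle i : cts (drawn_circle i).
Proof. by rewrite /drawn_circle; ct. Qed.

Lemma drawn_circle_inj (i j : nat) t t' : 0 <= t < 1 -> 0 <= t' < 1 ->
  drawn_circle i t = drawn_circle j t' -> i = j /\ t = t'.
Proof.
have val k s : 0 <= s < 1 -> exists x y, [/\ drawn_circle k s = (x - (2 * k%:R + 3), y), 0 <= x <= 1 &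
    [\/ 0 <= s <= 1/3 /\ (x = 3 * s /\ y = 0),
        1/3 <= s <= 2/3 /\ (x = 2 - 3 * s /\ y = 3 * s - 1) |
        2/3 <= s /\ (x = 0 /\ y = 3 - 3 * s)]].
  move=> sP; rewrite /drawn_circle; have [s1|s1] := leP s (1/3).
    rewrite (@clamp_id _ _ _ (3 * s)); last lra.
    rewrite (@clamp_le _ (3 * s - 1)); last lra.
    rewrite (@clamp_le _ (3 * s - 2)); last lra.
    by exists (3 * s), 0; rewrite !subr0; split=> //; [lra | constructor 1; lra].
  have [s2|s2] := leP s (2/3).
    rewrite (@clamp_ge _ (3 * s)); last lra.
    rewrite (@clamp_id _ _ _ (3 * s - 1)); last lra.
    rewrite (@clamp_le _ (3 * s - 2)); last lra.
    by exists (1 - (3 * s - 1)), (3 * s - 1); rewrite !subr0; split=> //; [lra | constructor 2; lra].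
  rewrite (@clamp_ge _ (3 * s)); last lra.
  rewrite (@clamp_ge _ (3 * s - 1)); last lra.
  rewrite (@clamp_id _ _ _ (3 * s - 2)); last lra.
  by exists (1 - 1), (1 - (3 * s - 2)); split=> //; [lra | constructor 3; lra].
move=> tP tP' E; have [x [y [E1 xP c1]]] := val i t tP; have [x' [y' [E2 xP' c2]]] := val j t' tP'.
move: E; rewrite E1 E2 => -[xE yE].
have ij : i = j by case: (nat_sep R i j) => // h; apply: (@absurd_le R); lra.
split=> //; rewrite ij in xE.
by case: c1 => [[? [? ?]]|[? [? ?]]|[? [? ?]]]; case: c2 => [[? [? ?]]|[? [? ?]]|[? [? ?]]]; lra.
Qed.

Lemma drawn_circle_left i t : (drawn_circle i t).1 <= -2.
Proof.
rewrite /drawn_circle /=; have := @clamp_itv R 0 1 (3 * t) ler01.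
have := @clamp_itv R 0 1 (3 * t - 1) ler01; have : 0 <= i%:R :> R by exact: ler0n.
lra.
Qed.

Lemma drawn_embedding :
  embedding drawn_vertex drawn_edge (fun i : 'I_(ncirc G) => drawn_circle i).
Proof.
split.
- move=> d; split.
  + by apply: continuous_subspaceT; exact: cts_drawn_edge.
  + by rewrite drawn_edge1 ?mulr0 ?drawn_vertexE //; lra.
  move=> t tP; have [t2|t2] := leP t (1/2).
    by rewrite drawn_edge1 ?drawn_edge2; [congr half_edge; ring | lra | lra].
  by rewrite drawn_edge2 ?drawn_edge1 ?edgeK; [congr half_edge; ring | lra | lra].
- move=> i; split; first by apply: continuous_subspaceT; exact: cts_drawn_circle.
  rewrite /drawn_circle (@clamp_le _ (3 * 0)); last lra.
  rewrite (@clamp_le _ (3 * 0 - 1)); last lra.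
  rewrite (@clamp_le _ (3 * 0 - 2)); last lra.
  rewrite (@clamp_ge _ (3 * 1)); last lra.
  rewrite (@clamp_ge _ (3 * 1 - 1)); last lra.
  rewrite (@clamp_ge _ (3 * 1 - 2)); last lra.
  by rewrite !subrr.
- have zero : 0 <= (0 : R) <= 1 by lra.
  have vd (v : vertex G) : vert (sval (vertex_dart v)) = v by case: (vertex_dart v) => e /= /eqP.
  split=> [u v|d v t tP E].
    case/(half_edgeP zero zero) => [[E _]|[_ _]|[E _ _]].
    + by rewrite -(vd u) E.
    + by rewrite !vd.
    by apply: (@absurd_le R); lra.
  have [|e [s [eE sP sE]]] := @drawn_edge_half d t; first lra.
  move: E; rewrite eE => /(half_edgeP sP zero)[[_ ?]|[? _ _]|[_ ? _]];
    by apply: (@absurd_le R); case: sE => -[_ ?]; lra.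
- move=> d d' t t' tP tP' E.
  have [|e [s [eE sP sE]]] := @drawn_edge_half d t; first lra.
  have [|e' [s' [eE' sP' sE']]] := @drawn_edge_half d' t'; first lra.
  move: E; rewrite eE eE' => /(half_edgeP sP sP')[[ee ss]|[? _ _]|[s1 s1' ee]].
  + case: sE => -[h1 ?]; case: sE' => -[h2 ?]; rewrite h1 h2 in ee.
    * by left; split; [rewrite ee | lra].
    * by right; split; [rewrite ee edgeK | lra].
    * by right; split; [rewrite ee | lra].
    by left; split; [apply: (can_inj (@edgeK G)) | lra].
  + by apply: (@absurd_le R); case: sE => -[_ ?]; lra.
  have [t2 t2'] : t = 1/2 /\ t' = 1/2.
    by case: sE => -[_ ?]; case: sE' => -[_ ?]; lra.
  rewrite t2 t2'; case: sE => -[h1 _]; case: sE' => -[h2 _]; rewrite h1 h2 in ee.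
  + by right; split=> //; lra.
  + by left; split=> //; apply: (can_inj (@edgeK G)).
  + by left; split=> //; rewrite ee edgeK.
  by right; split; [apply: (can_inj (@edgeK G)) | lra].
split.
  by move=> i j t t' tP tP' /(drawn_circle_inj tP tP')[/val_inj ij tt].
move=> i d t t' tP tP' E.
have [e [s [eE sP _]]] := @drawn_edge_half d t' tP'.
have := drawn_circle_left i t; rewrite E eE /=; have := half_edge_right l e sP.
by move=> h h'; apply: (@absurd_le R); lra.
Qed.

Lemma start_half_edge d t : 0 <= t <= 1/4 ->
  half_edge d t =
    ((spot R l d + spot R l (opp d)) / 2 - sgn R (is_left l d) / 4 * t,
     sgn R (upper l d) * (sgn R (is_left l d) * (spot R l (opp d) - spot R l d)
       - 3 * sgn R (out l d) * sgn R (is_left l d) / 2 * t)).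
Proof.
by move=> tP; rewrite /half_edge /hx /hy /half_x /half_y !polyline1 //; congr pair; field.
Qed.

(* The four half-edges leave the vertex along the lines of slope [6] and [-6],
   opposite ones in opposite directions, so that a linear chart suffices. *)
Lemma drawn_framing v : framing_preserved drawn_vertex drawn_edge v.
Proof.
pose a := sval (vertex_dart v); have va : vert a = v by apply/eqP; exact: (svalP (vertex_dart v)).
(* [b] is the other half-edge at the site of [a]; its [out] differs from that of [a] and [opp a], so
   it is adjacent to [a]. *)
have [b [sE oE]] := site_mate l a; have vE := site_vert sE.
have sOE : site l (opp b) = site l (opp a).
  by have [[]|[E _]] := vertex_sites l (esym vE); [|have := site_opp l a; rewrite -E -sE eqxx].
have lE : is_left l b = is_left l a by rewrite /is_left sE sOE.
have loa := is_left_opp l a; have lob := is_left_opp l b; rewrite lE in lob.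
pose m : R := (spot R l a + spot R l (opp a)) / 2.
pose s : R := sgn R (upper l a).
pose h : R := sgn R (is_left l a) * (spot R l (opp a) - spot R l a).
pose la : R := sgn R (is_left l a); pose o : R := sgn R (out l a).
(* [f] straightens the two lines through the apex: half-edges with the same [out] as [a] go to the
   first axis, the others to the second. *)
pose f (z : plane) : plane :=
  (- la * (2 * (z.1 - m) + o * (s * z.2 - h) / 3), - la * (2 * (z.1 - m) - o * (s * z.2 - h) / 3)).
pose g (z : plane) : plane :=
  (m - la * (z.1 + z.2) / 4, s * (h - la * o * 3 * (z.1 - z.2) / 2)).
have fg z : g (f z) = z.
  case: z => z1 z2; rewrite /f /g /s /h /la /o /sgn /=; congr pair;
    by case: (upper l a); case: (is_left l a); case: (out l a); lra.
have gf z : f (g z) = z.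
  case: z => z1 z2; rewrite /f /g /s /h /la /o /sgn /=; congr pair;
    by case: (upper l a); case: (is_left l a); case: (out l a); lra.
have cf : cts f by rewrite /f; ct.
have cgs : cts g by rewrite /g; ct.
have fv e t : 0 <= t <= 1/4 -> vert e = vert a ->
    f (half_edge e t) = if out l e == out l a then (la * sgn R (is_left l e) * t, 0)
                        else (0, la * sgn R (is_left l e) * t).
  move=> tP ve; have c0 : upper l e = upper l a by rewrite /upper ve.
  rewrite start_half_edge // /f /la /h /m /s /o c0.
  have [E E'] : (spot R l e + spot R l (opp e) = spot R l a + spot R l (opp a)) /\
      sgn R (is_left l e) * (spot R l (opp e) - spot R l e) =
      sgn R (is_left l a) * (spot R l (opp a) - spot R l a).
    have [] := half_edge0 ve; rewrite !hx0 !hy0 c0 => E1 E2; split; first lra.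
    by move: E2; rewrite [sgn R (upper l a)]/sgn; case: (upper l a); lra.
  rewrite E E'; move: (sgn R (is_left l a) * (spot R l (opp a) - spot R l a)) ((spot R l a + spot R l (opp a)) / 2).
  move=> h0 m0.
  by rewrite /sgn; case: (out l e); case: (out l a); case: (upper l a); rewrite /=; congr pair; field.
have start e (u : plane) : vert e = vert a ->
    (if out l e == out l a then (la * sgn R (is_left l e), 0)
                        else (0, la * sgn R (is_left l e))) = u -> starts_along f (drawn_edge e) u.
  move=> ve <-; rewrite /starts_along; near=> t.
  have t0 : 0 < t by near: t; exact: nbhs_right_gt.
  have t8 : t < 1/8 by near: t; apply: nbhs_right_lt; lra.
  exists (2 * t); first lra.
  rewrite drawn_edge1; last lra.
  rewrite fv //; last lra.
  by case: ifP => _ /=; congr pair; ring.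
exists setT, setT, f, g, a, b; split.
- split=> //; first by split; exact: openT.
  + by move=> x _; exact: cf.
  + by move=> x _; exact: cgs.
- split=> //; rewrite -va drawn_vertexE fv //; last lra.
  by rewrite eqxx mulr0.
- split=> //; [by rewrite -va -vE| |].
  + by move=> ba; move: oE; rewrite ba; case: (out l a).
  + by move=> ba; move: oE; rewrite ba out_opp; case: (out l a).
- split; apply: start; rewrite ?vert_opp ?out_opp ?eqxx ?loa //.
  + by rewrite /la /sgn; case: (is_left l a); congr pair; lra.
  by rewrite /la /sgn; case: (is_left l a) => /=; congr pair; lra.
have nb (c : bool) : (~~ c == c) = false by case: c.
split; apply: start; rewrite ?vert_opp ?out_opp ?lob ?lE ?oE ?nb //.
+ by rewrite /la /sgn; case: (is_left l a); congr pair; lra.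
by rewrite /la /sgn; case: (is_left l a) => /=; congr pair; lra.
Unshelve. all: by end_near.
Qed.

Lemma layout_planar : planar R G.
Proof.
exists drawn_vertex, drawn_edge, (fun i : 'I_(ncirc G) => drawn_circle i).
by split; [exact: drawn_embedding | exact: drawn_framing].
Qed.

End LayoutPlanar.

Theorem theorem1 (R : realType) (P : framed4graph) :
  (~ planar R P <-> minor Gamma P \/ minor Delta P) /\
  (~ planar R P <-> sminor Gamma P).
Proof.
have sn : sminor Gamma P -> ~ planar R P.
  by move=> /sminor_Gamma_crossing_circuits; exact: crossing_circuits_nonplanar.
have ms : minor Gamma P \/ minor Delta P -> sminor Gamma P.
  by case=> [/sminor_of_minor|/sminor_Delta_Gamma].
have nm : ~ planar R P -> minor Gamma P \/ minor Delta P.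
  move=> np; apply: contrapT => nGD; apply: np.
  by have [] := @layout_ex P; [tauto | tauto | move=> l; exact: layout_planar].
(* The implications form a cycle from non-planar to minor to s-minor and back. *)
by split; split=> [/nm|] //; move/ms/sn.
Qed.
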